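(* Let $\mathbb{F}$ be an algebraically closed field of characteristic $p>2$, let $\mathfrak g=\mathfrak g_{\bar0}\oplus\mathfrak g_{\bar1}$ be a finite-dimensional Lie superalgebra over $\mathbb{F}$ with $[\mathfrak g_{\bar1},\mathfrak g_{\bar1}]=0$, equipped with a symmetric bilinear form $\langle\cdot,\cdot\rangle$ such that $\langle\mathfrak g_{\bar0},\mathfrak g_{\bar1}\rangle=0$ and $\langle[a,u],v\rangle=-\langle u,[a,v]\rangle$ for $a\in\mathfrak g_{\bar0}$, $u,v\in\mathfrak g$. Let $\tau$ be an automorphism of $\mathfrak g$ preserving $\langle\cdot,\cdot\rangle$, of finite order $T$ relatively prime to $p$, and denote also by $\tau$ the induced automorphism of the vertex superalgebra $V_{\widehat{\mathfrak g}}(\ell,0)$, $\ell\in\mathbb{F}$. Then any locally truncated $\widehat{\mathfrak g}[\tau]$-module $M$ of level $\ell$ is a $\tau$-twisted $V_{\widehat{\mathfrak g}}(\ell,0)$-module (with $a\in\mathfrak g$ acting by $Y_M(a,z)=a_\tau(z)$).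
   Context: Conventions. $\mathbb{D}=\{m/n\in\mathbb{Q}:p\nmid n\}$ maps to $\mathbb{F}$ via $\mathbb{D}\to\mathbb{Z}/p\subset\mathbb{F}$; binomials $\binom\alpha i$, $\alpha\in\mathbb{D}$, and rational coefficients in $\mathbb{D}$ are read in $\mathbb{F}$; $(z_1+z_2)^\alpha:=\sum_{i\ge0}\binom\alpha iz_1^{\alpha-i}z_2^i$; $\delta(z)=\sum_{n\in\mathbb{Z}}z^n$. A vertex superalgebra is a $\mathbb{Z}_2$-graded space $V$ with an even vector $\mathbf 1$ and a linear map $v\mapsto Y(v,x)=\sum_{n\in\mathbb{Z}}v_nx^{-n-1}\in(\mathrm{End}\,V)[[x,x^{-1}]]$ with $u_nv$ of parity $|u|+|v|$, $u_nv=0$ for $n$ large, $Y(\mathbf 1,x)=1_V$, $Y(v,x)\mathbf 1\in V[[x]]$ with constant term $v$, and the Jacobi identity $$x_0^{-1}\delta\Big(\tfrac{x_1-x_2}{x_0}\Big)Y(u,x_1)Y(v,x_2)-(-1)^{|u||v|}x_0^{-1}\delta\Big(\tfrac{x_2-x_1}{-x_0}\Big)Y(v,x_2)Y(u,x_1)=x_2^{-1}\delta\Big(\tfrac{x_1-x_0}{x_2}\Big)Y(Y(u,x_0)v,x_2).$$ Let $\eta$ be a primitive $T$-th root of unity. For an automorphism $g$ of $V$ with $g^T=1$ and $V^r=\{v:gv=\eta^rv\}$, a $g$-twisted $V$-module is a vector space $W$ with a linear map $v\mapsto Y_W(v,x)=\sum_{n\in\frac1T\mathbb{Z}}v_nx^{-n-1}\in(\mathrm{End}\,W)[[x^{1/T},x^{-1/T}]]$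 such that for $u\in V^r$ ($0\le r<T$): $Y_W(u,x)=\sum_{n\in\frac rT+\mathbb{Z}}u_nx^{-n-1}$; $u_nw=0$ for $n$ large; $Y_W(\mathbf 1,x)=1_W$; and the Jacobi identity holds with $Y$ on the left replaced by $Y_W$ and right side replaced by $x_2^{-1}\delta\big(\tfrac{x_1-x_0}{x_2}\big)\big(\tfrac{x_1-x_0}{x_2}\big)^{-r/T}Y_W(Y(u,x_0)v,x_2)$. ($W$ need not be $\mathbb{Z}_2$-graded.) Affine Lie superalgebra: $\widehat{\mathfrak g}=\mathfrak g\otimes\mathbb{F}[t,t^{-1}]\oplus\mathbb{F}\mathbf k$, $\mathbf k$ central and even, with for $a,b\in\mathfrak g_{\bar0}$, $u,v\in\mathfrak g_{\bar1}$, $m,n\in\mathbb{Z}$: $[a\otimes t^m,b\otimes t^n]=[a,b]\otimes t^{m+n}+m\delta_{m+n,0}\langle a,b\rangle\mathbf k$, $[a\otimes t^m,u\otimes t^n]=[a,u]\otimes t^{m+n}$, $[u\otimes t^m,v\otimes t^n]=\delta_{m+n+1,0}\langle u,v\rangle\mathbf k$. $V_{\widehat{\mathfrak g}}(\ell,0)$ is the $\widehat{\mathfrak g}$-module induced from the one-dimensional module of $\mathfrak g\otimes\mathbb{F}[t]\oplus\mathbb{F}\mathbf k$ on which $\mathfrak g\otimes\mathbb{F}[t]$ acts as $0$ and $\mathbf k$ as $\ell$; with $\mathbf 1=1\otimes1$ and $\mathfrak g$ embedded by $a\mapsto(a\otimes t^{-1})\mathbf 1$, it has a unique vertex superalgebra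 structure with vacuum $\mathbf 1$ and $Y(a,x)=\sum_{n\in\mathbb{Z}}(a\otimes t^n)x^{-n-1}$ for $a\in\mathfrak g$. $\tau$ acts on $\widehat{\mathfrak g}$ by $\tau(a\otimes t^n)=\tau(a)\otimes t^n$, $\tau(\mathbf k)=\mathbf k$, which induces an automorphism of $V_{\widehat{\mathfrak g}}(\ell,0)$. Twisted affine Lie superalgebra: with $\mathfrak g_i=\{a:\tau a=\eta^ia\}$, $\widehat{\mathfrak g}[\tau]=\bigoplus_{i=0}^{T-1}\mathfrak g_i\otimes t^{i/T}\mathbb{F}[t,t^{-1}]\oplus\mathbb{F}\mathbf k$, $\mathbf k$ central, with the same brackets for exponents $m,n\in\frac1T\mathbb{Z}$ (i.e. for $a,b$ even and $u,v$ odd eigenvectors with admissible exponents: $[a\otimes t^m,b\otimes t^n]=[a,b]\otimes t^{m+n}+m\delta_{m+n,0}\langle a,b\rangle\mathbf k$, $[a\otimes t^m,u\otimes t^n]=[a,u]\otimes t^{m+n}$, $[u\otimes t^m,v\otimes t^n]=\delta_{m+n+1,0}\langle u,v\rangle\mathbf k$). A $\widehat{\mathfrak g}[\tau]$-module (not necessarily $\mathbb{Z}_2$-graded) $M$ is locally truncated if for every $w\in M$, $(\mathfrak g_i\otimes t^{n+i/T})w=0$ for all sufficiently large $n$; it has level $\ell$ if $\mathbf k$ acts as $\ell$. For $a\in\mathfrak g_i$, $a_\tau(z)=\sum_{n\in\mathbb{Z}}(a\otimes t^{n+i/T})z^{-n-1-i/T}$, extended linearly to $a\in\mathfrak g$.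 *)

(* Defs.v *)
From HB Require Import structures.
From mathcomp Require Import all_boot all_order all_algebra all_field.
From mathcomp Require Import finmap generic_quotient ring_quotient.
From mathcomp Require Import boolp classical_sets fsbigop.
From mathcomp.multinomials Require Import monalg.
Set Implicit Arguments.
Unset Strict Implicit.
Unset Printing Implicit Defensive.
Import Order.TTheory GRing.Theory Num.Theory.
Local Open Scope classical_set_scope.
Local Open Scope ring_scope.
Local Open Scope quotient_scope.

(******************************************************************************)
(* Conventions                                                                *)
(* - Parities are booleans, false being even and true odd; (-1) ^+ (i && j)   *)
(*   is the Koszul sign.                                                      *)
(* - A field Y(u, x) = \sum_n u_n x^(-n-1) is given by its modes n |-> u_n,   *)
(*   so that the coefficient of x^q in Y(u, x) is u_(-q-1).                   *)
(* - {malg G[K]} is the type of finitely supported functions K -> G, and      *)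
(*   << a *g n >> is the function with value a at n and 0 elsewhere. It is    *)
(*   used for g (x) F[t, t^-1] (with << a *g n >> standing for a (x) t^n) and *)
(*   for free associative algebras.                                           *)
(******************************************************************************)

(* Quotient of a vector space by the span of a set of vectors *)

Section SpanQuotient.
Variables (F : fieldType) (U : lmodType F) (G : U -> Prop).

Inductive lspan : U -> Prop :=
| lspan0 : lspan 0
| lspan_cons (c : F) (v w : U) : G v -> lspan w -> lspan (c *: v + w).

Lemma lspan_lin c x y : lspan x -> lspan y -> lspan (c *: x + y).
Proof.
move=> + Hy; elim=> [|d v w Gv _ IH]; first by rewrite scaler0 add0r.
by rewrite scalerDr scalerA -addrA; apply: lspan_cons.
Qed.

Definition lspanb (x : U) : bool := `[< lspan x >].

Lemma lspanb_zmod_closed : zmod_closed lspanb.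
Proof.
split=> [|x y /asboolP Hx /asboolP Hy]; first exact/asboolP/lspan0.
by apply/asboolP; rewrite addrC -scaleN1r; apply: lspan_lin.
Qed.

HB.instance Definition _ := GRing.isZmodClosed.Build U lspanb lspanb_zmod_closed.

Definition lspan_zmod := GRing.ZmodClosed.clone U lspanb _.

Definition lquot := Quotient.quot lspan_zmod.

HB.instance Definition _ := GRing.Zmodule.on lquot.

Definition lquot_pi (x : U) : lquot := \pi_(Quotient.quot lspan_zmod) x.
Definition lquot_repr (x : lquot) : U := repr (x : Quotient.quot lspan_zmod).

Lemma lquot_reprK : cancel lquot_repr lquot_pi.
Proof. by move=> x; rewrite /lquot_pi /lquot_repr reprK. Qed.

Lemma lquot_eqP x y : lquot_pi x = lquot_pi y <-> lspan (x - y).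
Proof.
have -> : (lquot_pi x = lquot_pi y) <-> (x == y %[mod Quotient.quot lspan_zmod]).
  by split=> [/eqP|/eqP].
by rewrite -Quotient.idealrBE; split=> /asboolP.
Qed.

Lemma lquot_piD x y : lquot_pi (x + y) = lquot_pi x + lquot_pi y.
Proof. by rewrite /lquot_pi raddfD. Qed.

Definition lquot_scale (c : F) (x : lquot) : lquot :=
  lquot_pi (c *: lquot_repr x).

Lemma lquot_piZ c x : lquot_scale c (lquot_pi x) = lquot_pi (c *: x).
Proof.
apply/lquot_eqP; rewrite -scalerBr -[_ *: _]addr0.
by apply: lspan_lin; [apply/lquot_eqP; rewrite lquot_reprK | apply: lspan0].
Qed.

Lemma lquot_scaleA c d x :
  lquot_scale c (lquot_scale d x) = lquot_scale (c * d) x.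
Proof. by rewrite -[x]lquot_reprK !lquot_piZ scalerA. Qed.

Lemma lquot_scale1 : left_id 1 lquot_scale.
Proof. by move=> x; rewrite -[x]lquot_reprK lquot_piZ scale1r. Qed.

Lemma lquot_scaleDr : right_distributive lquot_scale +%R.
Proof.
move=> c x y; rewrite -[x]lquot_reprK -[y]lquot_reprK.
by rewrite -lquot_piD !lquot_piZ scalerDr lquot_piD.
Qed.

Lemma lquot_scaleDl x : {morph lquot_scale^~ x : c d / c + d}.
Proof.
by move=> c d; rewrite -[x]lquot_reprK !lquot_piZ scalerDl lquot_piD.
Qed.

HB.instance Definition _ := GRing.Zmodule_isLmodule.Build F lquot
  lquot_scaleA lquot_scale1 lquot_scaleDr lquot_scaleDl.

End SpanQuotient.

(* Lie superalgebras *)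

Section LieSuper.
Variables (F : fieldType) (g : vectType F) (gpar : bool -> {vspace g}).
Variable br : g -> g -> g.

(* The last axiom only matters in characteristic 3. *)
Record is_lie_superalgebra : Prop := IsLieSuperalgebra {
  lie_sum : (gpar false + gpar true)%VS = fullv;
  lie_direct : (gpar false :&: gpar true)%VS = 0%VS;
  lie_linearl : forall c a b d, br (c *: a + b) d = c *: br a d + br b d;
  lie_linearr : forall c a b d, br d (c *: a + b) = c *: br d a + br d b;
  lie_graded : forall i j a b, a \in gpar i -> b \in gpar j ->
    br a b \in gpar (i (+) j);
  lie_skew : forall i j a b, a \in gpar i -> b \in gpar j ->
    br a b = - ((-1) ^+ (i && j) *: br b a);
  lie_jacobi : forall i j a b d, a \in gpar i -> b \in gpar j ->
    br a (br b d) = br (br a b) d + (-1) ^+ (i && j) *: br b (br a d);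
  lie_cube : forall u, u \in gpar true -> br u (br u u) = 0
}.

Record is_lie_automorphism (tau : 'End(g)) : Prop := IsLieAutomorphism {
  aut_bij : bijective tau;
  aut_par : forall i a, a \in gpar i -> tau a \in gpar i;
  aut_br : forall a b, tau (br a b) = br (tau a) (tau b)
}.

Variable form : g -> g -> F.

Record is_invariant_form : Prop := IsInvariantForm {
  form_linear : forall c a b d, form (c *: a + b) d = c * form a d + form b d;
  form_sym : forall a b, form a b = form b a;
  form_orth : forall a u, a \in gpar false -> u \in gpar true -> form a u = 0;
  form_inv : forall a u v, a \in gpar false ->
    form (br a u) v = - form u (br a v)
}.

End LieSuper.

Definition has_order (T : Type) (f : T -> T) (n : nat) : Prop :=
  (0 < n)%N /\ forall m, (forall x, iter m f x = x) <-> (n %| m)%N.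

(* The vector space g (x) F[t^K], with exponents in K. *)

Section Loop.
Variables (F : fieldType) (g : lmodType F) (K : choiceType).

Definition loop := {malg g[K]}.

HB.instance Definition _ := GRing.Zmodule.on loop.

Definition loop_scale (c : F) (f : loop) : loop :=
  [malg k in msupp f => c *: f@_k].

Lemma loop_scaleE c f k : (loop_scale c f)@_k = c *: f@_k.
Proof. by rewrite mcoeffE; case: msuppP; rewrite ?scaler0. Qed.

Lemma loop_scaleA c d f : loop_scale c (loop_scale d f) = loop_scale (c * d) f.
Proof. by apply/malgP => k; rewrite !loop_scaleE scalerA. Qed.

Lemma loop_scale1 : left_id 1 loop_scale.
Proof. by move=> f; apply/malgP => k; rewrite loop_scaleE scale1r. Qed.

Lemma loop_scaleDr : right_distributive loop_scale +%R.
Proof.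
by move=> c f h; apply/malgP => k; rewrite mcoeffD !loop_scaleE mcoeffD scalerDr.
Qed.

Lemma loop_scaleDl f : {morph loop_scale^~ f : c d / c + d}.
Proof.
by move=> c d; apply/malgP => k; rewrite mcoeffD !loop_scaleE scalerDl.
Qed.

HB.instance Definition _ := GRing.Zmodule_isLmodule.Build F loop
  loop_scaleA loop_scale1 loop_scaleDr loop_scaleDl.

End Loop.

(* The affine superalgebra is affine g int with iota the canonical map        *)
(* int -> F. The twisted one is the subspace twisted_affine of affine g rat,  *)
(* with iota = ratr, which reads a rational with denominator prime to p in F. *)

Section Affine.
Variables (F : fieldType) (g : vectType F) (gpar : bool -> {vspace g}).
Variables (br : g -> g -> g) (form : g -> g -> F).

Definition affine (K : choiceType) := (loop g K * F^o)%type.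

Definition tens (K : choiceType) (a : g) (n : K) : affine K := (<< a *g n >>, 0).

Definition kk (K : choiceType) : affine K := (0, 1).

Definition affine_par (K : choiceType) (i : bool) (x : affine K) : Prop :=
  (forall n, x.1@_n \in gpar i) /\ (i -> x.2 = 0).

(* The component of a of parity i, for a direct sum g = g_0 + g_1. *)
Definition par_part (i : bool) (a : g) : g :=
  daddv_pi (gpar i) (gpar (~~ i)) a.

Definition affine_br (K : nzRingType) (iota : K -> F) (x y : affine K) :
    affine K :=
  (\sum_(m <- msupp x.1) \sum_(n <- msupp y.1)
      << br x.1@_m y.1@_n *g m + n >>,
   \sum_(m <- msupp x.1) \sum_(n <- msupp y.1)
      ((if m + n == 0
        then iota m * form (par_part false x.1@_m) (par_part false y.1@_n)
        else 0) +
       (if m + n + 1 == 0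
        then form (par_part true x.1@_m) (par_part true y.1@_n)
        else 0))).

(* A module for a graded subspace S of affine K that is closed under          *)
(* affine_br, as twisted_affine is when tau is an automorphism; values of rho *)
(* outside S are irrelevant.                                                  *)
Record is_affine_module (K : nzRingType) (iota : K -> F) (S : affine K -> Prop)
    (M : lmodType F) (rho : affine K -> M -> M) : Prop := IsAffineModule {
  rho_linearl : forall c x y w, S x -> S y ->
    rho (c *: x + y) w = c *: rho x w + rho y w;
  rho_linearr : forall c x v w, S x ->
    rho x (c *: v + w) = c *: rho x v + rho x w;
  rho_br : forall i j x y w, S x -> S y -> affine_par i x -> affine_par j y ->
    rho (affine_br iota x y) w =
      rho x (rho y w) - (-1) ^+ (i && j) *: rho y (rho x w)
}.

Definition has_level (K : choiceType) (M : lmodType F)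
    (rho : affine K -> M -> M) (l : F) : Prop :=
  forall w, rho (kk K) w = l *: w.

End Affine.

Arguments tens {F g K} a n.
Arguments kk {F g K}.

Section Twisted.
Variables (F : fieldType) (g : vectType F) (tau : 'End(g)) (eta : F) (T : nat).

Definition eigen (i : nat) (a : g) : Prop := tau a = eta ^+ i *: a.

Definition twisted_affine (x : affine g rat) : Prop :=
  forall q, x.1@_q != 0 -> exists i, [/\ (i < T)%N,
    q - i%:R / T%:R \is a Num.int & eigen i x.1@_q].

Definition locally_truncated (M : lmodType F) (rho : affine g rat -> M -> M) :
    Prop :=
  forall w i, (i < T)%N -> exists N : int, forall n : int, N <= n ->
    forall a, eigen i a -> rho (tens a (n%:~R + i%:R / T%:R)) w = 0.

(* The modes of a_tau(z), for a in g_i. *)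
Definition tau_field (M : lmodType F) (rho : affine g rat -> M -> M)
    (i : nat) (a : g) (q : rat) (w : M) : M :=
  if q - i%:R / T%:R \is a Num.int then rho (tens a q) w else 0.

End Twisted.

(* The induced module U(L) (x)_U(P) F_l, with L the affine superalgebra and   *)
(* P = g (x) F[t] + F k. With A the free associative algebra on the set L,    *)
(* U(L) is A modulo the two-sided ideal generated by the relations making     *)
(* L -> U(L) linear and sending brackets to supercommutators; tensoring over  *)
(* U(P) with F_l then identifies u b with chi(b) u for b in P, where chi is   *)
(* the character of P vanishing on g (x) F[t] and with chi(k) = l.            *)

Section Induced.
Variables (F : fieldType) (g : vectType F) (gpar : bool -> {vspace g}).
Variables (br : g -> g -> g) (form : g -> g -> F) (l : F).

Let L := affine g int.

Definition free_algebra := {malg F[{fmonom L}]}.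

HB.instance Definition _ := GRing.Lalgebra.on free_algebra.

Definition gen (x : L) : free_algebra := << fmu x >>.

Definition nonneg_part (x : L) : Prop := forall n : int, n < 0 -> x.1@_n = 0.

Inductive induced_rel : free_algebra -> Prop :=
| rel_linear (u v : free_algebra) (c : F) (x y : L) :
    induced_rel (u * (gen (c *: x + y) - (c *: gen x + gen y)) * v)
| rel_bracket (u v : free_algebra) (i j : bool) (x y : L) :
    affine_par gpar i x -> affine_par gpar j y ->
    induced_rel (u * (gen x * gen y - (-1) ^+ (i && j) *: (gen y * gen x)
                      - gen (affine_br gpar br form intr x y)) * v)
| rel_induced (u : free_algebra) (x : L) :
    nonneg_part x -> induced_rel (u * gen x - (l * x.2) *: u).

Definition Vaff := lquot induced_rel.

HB.instance Definition _ := GRing.Lmodule.on Vaff.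

Definition Vvac : Vaff := lquot_pi induced_rel 1.

Definition Vact (x : L) (v : Vaff) : Vaff :=
  lquot_pi induced_rel (gen x * lquot_repr v).

Definition Vemb (a : g) : Vaff := Vact (tens a (-1)) Vvac.

Inductive Vpar : bool -> Vaff -> Prop :=
| Vpar_vac : Vpar false Vvac
| Vpar_act i j x v : affine_par gpar i x -> Vpar j v -> Vpar (i (+) j) (Vact x v)
| Vpar_zero i : Vpar i 0
| Vpar_lin i c v w : Vpar i v -> Vpar i w -> Vpar i (c *: v + w).

Definition affine_map (tau : g -> g) (x : L) : L :=
  (\sum_(n <- msupp x.1) << tau x.1@_n *g n >>, x.2).

(* As Vvac generates Vaff, this determines sigma. *)
Record induced_automorphism (tau : g -> g) (sigma : Vaff -> Vaff) : Prop :=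
  InducedAutomorphism {
    ind_linear : forall c v w, sigma (c *: v + w) = c *: sigma v + sigma w;
    ind_vac : sigma Vvac = Vvac;
    ind_act : forall x v, sigma (Vact x v) = Vact (affine_map tau x) (sigma v)
  }.

End Induced.

(* Formal calculus in x0, x1, x2 with rational exponents: a formal series is  *)
(* the function sending e = (e0, e1, e2) to the coefficient of                *)
(* x0^e0 x1^e1 x2^e2.                                                         *)

Definition expo := (rat * rat * rat)%type.

Section Formal.
Variables (F : fieldType).

(* The product of a scalar series and a vector-valued one. The sum runs over  *)
(* the indices with nonzero term; there are finitely many of them in all the  *)
(* products of the Jacobi identity.                                           *)
Definition series_mul (W : lmodType F) (K : expo -> F) (A : expo -> W)
    (e : expo) : W :=
  \sum_(d \in [set: expo]) K d *: A (e - d).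

(* Binomial coefficients are computed in rat, then read in F. *)
Definition binr (al : rat) (i : nat) : F :=
  ratr ((\prod_(j < i) (al - j%:R)) / (i`!)%:R).

(* Coefficient of y^a z^b in (y - z)^al, expanded in nonnegative powers of z. *)
Definition sub_pow (al a b : rat) : F :=
  if (b \is a Num.nat) && (a == al - b)
  then (-1) ^+ (Num.truncn b) * binr al (Num.truncn b) else 0.

(* x0^-1 delta((x1 - x2) / x0) *)
Definition delta_12 (e : expo) : F :=
  let: (e0, e1, e2) := e in
  if e0 \is a Num.int then sub_pow (- e0 - 1) e1 e2 else 0.

(* x0^-1 delta((x2 - x1) / (- x0)) *)
Definition delta_21 (e : expo) : F :=
  let: (e0, e1, e2) := e in
  if e0 \is a Num.int
  then (-1) ^ (numq (- e0 - 1)) * sub_pow (- e0 - 1) e2 e1 else 0.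

(* x2^-1 delta((x1 - x0) / x2) ((x1 - x0) / x2)^(- s) *)
Definition delta_10 (s : rat) (e : expo) : F :=
  let: (e0, e1, e2) := e in
  if e2 - s \is a Num.int then sub_pow (- e2 - 1) e1 e0 else 0.

(* Modes indexed by int, extended by 0 to rat. *)
Definition int_modes (V W : lmodType F) (Y : V -> int -> W -> W)
    (u : V) (q : rat) (w : W) : W :=
  if q \is a Num.int then Y u (numq q) w else 0.

(* The Jacobi identity applied to w, with s = r / T for u in V^r. *)
Definition jacobi (V W : lmodType F) (Y : V -> int -> V -> V)
    (YW : V -> rat -> W -> W) (s : rat) (sign : F) (u v : V) (w : W) : Prop :=
  let uv := fun e : expo => let: (e0, e1, e2) := e in
    if e0 == 0 then YW u (- e1 - 1) (YW v (- e2 - 1) w) else 0 in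
  let vu := fun e : expo => let: (e0, e1, e2) := e in
    if e0 == 0 then YW v (- e2 - 1) (YW u (- e1 - 1) w) else 0 in
  let u_v := fun e : expo => let: (e0, e1, e2) := e in
    if e1 == 0 then YW (int_modes Y u (- e0 - 1) v) (- e2 - 1) w else 0 in
  forall e, series_mul delta_12 uv e - sign *: series_mul delta_21 vu e =
            series_mul (delta_10 s) u_v e.

Record is_vertex_superalgebra (V : lmodType F) (par : bool -> V -> Prop)
    (vac : V) (Y : V -> int -> V -> V) : Prop := IsVertexSuperalgebra {
  va_par_zero : forall i, par i 0;
  va_par_linear : forall i c v w, par i v -> par i w -> par i (c *: v + w);
  va_par_sum : forall v, exists v0 v1,
    [/\ par false v0, par true v1 & v = v0 + v1];
  va_par_direct : forall v, par false v -> par true v -> v = 0;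
  va_vac_even : par false vac;
  va_linearl : forall c u v n w, Y (c *: u + v) n w = c *: Y u n w + Y v n w;
  va_linearr : forall u n c v w, Y u n (c *: v + w) = c *: Y u n v + Y u n w;
  va_par_modes : forall i j u v n, par i u -> par j v ->
    par (i (+) j) (Y u n v);
  va_truncation : forall u v, exists N : int, forall n, N <= n -> Y u n v = 0;
  va_vacuum : forall n w, Y vac n w = if n == -1 then w else 0;
  va_creation : forall v (n : int), 0 <= n -> Y v n vac = 0;
  va_creation_const : forall v, Y v (-1) vac = v;
  va_jacobi : forall i j u v w, par i u -> par j v ->
    jacobi Y (int_modes Y) 0 ((-1) ^+ (i && j)) u v w
}.

Record is_twisted_module (V : lmodType F) (par : bool -> V -> Prop) (vac : V)
    (Y : V -> int -> V -> V) (sigma : V -> V) (eta : F) (T : nat)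
    (W : lmodType F) (YW : V -> rat -> W -> W) : Prop := IsTwistedModule {
  tm_linearl : forall c u v n w, YW (c *: u + v) n w = c *: YW u n w + YW v n w;
  tm_linearr : forall u n c v w, YW u n (c *: v + w) = c *: YW u n v + YW u n w;
  tm_exponents : forall u n w, n * T%:R \isn't a Num.int -> YW u n w = 0;
  tm_exponents_eigen : forall r u n w, (r < T)%N -> sigma u = eta ^+ r *: u ->
    n - r%:R / T%:R \isn't a Num.int -> YW u n w = 0;
  tm_truncation : forall r u w, (r < T)%N -> sigma u = eta ^+ r *: u ->
    exists N : rat, forall n, N <= n -> YW u n w = 0;
  tm_vacuum : forall n w, YW vac n w = if n == -1 then w else 0;
  tm_jacobi : forall r i j u v w, (r < T)%N -> sigma u = eta ^+ r *: u ->
    par i u -> par j v ->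
    jacobi Y YW (r%:R / T%:R) ((-1) ^+ (i && j)) u v w
}.

End Formal.

(* Main.v *)
Require Import Defs.
From HB Require Import structures.
From mathcomp Require Import all_boot all_order all_algebra all_field.
From mathcomp Require Import finmap generic_quotient ring_quotient.
From mathcomp Require Import boolp classical_sets fsbigop functions.
From mathcomp.multinomials Require Import monalg.
From mathcomp Require Import cyclic.
From mathcomp Require Import zify ring lra.
Set Implicit Arguments.
Unset Strict Implicit.
Unset Printing Implicit Defensive.
Import Order.TTheory GRing.Theory Num.Theory.
Local Open Scope ring_scope.

(** Let al, be be fields on M and consider the products
      pr(m, n) = Res_x x^m ((x - z)^n al(x) be(z) - eps (x - z)^n be(z) al(x)),
    the first power being expanded for |x| > |z| and the second for |z| > |x|.
    They satisfy pr(m, n + 1) = pr(m + 1, n) - z pr(m, n), and if al and be are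
    local to each other they vanish for n large. The twisted Jacobi identity
    for u of degree r says exactly that pr(m, n), computed for Y_M(u, x) and
    Y_M(v, x), is zero when m is not in r/T + Z and otherwise equals
      sum_i binom(m, i) z^(m - i) Y_M(u_(n + i) v, z)                    ([jacobiP]).

    In characteristic p the recursion gives, for P a power of p,
      pr(m + P, n) = z^P pr(m, n) + pr(m, n + P),
    so that pr(m + P, n) = z^P pr(m, n) as soon as P is large. Taking P congruent
    to 1 modulo T, so that P r/T lies in r/T + Z, the field z^(- P r/T) pr(P r/T, n)
    does not depend on P for P large. This Frobenius limit is the field that
    ought to be Y_M(u_n v, z), because binom(P r/T, i) = 0 in F for 0 < i < P; and
    conversely a local family is determined by its limits through the formula
    above ([hlim_inv]). No expansion of x^(r/T) in powers of x - z is
    needed.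

    The module structure is built in three steps.

    - The fields on M that are local to every a_tau form a space on which the
      untwisted affine superalgebra acts at level l, a (x) t^n acting by be ->
      lim z^(- P r/T) pr(P r/T, n) with al = a_tau ([act_br]). Stability of the
      space and the bracket relations both come from one commutator formula for
      products of fields ([prodF_comm]), applied to the brackets of a_tau and
      b_tau ([fldA_comm]). As M is not graded, a field is replaced by the pair
      of its even and odd components, so that Koszul signs make sense.

    - The identity field is annihilated by g (x) F[t], so the universal property
      of the induced module ([uphi_act]) sends the vertex superalgebra to that space
      of fields; Y_M is the sum of the two components of the image.

    - The Jacobi identity for u and v is proved when u and v are monomials in the
      a (x) t^n applied to the vacuum, by induction on v ([mono_local],
      [mono_limit]). For v the vacuum it amounts to the formula for the
      divided derivatives of Y_M(u, z) ([mono_dd]), and the induction step is again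
      [prodF_comm]. Monomials of the right parity and degree span the
      homogeneous components ([mono_span_eigen], [mono_span_par]), and both sides
      are linear. *)

(** * Binomial coefficients of rationals with denominator prime to p *)

Section Binomials.
Variables (F : fieldType) (p T : nat).
Hypotheses (charF : p \in [pchar F]) (T_gt0 : (0 < T)%N) (cop : coprime T p).

Let p_pr : prime p := pcharf_prime charF.

Lemma T_neq0 : T%:R != 0 :> F.
Proof.
rewrite -(dvdn_pcharf charF); apply/negP => pT.
by move: cop; rewrite coprime_sym prime_coprime // pT.
Qed.

(** Rationals whose denominator divides [T]; the exponents of all fields are of this form. *)
Definition Tint (q : rat) : bool := q * T%:R \is a Num.int.

Lemma TintP q : reflect (exists N : int, q = N%:~R / T%:R) (Tint q).
Proof.
have T0 : T%:R != 0 :> rat by rewrite pnatr_eq0 -lt0n.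
apply: (iffP idP) => [/intrP[N E]|[N ->]]; first by exists N; rewrite -E mulfK.
by rewrite /Tint mulfVK // intr_int.
Qed.

Lemma Tint_int q : q \is a Num.int -> Tint q.
Proof. by move=> qi; rewrite /Tint rpredM // natr_int. Qed.

Lemma TintD q r : Tint q -> Tint r -> Tint (q + r).
Proof. by move=> Hq Hr; rewrite /Tint mulrDl rpredD. Qed.

Lemma TintN q : Tint q -> Tint (- q).
Proof. by move=> Hq; rewrite /Tint mulNr rpredN. Qed.

Lemma TintB q r : Tint q -> Tint r -> Tint (q - r).
Proof. by move=> Hq Hr; rewrite TintD ?TintN. Qed.

Lemma Tint_div (r : nat) : Tint (r%:R / T%:R).
Proof. by apply/TintP; exists r. Qed.

Lemma TintMn q k : Tint q -> Tint (k%:R * q).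
Proof. by move=> Hq; rewrite /Tint -mulrA rpredM ?natr_int. Qed.

Lemma Tint_nat k : Tint k%:R.
Proof. by apply/Tint_int/natr_int. Qed.

Lemma Tint_intr (k : int) : Tint k%:~R.
Proof. by apply/Tint_int/intr_int. Qed.

Lemma ratr_frac (x d : int) : d%:~R != 0 :> F ->
  ratr (x%:~R / d%:~R) = x%:~R / d%:~R :> F.
Proof.
move=> dF; have d0 : d != 0 by apply: contraNneq dF => ->.
have d0q : d%:~R != 0 :> rat by rewrite intr_eq0.
set q : rat := x%:~R / d%:~R.
have E : numq q * d = x * denq q.
  apply/eqP; rewrite -(eqr_int rat) !rmorphM /=.
  by rewrite numqE mulrAC {1}/q divfK.
have dvd : (denq q %| d)%Z.
  have : (denq q %| numq q * d)%Z by rewrite E dvdz_mull.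
  by rewrite Gauss_dvdzr // coprimez_sym /coprimez /gcdz (eqP (coprime_num_den q)).
have qF : (denq q)%:~R != 0 :> F.
  by move: dvd dF => /dvdzP[k ->]; rewrite intrM; apply: contraNneq => ->; rewrite mulr0.
rewrite /ratr; apply/eqP; rewrite eqr_div //.
by rewrite -!intrM E.
Qed.

(** The binomial coefficient of the rational N / T, read in F, is that of any natural number
    p-adically close enough to it. *)
Lemma binr_congr (N : int) (b e i : nat) : (logn p i`! < e)%N ->
  (exists x : int, (b * T)%:Z = N + x * (p ^ e)%:Z) ->
  binr F (N%:~R / T%:R) i = 'C(b, i)%:R.
Proof.
move=> He [x Hx].
have T0 : T%:R != 0 :> rat by rewrite pnatr_eq0 -lt0n.
have f0 : i`!%:R != 0 :> rat by rewrite pnatr_eq0 -lt0n fact_gt0.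
(* the two products agree modulo p ^ e *)
have [y Hy] : exists y : int, \prod_(j < i) (N - (j * T)%:Z)
    = (T ^ i * i`! * 'C(b, i))%:Z + y * (p ^ e)%:Z.
  have -> : (T ^ i * i`! * 'C(b, i))%:Z = \prod_(j < i) ((b * T)%:Z - (j * T)%:Z).
    have -> : \prod_(j < i) ((b * T)%:Z - (j * T)%:Z)
            = \prod_(j < i) (T%:Z * (b%:Z - j%:Z)).
      by apply: eq_bigr => j _; rewrite !PoszM -mulrBl mulrC.
    rewrite big_split /= prodr_const card_ord -mulnA PoszM.
    congr (_ * _); first by rewrite -!natz natrX.
    rewrite mulnC bin_ffact.
    elim: i {He f0} => [|i IH]; first by rewrite big_ord0.
    rewrite big_ord_recr /= -IH ffactnSr PoszM.
    case: (leqP i b) => [ib|bi]; first by rewrite subzn.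
    by rewrite ffact_small // !mul0r.
  rewrite Hx.
  elim: i {He f0} => [|i [y IH]]; first by exists 0; rewrite !big_ord0 mul0r addr0.
  rewrite !big_ord_recr /= IH.
  exists (y * (N - (i * T)%:Z) - x * \prod_(j < i) (N + x * (p ^ e)%:Z - (j * T)%:Z)).
  by ring.
have pe : i`! = (i`!`_p^' * p ^ logn p i`!)%N.
  by rewrite -p_part mulnC partnC // fact_gt0.
set D : int := (T ^ i * i`!`_p^')%:Z.
have DF : D%:~R != 0 :> F.
  rewrite /D -pmulrn -(dvdn_pcharf charF) Euclid_dvdM // Euclid_dvdX // negb_or.
  apply/andP; split; last first.
    by rewrite -prime_coprime // coprime_sym (@pnat_coprime p^') ?part_pnat // pnatNK pnat_id.
  by rewrite negb_and -prime_coprime // coprime_sym cop.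
rewrite /binr.
have -> : (\prod_(j < i) (N%:~R / T%:R - j%:R)) / i`!%:R
   = ('C(b, i)%:Z * D + y * (p ^ (e - logn p i`!))%:Z)%:~R / D%:~R :> rat.
  have -> : \prod_(j < i) (N%:~R / T%:R - j%:R)
    = (\prod_(j < i) (N - (j * T)%:Z))%:~R / T%:R ^+ i :> rat.
    have -> : T%:R ^+ i = \prod_(j < i) T%:R :> rat by rewrite prodr_const card_ord.
    rewrite rmorph_prod -prodf_div.
    apply: eq_bigr => j _ /=.
    by rewrite rmorphB /= -pmulrn natrM mulrBl mulfK.
  rewrite Hy /D.
  have Ee : (p ^ e)%:Z = (p ^ (e - logn p i`!))%:Z * (p ^ logn p i`!)%:Z.
    by rewrite -PoszM -expnD subnK // ltnW.
  rewrite Ee; have p0 : (p ^ logn p i`!)%:R != 0 :> rat.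
    by rewrite pnatr_eq0 -lt0n expn_gt0 prime_gt0.
  have Dq0 : (i`!`_p^')%:R != 0 :> rat by rewrite pnatr_eq0 -lt0n part_gt0.
  have Ti : T%:R ^+ i != 0 :> rat by rewrite expf_neq0.
  move: Dq0 pe; move: (logn p i`!) (i`!`_p^')%N => v r Dq0 ->.
  rewrite !(rmorphD, rmorphM) /= -!pmulrn !(natrM, natrX).
  by field; rewrite Dq0 Ti expf_neq0 // pnatr_eq0 -lt0n prime_gt0.
rewrite ratr_frac // rmorphD !rmorphM /= -!pmulrn mulrDl mulfK //.
rewrite natrX (pcharf0 charF) expr0n subn_eq0 leqNgt He /= mulr0 mul0r addr0.
by [].
Qed.

Lemma bin_pfactor e j : (0 < j < p ^ e)%N -> 'C(p ^ e, j)%:R = 0 :> F.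
Proof.
case: j => // j /= Hj; apply/eqP; rewrite -(dvdn_pcharf charF).
apply: contraLR Hj => pC; rewrite -leqNgt dvdn_leq //.
have : (p ^ e %| j.+1 * 'C(p ^ e, j.+1))%N.
  by rewrite -mul_bin_diag dvdn_mulr.
by rewrite Gauss_dvdl // coprimeXl // prime_coprime.
Qed.

Lemma bin_period b e j k : (k < p ^ e)%N ->
  'C(b + j * p ^ e, k)%:R = 'C(b, k)%:R :> F.
Proof.
move=> Hk; elim: j => [|j <-]; first by rewrite mul0n addn0.
rewrite mulSn addnCA -binomial.Vandermonde big_ord_recl bin0 mul1n subn0 natrD.
rewrite natr_sum big1 ?addr0 // => i _; rewrite natrM bin_pfactor ?mul0r //.
by rewrite lift0 /=; apply: leq_ltn_trans Hk.
Qed.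

(** Rationals with denominator T have p-adic approximations by natural numbers. *)
Lemma Tint_approx (N : int) e :
  exists b : nat, exists x : int, (b * T)%:Z = N + x * (p ^ e)%:Z.
Proof.
have c : coprime T (p ^ e) by rewrite coprimeXr.
have /(coprimeP _ T_gt0)[[u v] /= E] := c.
have pe0 : (p ^ e)%:Z != 0 by rewrite eqz_nat -lt0n expn_gt0 prime_gt0.
have r0 := modz_ge0 N pe0.
exists (`|(N %% (p ^ e)%:Z)%Z| * u)%N.
exists ((N %% (p ^ e)%:Z)%Z * v%:Z - (N %/ (p ^ e)%:Z)%Z).
rewrite !PoszM gez0_abs // [X in _ = X + _](divz_eq N (p ^ e)%N).
have -> : (N %% (p ^ e)%:Z)%Z * u%:Z * T%:Z =
   (N %% (p ^ e)%:Z)%Z * (1 + v%:Z * (p ^ e)%:Z).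
  rewrite -mulrA -!PoszM; congr (_ * _); lia.
by ring.
Qed.

(** Up to any order, [binr q] is a row of the Pascal triangle modulo [p], and
    the row number can be prescribed modulo any power of [p]. *)
Lemma binr_nat2 (q c : rat) (e K : nat) : Tint q -> Tint c ->
  exists b b' j j' : nat,
  [/\ (b + j * p ^ e = b' + j' * p ^ e)%N,
     forall k, (k < K)%N -> binr F q k = 'C(b, k)%:R,
     forall k, (k < K)%N -> binr F (q + 1) k = 'C(b.+1, k)%:R &
     forall k, (k < K)%N -> binr F (q + (p ^ e)%:R * c) k = 'C(b', k)%:R].
Proof.
move=> /TintP[N ->] /TintP[C ->].
have T0 : T%:R != 0 :> rat by rewrite pnatr_eq0 -lt0n.
pose e' := maxn e (\max_(k < K) k`!).
have He' k : (k < K)%N -> (logn p k`! < e')%N.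
  move=> Hk; apply: leq_trans (leq_maxr _ _).
  by apply: leq_trans (ltn_logl _ (fact_gt0 _)) (leq_bigmax (Ordinal Hk)).
have [b [x Hb]] := Tint_approx N e'.
have [b' [x' Hb']] := Tint_approx (N + (p ^ e)%:Z * C) e'.
have [d Hd] : exists d, e' = (e + d)%N.
  by exists (e' - e)%N; rewrite subnKC // leq_maxl.
have dv : (p ^ e %| `|b'%:Z - b%:Z|)%N.
  rewrite -(@Gauss_dvdr _ T) ?coprimeXl 1?coprime_sym // -[T in (T * _)%N]absz_nat -abszM.
  rewrite -[(p ^ e)%N]absz_nat -dvdzE.
  apply/dvdzP; exists (C + (x' - x) * (p ^ d)%:Z).
  rewrite mulrBr ![T%:Z * _]mulrC -!PoszM Hb Hb' Hd expnD !PoszM; ring.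
have [j [j' Hj]] : exists j j' : nat, (b + j * p ^ e = b' + j' * p ^ e)%N.
  case/dvdnP: dv => k Hk; case: (leqP b b') => Hbb.
    exists k, 0%N; rewrite -Hk; lia.
  by exists 0%N, k; rewrite -Hk; lia.
exists b, b', j, j'; split=> // k Hk.
- by apply: (@binr_congr _ _ e'); [exact: He' | exists x].
- have -> : N%:~R / T%:R + 1 = (N + T%:Z)%:~R / T%:R :> rat.
    by rewrite rmorphD /= mulrDl -pmulrn divff.
  apply: (@binr_congr _ _ e'); [exact: He' | exists x].
  by rewrite mulSn PoszD Hb; ring.
- have -> : N%:~R / T%:R + (p ^ e)%:R * (C%:~R / T%:R)
          = (N + (p ^ e)%:Z * C)%:~R / T%:R :> rat.
    by rewrite rmorphD rmorphM /= mulrDl mulrA -pmulrn.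
  by apply: (@binr_congr _ _ e'); [exact: He' | exists x'].
Qed.

(** In F the first p ^ e binomial coefficients only depend on q up to p ^ e. *)
Lemma binr_near q c e k : Tint q -> Tint c -> (k < p ^ e)%N ->
  binr F (q + (p ^ e)%:R * c) k = binr F q k.
Proof.
move=> Hq Hc Hk; have [b [b' [j [j' [E H1 _ H2]]]]] := binr_nat2 e k.+1 Hq Hc.
by rewrite H1 // H2 // -(bin_period b j Hk) E bin_period.
Qed.

Lemma binrS q k : Tint q ->
  binr F (q + 1) k.+1 = binr F q k.+1 + binr F q k.
Proof.
move=> Hq; have [b [_ [_ [_ [_ H1 H2 _]]]]] := binr_nat2 0 k.+2 Hq (Tint_nat 0).
by rewrite H2 // !H1 // binS natrD.
Qed.

Lemma binr_natE (b k : nat) : binr F b%:R k = 'C(b, k)%:R.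
Proof.
have T0 : T%:R != 0 :> rat by rewrite pnatr_eq0 -lt0n.
have -> : b%:R = (b * T)%:Z%:~R / T%:R :> rat by rewrite -pmulrn natrM mulfK.
by apply: (@binr_congr _ _ (logn p k`!).+1) => //; exists 0; rewrite mul0r addr0.
Qed.

Lemma binr0 q : binr F q 0 = 1.
Proof. by rewrite /binr big_ord0 fact0 divr1 (ratr_nat _ 1). Qed.

Lemma binr_0 k : binr F 0 k = (k == 0%N)%:R.
Proof. by rewrite -[0]/(0%:R : rat) binr_natE bin0n. Qed.

Lemma binr1 q : binr F q 1 = ratr q.
Proof. by rewrite /binr big_ord1 subr0 divr1. Qed.

Lemma ratrN (q : rat) : ratr (- q) = - ratr q :> F.
Proof. by rewrite /ratr numqN denqN intrN mulNr. Qed.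

(** Upper negation. *)
Lemma binr_neg q k : binr F (k%:R - q - 1) k = (-1) ^+ k * binr F q k.
Proof.
rewrite /binr.
have -> : \prod_(j < k) (k%:R - q - 1 - j%:R) = (-1) ^+ k * \prod_(j < k) (q - j%:R) :> rat.
  have -> : (-1) ^+ k = \prod_(j < k) (-1) :> rat by rewrite prodr_const card_ord.
  rewrite -big_split /= (reindex_inj rev_ord_inj); apply: eq_bigr => j _ /=.
  by rewrite natrB // -natr1; ring.
rewrite -[in LHS]signr_odd -[in RHS]signr_odd; case: (odd k); last first.
  by rewrite !expr0 !mul1r.
by rewrite !expr1 !mulN1r mulNr ratrN.
Qed.

Lemma binr_small q e k : Tint q -> (0 < k < p ^ e)%N -> binr F ((p ^ e)%:R * q) k = 0.
Proof.
move=> Hq /andP[k0 Hk]; rewrite -[_ * _]add0r binr_near ?binr_0 ?gtn_eqF //.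
exact: (Tint_nat 0).
Qed.

End Binomials.

(** * Sums over the natural numbers *)

Section NatSums.
Variables (F : fieldType) (M : lmodType F).
Implicit Types (f g : nat -> M) (N : lmodType F).

(** The sum of a family with finite support (and zero otherwise). *)
Definition nsum f : M := (\sum_(k \in [set: nat]) f k)%R.

Lemma nsumE f K : (forall k, (K <= k)%N -> f k = 0) -> nsum f = \sum_(k < K) f k.
Proof.
move=> H; rewrite /nsum fsbig_ord; apply/esym/fsbig_widen => //= k [_ /= /negP].
by rewrite -leqNgt => /H.
Qed.

Lemma eq_nsum f g : f =1 g -> nsum f = nsum g.
Proof. by move=> /funext ->. Qed.

(** The two conditions say that the sum over pairs is finite along each row, uniformly, and
    along each column. *)
Lemma nsum_exch (f : nat -> nat -> M) :
  (exists L, forall k l, (L <= l)%N -> f k l = 0) ->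
  (forall l, exists K, forall k, (K <= k)%N -> f k l = 0) ->
  nsum (fun k => nsum (f k)) = nsum (fun l => nsum (f^~ l)).
Proof.
move=> [L HL] /choice [K HK].
pose B := \max_(l < L) K l.
have HB k l : (B <= k)%N -> f k l = 0.
  move=> Bk; case: (ltnP l L) => lL; last exact: HL.
  by apply: HK; apply: leq_trans Bk; apply: (leq_bigmax (Ordinal lL)).
rewrite (@nsumE _ B) => [|k Bk]; last first.
  by rewrite (@nsumE _ 0) ?big_ord0 // => l _; apply: HB.
rewrite (@nsumE _ L) => [|l Ll]; last first.
  by rewrite (@nsumE _ 0) ?big_ord0 // => k _; apply: HL.
under eq_bigr => k _ do rewrite (@nsumE (f k) L (HL k)).
under [RHS]eq_bigr => l _ do rewrite (@nsumE (f^~ l) B (fun k => @HB k l)).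
exact: exchange_big.
Qed.

End NatSums.

(** Linearity of a bare function. *)
Definition lin (F : fieldType) (M N : lmodType F) (f : M -> N) :=
  forall c x y, f (c *: x + y) = c *: f x + f y.

Section Lin.
Variables (F : fieldType) (M N : lmodType F) (f : M -> N).
Hypothesis Hf : lin f.

Lemma lin0 : f 0 = 0.
Proof. by have := Hf (-1) 0 0; rewrite scaler0 addr0 scaleN1r addNr. Qed.

Lemma linD x y : f (x + y) = f x + f y.
Proof. by rewrite -[x]scale1r Hf !scale1r. Qed.

Lemma linZ c x : f (c *: x) = c *: f x.
Proof. by rewrite -[_ *: _]addr0 Hf lin0 addr0. Qed.

Lemma linN x : f (- x) = - f x.
Proof. by rewrite -scaleN1r linZ scaleN1r. Qed.

Lemma linB x y : f (x - y) = f x - f y.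
Proof. by rewrite linD linN. Qed.

Lemma lin_sum (I : Type) (r : seq I) (P : pred I) (h : I -> M) :
  f (\sum_(i <- r | P i) h i) = \sum_(i <- r | P i) f (h i).
Proof. by apply: (big_morph f linD lin0). Qed.

Lemma lin_nsum h K : (forall k, (K <= k)%N -> h k = 0) ->
  f (nsum h) = nsum (fun k => f (h k)).
Proof.
move=> H; rewrite (nsumE H) lin_sum (@nsumE _ _ _ K) // => k Hk.
by rewrite H // lin0.
Qed.
End Lin.

Lemma rat_bound (q q0 : rat) : exists K : nat, forall k, (K <= k)%N -> q0 <= q + k%:R.
Proof.
exists (Num.bound `|q0 - q|) => k Hk.
have H := archi_boundP (normr_ge0 (q0 - q)).
have H2 : (Num.bound `|q0 - q|)%:R <= k%:R :> rat by rewrite ler_nat.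
have := ler_norm (q0 - q); lra.
Qed.

(** Congruence modulo the integers. *)
Definition congZ (a b : rat) : bool := a - b \is a Num.int.

Lemma congZ_refl a : congZ a a. Proof. by rewrite /congZ subrr. Qed.

Lemma congZ_sym a b : congZ a b -> congZ b a.
Proof. by rewrite /congZ -[b - a]opprB rpredN. Qed.

Lemma congZ_trans b a c : congZ a b -> congZ b c -> congZ a c.
Proof. by rewrite /congZ => ab bc; rewrite -[a](subrK b) -addrA rpredD. Qed.

Lemma congZD a b c d : congZ a b -> congZ c d -> congZ (a + c) (b + d).
Proof. by rewrite /congZ opprD addrACA => *; rewrite rpredD. Qed.

Lemma congZN a b : congZ a b -> congZ (- a) (- b).
Proof. by rewrite /congZ -opprD rpredN. Qed.

Lemma congZDi a b c : congZ a b -> c \is a Num.int -> congZ (a + c) b.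
Proof. by rewrite /congZ addrAC => *; rewrite rpredD. Qed.

(** * Expansions of powers of x - z *)

Section Expansion.
Variables (F : fieldType) (p T : nat).
Hypotheses (charF : p \in [pchar F]) (T_gt0 : (0 < T)%N) (cop : coprime T p).
Variable M : lmodType F.
Implicit Types (B : rat -> rat -> M) (n : int) (m q : rat).

Let binrS := binrS charF T_gt0 cop.
Let binr_0 := binr_0 charF T_gt0 cop.

(** The coefficient at [(m, q)] of (x - z) ^ n B, expanded for |x| > |z|, where
    [B s t] is the coefficient of x ^ (- s - 1) z ^ (- t - 1). *)
Definition PL n B m q : M :=
  nsum (fun k => ((-1) ^+ k * binr F n%:~R k) *: B (m + n%:~R - k%:R) (q + k%:R)).

Lemma PL_ext n B B' m q : (forall k : nat, B (m + n%:~R - k%:R) (q + k%:R) =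
   B' (m + n%:~R - k%:R) (q + k%:R)) -> PL n B m q = PL n B' m q.
Proof. by move=> H; apply: eq_nsum => k; rewrite H. Qed.

(** Truncation in z, which makes the expansion for |x| > |z| meaningful. *)
Definition trunc B q0 := forall s t, q0 <= t -> B s t = 0.

Lemma PLE B q0 n m q : trunc B q0 -> exists K, forall K', (K <= K')%N ->
  PL n B m q = \sum_(k < K')
    ((-1) ^+ k * binr F n%:~R k) *: B (m + n%:~R - k%:R) (q + k%:R).
Proof.
move=> HB; have [K HK] := rat_bound q q0; exists K => K' HK'.
apply: nsumE => k Hk; rewrite HB ?scaler0 //; apply: HK; exact: leq_trans Hk.
Qed.

Lemma PL_trunc B q0 n : trunc B q0 -> trunc (PL n B) q0.
Proof.
move=> HB m q Hq; rewrite /PL (@nsumE _ _ _ 0) ?big_ord0 // => k _.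
by rewrite HB ?scaler0 // ler_wpDr.
Qed.

Lemma PL0 B m q : PL 0 B m q = B m q.
Proof.
rewrite /PL (@nsumE _ _ _ 1) => [|k k0]; last by rewrite binr_0 gtn_eqF // mulr0 scale0r.
by rewrite big_ord1 binr0 expr0 mulr1 scale1r subr0 !addr0.
Qed.

Lemma PL_rec B q0 n m q : trunc B q0 ->
  PL (n + 1) B m q = PL n B (m + 1) q - PL n B m (q + 1).
Proof.
move=> HB; have [K HK] := PLE n (m + 1) q HB.
have [K' HK'] := PLE n m (q + 1) HB.
have [K2 HK2] := PLE (n + 1) m q HB.
pose N := maxn K (maxn K' K2).
have N1 : (K <= N.+1)%N by rewrite ltnW // ltnS leq_maxl.
have N2 : (K' <= N)%N by rewrite leq_max leq_max leqnn orbT.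
have N3 : (K2 <= N.+1)%N by rewrite ltnW // ltnS leq_max leq_max leqnn !orbT.
rewrite (HK _ N1) (HK' _ N2) (HK2 _ N3) !big_ord_recl /= !binr0 -[RHS]addrA.
congr (_ + _); first by rewrite rmorphD /=; congr (_ *: B _ _); ring.
rewrite -sumrB; apply: eq_bigr => k _.
rewrite /bump /= add1n rmorphD /= binrS ?Tint_intr //.
have -> : m + (n%:~R + 1) - k.+1%:R = m + n%:~R - k%:R by rewrite -natr1; ring.
have -> : m + 1 + n%:~R - k.+1%:R = m + n%:~R - k%:R by rewrite -natr1; ring.
have -> : q + 1 + k%:R = q + k.+1%:R by rewrite -natr1; ring.
rewrite -scalerBl; congr (_ *: _); rewrite exprS; ring.
Qed.

Lemma PL_lin B q0 n m q (N : lmodType F) (f : M -> N) : trunc B q0 -> lin f ->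
  f (PL n B m q) =
  nsum (fun k => ((-1) ^+ k * binr F n%:~R k) *: f (B (m + n%:~R - k%:R) (q + k%:R))).
Proof.
move=> HB Hf; have [K HK] := rat_bound q q0.
rewrite (lin_nsum Hf (K := K)) => [|k Hk]; last by rewrite HB ?scaler0 // HK.
by apply: eq_nsum => k; rewrite (linZ Hf).
Qed.

Lemma PL_comb c B B' q0 n m q : trunc B q0 -> trunc B' q0 ->
  PL n (fun s t => c *: B s t + B' s t) m q = c *: PL n B m q + PL n B' m q.
Proof.
move=> HB HB'; have H : trunc (fun s t => c *: B s t + B' s t) q0.
  by move=> s t Ht; rewrite HB // HB' // scaler0 addr0.
have [K1 E1] := PLE n m q HB; have [K2 E2] := PLE n m q HB'.
have [K3 E3] := PLE n m q H; pose N := maxn K1 (maxn K2 K3).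
rewrite (E1 N) ?(E2 N) ?(E3 N) ?leq_max ?leqnn ?orbT //.
rewrite scaler_sumr -big_split /=; apply: eq_bigr => k _.
by rewrite scalerDr !scalerA mulrC.
Qed.

Lemma PL_sum (I : Type) (r : seq I) (c : I -> F) (B : I -> rat -> rat -> M) q0 n m q :
  (forall i, trunc (B i) q0) ->
  PL n (fun s t => \sum_(i <- r) c i *: B i s t) m q = \sum_(i <- r) c i *: PL n (B i) m q.
Proof.
move=> HB; elim: r => [|i r IH].
  rewrite big_nil /PL (@nsumE _ _ _ 0) ?big_ord0 // => k _.
  by rewrite big_nil scaler0.
rewrite big_cons -IH -(@PL_comb _ _ _ q0) //; last first.
  by move=> s t Ht; rewrite big1 // => j _; rewrite HB // scaler0.
by apply: PL_ext => k; rewrite big_cons.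
Qed.

(** A family satisfying the recursion of multiplication by [x - z] is
    determined by its value at n = 0, if it is truncated in one variable. *)
Lemma uniq_L (h : int -> rat -> rat -> M) (c d : rat) :
  (forall n m q, congZ m c -> congZ q d ->
     h (n + 1) m q = h n (m + 1) q - h n m (q + 1)) ->
  (forall n, exists q0, forall m q, congZ m c -> congZ q d -> q0 <= q -> h n m q = 0) ->
  (forall m q, congZ m c -> congZ q d -> h 0 m q = 0) ->
  forall n m q, congZ m c -> congZ q d -> h n m q = 0.
Proof.
move=> rec tr h0.
have c1 a b : congZ a b -> congZ (a + 1) b by move=> H; apply: congZDi.
elim/int_ind => [//|n IH|n IH] m q Hm Hq.
  have -> : Posz n.+1 = Posz n + 1 by rewrite -addn1 PoszD.
  by rewrite rec // !IH ?subr0 ?c1.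
have [q0 Hq0] := tr (- n.+1%:Z).
have step m' q' : congZ m' c -> congZ q' d -> h (- n.+1%:Z) (m' + 1) q' = h (- n.+1%:Z) m' (q' + 1).
  move=> Hm' Hq'; apply/eqP; rewrite -subr_eq0 -rec //.
  by have -> : - Posz n.+1 + 1 = - Posz n; [rewrite -addn1 PoszD opprD subrK | rewrite IH].
have many k m' q' : congZ m' c -> congZ q' d ->
    h (- n.+1%:Z) m' q' = h (- n.+1%:Z) (m' - k%:R) (q' + k%:R).
  move=> Hm' Hq'; elim: k => [|k ->]; first by rewrite subr0 addr0.
  rewrite -natr1 opprD !addrA -step ?subrK //.
    by rewrite -addrA; apply: congZDi => //; rewrite rpredB // rpredN natr_int.
  by apply: congZDi => //; rewrite natr_int.
have [K HK] := rat_bound q q0.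
rewrite (many K) // Hq0 ?HK //; apply: congZDi; rewrite ?rpredN ?natr_int //.
Qed.

Lemma uniq_R (h : int -> rat -> rat -> M) (c d : rat) :
  (forall n m q, congZ m c -> congZ q d ->
     h (n + 1) m q = h n (m + 1) q - h n m (q + 1)) ->
  (forall n, exists m0, forall m q, congZ m c -> congZ q d -> m0 <= m -> h n m q = 0) ->
  (forall m q, congZ m c -> congZ q d -> h 0 m q = 0) ->
  forall n m q, congZ m c -> congZ q d -> h n m q = 0.
Proof.
move=> rec tr h0 n m q Hm Hq.
suff : (-1) ^ n *: h n m q = 0.
  by move/eqP; rewrite scaler_eq0 expfz_eq0 oppr_eq0 oner_eq0 andbF /= => /eqP.
apply: (@uniq_L (fun n q m => (-1) ^ n *: h n m q) d c) => //.
- move=> k q' m' Hq' Hm'; rewrite rec // expfzDr ?oppr_eq0 ?oner_eq0 // expr1z.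
  by rewrite mulrN1 scaleNr -scalerN opprB scalerBr.
- by move=> k; have [m0 H] := tr k; exists m0 => q' m' *; rewrite H ?scaler0.
- by move=> q' m' *; rewrite h0 ?scaler0.
Qed.

(** The same coefficient, expanded for |z| > |x|. *)
Definition PR n B m q : M :=
  nsum (fun k => ((-1) ^ n * ((-1) ^+ k * binr F n%:~R k)) *:
                 B (m + k%:R) (q + n%:~R - k%:R)).

(** Truncation in x, which makes the expansion for |z| > |x| meaningful. *)
Definition truncR B s0 := forall s t, s0 <= s -> B s t = 0.

(** The second expansion is the first one with the variables exchanged. *)
Lemma PR_PL B s0 n m q : truncR B s0 ->
  PR n B m q = (-1) ^ n *: PL n (fun t s => B s t) q m.
Proof.
move=> HB; have [K HK] := rat_bound m s0.
have lZ : lin (fun x : M => (-1) ^ n *: x).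
  by move=> b x y; rewrite scalerDr !scalerA mulrC.
rewrite /PL (lin_nsum lZ (K := K)) => [|k Hk]; last by rewrite HB ?scaler0 // HK.
by apply: eq_nsum => k; rewrite scalerA.
Qed.

Lemma PR_ext n B B' m q : (forall k : nat, B (m + k%:R) (q + n%:~R - k%:R) =
   B' (m + k%:R) (q + n%:~R - k%:R)) -> PR n B m q = PR n B' m q.
Proof. by move=> H; apply: eq_nsum => k; rewrite H. Qed.

Lemma PR_trunc B s0 n : truncR B s0 -> truncR (PR n B) s0.
Proof.
by move=> HB m q Hm; rewrite (PR_PL _ _ _ HB) (@PL_trunc _ s0) ?scaler0 // => s t; apply: HB.
Qed.

Lemma PR0 B s0 m q : truncR B s0 -> PR 0 B m q = B m q.
Proof. by move=> HB; rewrite (PR_PL _ _ _ HB) PL0 expr0z scale1r. Qed.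

Lemma PR_rec B s0 n m q : truncR B s0 ->
  PR (n + 1) B m q = PR n B (m + 1) q - PR n B m (q + 1).
Proof.
move=> HB; rewrite !(PR_PL _ _ _ HB) (@PL_rec _ s0) => [|t s]; last exact: HB.
rewrite expfzDr ?oppr_eq0 ?oner_eq0 // expr1z.
by rewrite mulrN1 scaleNr -scalerN opprB scalerBr.
Qed.

Lemma PR_lin B s0 n m q (N : lmodType F) (f : M -> N) : truncR B s0 -> lin f ->
  f (PR n B m q) =
  nsum (fun k => ((-1) ^ n * ((-1) ^+ k * binr F n%:~R k)) *:
                 f (B (m + k%:R) (q + n%:~R - k%:R))).
Proof.
move=> HB Hf; have [K HK] := rat_bound m s0.
rewrite (lin_nsum Hf (K := K)) => [|k Hk]; last by rewrite HB ?scaler0 // HK.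
by apply: eq_nsum => k; rewrite (linZ Hf).
Qed.

Lemma PR_comb c B B' s0 n m q : truncR B s0 -> truncR B' s0 ->
  PR n (fun s t => c *: B s t + B' s t) m q = c *: PR n B m q + PR n B' m q.
Proof.
move=> HB HB'; rewrite (PR_PL _ _ _ HB) (PR_PL _ _ _ HB') (@PR_PL _ s0).
  rewrite (@PL_comb _ _ _ s0) => [|t s|t s]; [|exact: HB|exact: HB'].
  by rewrite scalerDr !scalerA mulrC.
by move=> s t Hs; rewrite HB // HB' // scaler0 addr0.
Qed.

Lemma PR_sum (I : Type) (r : seq I) (c : I -> F) (B : I -> rat -> rat -> M) s0 n m q :
  (forall i, truncR (B i) s0) ->
  PR n (fun s t => \sum_(i <- r) c i *: B i s t) m q = \sum_(i <- r) c i *: PR n (B i) m q.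
Proof.
move=> HB; rewrite (@PR_PL _ s0) => [|s t Hs]; last first.
  by rewrite big1 // => i _; rewrite HB // scaler0.
rewrite (@PL_sum _ _ _ (fun i t s => B i s t) s0) => [|i t s]; last exact: HB.
rewrite scaler_sumr; apply: eq_bigr => i _.
by rewrite (PR_PL _ _ _ (HB i)) !scalerA mulrC.
Qed.

Lemma PL_shift B n m q a b :
  PL n (fun s t => B (s + a) (t + b)) m q = PL n B (m + a) (q + b).
Proof. by apply: eq_nsum => k; congr (_ *: B _ _); ring. Qed.

Lemma PR_shift B n m q a b :
  PR n (fun s t => B (s + a) (t + b)) m q = PR n B (m + a) (q + b).
Proof. by apply: eq_nsum => k; congr (_ *: B _ _); ring. Qed.

Lemma nsum_exchZ (c d : nat -> F) (Psi : nat -> nat -> M) :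
  (exists L, forall k l, (L <= l)%N -> Psi k l = 0) ->
  (forall l, exists K, forall k, (K <= k)%N -> Psi k l = 0) ->
  nsum (fun k => c k *: nsum (fun l => d l *: Psi k l)) =
  nsum (fun l => d l *: nsum (fun k => c k *: Psi k l)).
Proof.
move=> [L HL] HK.
have lZ (e : F) : lin (fun x : M => e *: x).
  by move=> b x y; rewrite scalerDr !scalerA mulrC.
transitivity (nsum (fun k => nsum (fun l => c k *: (d l *: Psi k l)))).
  apply: eq_nsum => k; rewrite (lin_nsum (lZ _) (K := L)) // => l Hl.
  by rewrite HL ?scaler0.
rewrite nsum_exch.
- apply: eq_nsum => l; have [K {}HK] := HK l.
  rewrite (lin_nsum (lZ _) (K := K)) => [|k Hk]; last by rewrite HK ?scaler0.
  by apply: eq_nsum => k; rewrite !scalerA mulrC.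
- by exists L => k l Hl; rewrite HL ?scaler0.
- by move=> l; have [K {}HK] := HK l; exists K => k Hk; rewrite HK ?scaler0.
Qed.

(** The four lemmas below exchange an expansion of (x - z) ^ n', acting on the indices (s, t),
    with one of (y - z) ^ n, acting on (s', t). *)
Section Exchange.
Variables (Psi : rat -> rat -> rat -> M) (n n' : int) (m m' q : rat).

Lemma exch_LL t0 : (forall s s' t, t0 <= t -> Psi s s' t = 0) ->
  PL n' (fun s t => PL n (fun s' t' => Psi s s' t') m t) m' q =
  PL n (fun s' t => PL n' (fun s t' => Psi s s' t') m' t) m q.
Proof.
move=> H; have [K HK] := rat_bound q t0.
rewrite /PL nsum_exchZ.
- by apply: eq_nsum => l; congr (_ *: _); apply: eq_nsum => k; congr (_ *: Psi _ _ _); ring.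
- exists K => k l Hl; apply: H; rewrite addrAC; apply: ler_wpDr => //; exact: HK.
- by move=> l; exists K => k Hk; apply: H; apply: ler_wpDr => //; exact: HK.
Qed.

Lemma exch_LR s0 : (forall s s' t, s0 <= s' -> Psi s s' t = 0) ->
  (forall s', exists t0, forall s t, t0 <= t -> Psi s s' t = 0) ->
  PL n' (fun s t => PR n (fun s' t' => Psi s s' t') m t) m' q =
  PR n (fun s' t => PL n' (fun s t' => Psi s s' t') m' t) m q.
Proof.
move=> H H2; have [K HK] := rat_bound m s0.
rewrite /PL /PR nsum_exchZ.
- by apply: eq_nsum => l; congr (_ *: _); apply: eq_nsum => k; congr (_ *: Psi _ _ _); ring.
- by exists K => k l Hl; apply: H; exact: HK.
- move=> l; have [t0 Ht] := H2 (m + l%:R); have [K' HK'] := rat_bound (q + n%:~R - l%:R) t0.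
  exists K' => k Hk; apply: Ht.
  have -> : q + k%:R + n%:~R - l%:R = q + n%:~R - l%:R + k%:R by ring.
  exact: HK'.
Qed.

Lemma exch_RL s0 : (forall s s' t, s0 <= s -> Psi s s' t = 0) ->
  (forall s, exists t0, forall s' t, t0 <= t -> Psi s s' t = 0) ->
  PR n' (fun s t => PL n (fun s' t' => Psi s s' t') m t) m' q =
  PL n (fun s' t => PR n' (fun s t' => Psi s s' t') m' t) m q.
Proof.
move=> H H2; have [K HK] := rat_bound m' s0.
rewrite /PL /PR -nsum_exchZ.
- by apply: eq_nsum => l; congr (_ *: _); apply: eq_nsum => k; congr (_ *: Psi _ _ _); ring.
- by exists K => k l Hl; apply: H; exact: HK.
- move=> l; have [t0 Ht] := H2 (m' + l%:R); have [K' HK'] := rat_bound (q + n'%:~R - l%:R) t0.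
  exists K' => k Hk; apply: Ht; exact: HK'.
Qed.

Lemma exch_RR s0 : (forall s s' t, s0 <= s' -> Psi s s' t = 0) ->
  (forall s', exists s1, forall s t, s1 <= s -> Psi s s' t = 0) ->
  PR n' (fun s t => PR n (fun s' t' => Psi s s' t') m t) m' q =
  PR n (fun s' t => PR n' (fun s t' => Psi s s' t') m' t) m q.
Proof.
move=> H H2; have [K HK] := rat_bound m s0.
rewrite /PR nsum_exchZ.
- by apply: eq_nsum => l; congr (_ *: _); apply: eq_nsum => k; congr (_ *: Psi _ _ _); ring.
- by exists K => k l Hl; apply: H; exact: HK.
- move=> l; have [s1 Hs] := H2 (m + l%:R); have [K' HK'] := rat_bound m' s1.
  by exists K' => k Hk; apply: Hs; exact: HK'.
Qed.

End Exchange.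

End Expansion.

(** * Products of fields *)

Lemma subr4 (V : zmodType) (a b c d : V) : a - b - (c - d) = a - c - (b - d).
Proof. by rewrite opprB [X in _ + X]addrC addrACA opprB [X in _ = _ + X]addrC. Qed.

Lemma sub_sub (V : zmodType) (a b c d : V) : a - b - (c - d) = a + d - (b + c).
Proof. by rewrite opprB addrACA -opprD; congr (_ + _); rewrite addrC. Qed.

Section Fields.
Variables (F : fieldType) (p T : nat).
Hypotheses (charF : p \in [pchar F]) (T_gt0 : (0 < T)%N) (cop : coprime T p).
Variable M : lmodType F.

(** A field on M is given by its modes: [al q] is the coefficient of z ^ (- q - 1). *)
Definition field_ := rat -> M -> M.
Implicit Types (al be ga : rat -> M -> M) (n : int) (m q : rat) (w : M).

Let PL_rec := PL_rec charF T_gt0 cop.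
Let PR_rec := PR_rec charF T_gt0 cop.
Let PL0 := PL0 charF T_gt0 cop.
Let PR0 := PR0 charF T_gt0 cop.

(** The modes are linear, vanish on each vector from some index on, and are indexed by (1/T) Z. *)
Record isfld al : Prop := IsFld {
  fld_lin : forall q, lin (al q);
  fld_tr : forall w, exists q0, forall q, q0 <= q -> al q w = 0;
  fld_T : forall q w, ~~ Tint T q -> al q w = 0
}.

Lemma fld0 al q : isfld al -> al q 0 = 0.
Proof. by move=> H; apply: lin0; apply: fld_lin. Qed.

Lemma fin_bound (P : nat -> rat -> Prop) K :
  (forall k, exists q0, forall q, q0 <= q -> P k q) ->
  exists q0, forall q k, (k < K)%N -> q0 <= q -> P k q.
Proof.
move=> H; elim: K => [|K [q0 IH]]; first by exists 0.
have [q1 H1] := H K; exists (Num.max q0 q1) => q k.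
rewrite ltnS leq_eqVlt ge_max => /orP[/eqP ->|kK] /andP[h1 h2]; [exact: H1|exact: IH].
Qed.

Lemma trunc_comp al ga w : isfld al -> isfld ga ->
  exists q0, trunc (fun s t => al s (ga t w)) q0.
Proof.
move=> Ha Hg; have [q0 H] := fld_tr Hg w; exists q0 => s t Ht.
by rewrite H // fld0.
Qed.

Lemma truncR_comp al ga w : isfld al -> isfld ga ->
  exists q0, truncR (fun s t => ga t (al s w)) q0.
Proof.
move=> Ha Hg; have [q0 H] := fld_tr Ha w; exists q0 => s t Hs.
by rewrite H // fld0.
Qed.

(** The modes in z of the residue in x of
    x ^ m ((x - z) ^ n al(x) be(z) - eps (x - z) ^ n be(z) al(x)), the two powers of x - z being
    expanded for |x| > |z| and for |z| > |x|; [eps] is the Koszul sign. *)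
Definition prodF (eps : F) al be m n : field_ := fun q w =>
  PL n (fun s t => al s (be t w)) m q - eps *: PR n (fun s t => be t (al s w)) m q.

Lemma prodFE eps al be m n q w : prodF eps al be m n q w =
  PL n (fun s t => al s (be t w)) m q - eps *: PR n (fun s t => be t (al s w)) m q.
Proof. by []. Qed.

Lemma prodF_rec eps al be m n q w : isfld al -> isfld be ->
  prodF eps al be m (n + 1) q w =
  prodF eps al be (m + 1) n q w - prodF eps al be m n (q + 1) w.
Proof.
move=> Ha Hb; have [q0 H] := trunc_comp w Ha Hb; have [q1 H1] := truncR_comp w Ha Hb.
rewrite /prodF (PL_rec _ _ _ H) (PR_rec _ _ _ H1) scalerBr.
exact: subr4.
Qed.

Lemma prodF0 eps al be m q w : isfld al -> isfld be ->
  prodF eps al be m 0 q w = al m (be q w) - eps *: be q (al m w).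
Proof.
by move=> Ha Hb; have [q1 H1] := truncR_comp w Ha Hb; rewrite /prodF PL0 (PR0 _ _ H1).
Qed.

Lemma PR_trunc2 n m (Psi : rat -> rat -> M) s0 :
  truncR Psi s0 -> (forall s, exists t0, forall t, t0 <= t -> Psi s t = 0) ->
  exists t0, forall t, t0 <= t -> PR n Psi m t = 0.
Proof.
move=> H H2; have [K HK] := rat_bound m s0.
have [t0 Ht] : exists t0, forall t k, (k < K)%N -> t0 <= t -> Psi (m + k%:R) (t + n%:~R - k%:R) = 0.
  apply: (fin_bound (P := fun k t => Psi (m + k%:R) (t + n%:~R - k%:R) = 0)) => k.
  have [t0 Ht] := H2 (m + k%:R); exists (t0 - n%:~R + k%:R) => t Hk; apply: Ht; lra.
exists t0 => t Htt; rewrite /PR (@nsumE _ _ _ 0) ?big_ord0 // => k _.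
case: (ltnP k K) => [kK|Kk]; first by rewrite Ht ?scaler0.
by rewrite H ?scaler0 // HK.
Qed.

Lemma isfld_prodF eps al be m n : isfld al -> isfld be -> isfld (prodF eps al be m n).
Proof.
move=> Ha Hb; split.
- move=> q c x y; rewrite /prodF.
  have [q0 H0] := trunc_comp x Ha Hb; have [q1 H1] := truncR_comp x Ha Hb.
  have [q2 H2] := trunc_comp y Ha Hb; have [q3 H3] := truncR_comp y Ha Hb.
  pose Q := Num.max q0 q2; pose Q' := Num.max q1 q3.
  have -> : (fun s t => al s (be t (c *: x + y))) =
     (fun s t => c *: al s (be t x) + al s (be t y)).
    by apply: funext => s; apply: funext => t; rewrite !(fld_lin Hb, fld_lin Ha).
  have -> : (fun s t => be t (al s (c *: x + y))) =
     (fun s t => c *: be t (al s x) + be t (al s y)).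
    by apply: funext => s; apply: funext => t; rewrite !(fld_lin Ha, fld_lin Hb).
  rewrite (@PL_comb _ _ _ _ _ Q) ?(@PR_comb _ _ _ _ _ Q'); first last.
  - by move=> s t; rewrite ge_max => /andP[]; intros; apply: H2.
  - by move=> s t; rewrite ge_max => /andP[]; intros; apply: H0.
  - by move=> s t; rewrite ge_max => /andP[]; intros; apply: H3.
  - by move=> s t; rewrite ge_max => /andP[]; intros; apply: H1.
  rewrite !scalerDr !scalerN !scalerA opprD addrACA; congr (_ + _ + _).
  by rewrite mulrC.
- move=> w; have [q0 H0] := trunc_comp w Ha Hb; have [q1 H1] := truncR_comp w Ha Hb.
  have [t0 Ht] := @PR_trunc2 n m _ _ H1 (fun s => fld_tr Hb (al s w)).
  exists (Num.max q0 t0) => q; rewrite ge_max => /andP[h1 h2].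
  by rewrite /prodF (PL_trunc _ H0) // Ht // scaler0 subr0.
- move=> q w Hq.
  have H (z : rat) : z \is a Num.int -> ~~ Tint T (q + z).
    move=> Hz; apply: contra Hq => Hq; rewrite -[q](addrK z) TintB //; exact: Tint_int.
  rewrite /prodF /PL /PR !(@nsumE _ _ _ 0) ?big_ord0 ?scaler0 ?subr0 // => k _.
  - rewrite (fld_T Hb) ?scaler0 // -addrA H // rpredB ?natr_int ?intr_int //.
  - by rewrite (fld_T Hb) ?H ?natr_int // fld0 ?scaler0.
Qed.

(** Multiplication by z ^ c. *)
Definition zsh (c : rat) al : field_ := fun q => al (q + c).

Lemma zshA c d al : zsh c (zsh d al) = zsh (c + d) al.
Proof. by apply: funext => q; rewrite /zsh addrA. Qed.

Lemma zsh0 al : zsh 0 al = al.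
Proof. by apply: funext => q; rewrite /zsh addr0. Qed.

Lemma isfld_zsh c al : Tint T c -> isfld al -> isfld (zsh c al).
Proof.
move=> Hc [H1 H2 H3]; split=> [q|w|q w Hq]; first exact: H1.
  by have [q0 H] := H2 w; exists (q0 - c) => q Hq; apply: H; lra.
by apply: H3; apply: contra Hq => Hq; rewrite -[q](addrK c) TintB.
Qed.

Lemma prodF_zsh eps al be m n c : prodF eps al (zsh c be) m n = zsh c (prodF eps al be m n).
Proof.
apply: funext => q; apply: funext => w; rewrite /prodF /zsh.
have -> : PL n (fun s t => al s (be (t + c) w)) m q =
    PL n (fun s t => al s (be t w)) m (q + c).
  by have := PL_shift (fun s t => al s (be t w)) n m q 0 c; rewrite addr0 => <-;
     apply: PL_ext => k; rewrite addr0.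
by have := PR_shift (fun s t => be t (al s w)) n m q 0 c; rewrite addr0 => <-;
   congr (_ - _ *: _); apply: PR_ext => k; rewrite addr0.
Qed.

Lemma isfld0 : isfld (0 : field_).
Proof. by split=> [q c x y|w|//]; [rewrite scaler0 addr0 | exists 0]. Qed.

Lemma isfld_comb c al be : isfld al -> isfld be -> isfld (c *: al + be : field_).
Proof.
move=> [a1 a2 a3] [b1 b2 b3].
have E q w : (c *: al + be : field_) q w = c *: al q w + be q w by [].
split=> [q d x y|w|q w Hq]; rewrite ?E.
- by rewrite a1 b1 !scalerDr !scalerA [c * d]mulrC addrACA.
- have [q0 H0] := a2 w; have [q1 H1] := b2 w; exists (Num.max q0 q1) => q.
  by rewrite ge_max E => /andP[h1 h2]; rewrite H0 // H1 // scaler0 addr0.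
- by rewrite a3 // b3 // scaler0 addr0.
Qed.

Lemma prodF_combr eps al be be' c m n : isfld al -> isfld be -> isfld be' ->
  prodF eps al (c *: be + be' : field_) m n =
  c *: prodF eps al be m n + prodF eps al be' m n.
Proof.
move=> Ha Hb Hb'; apply: funext => q; apply: funext => w.
have E (x y : field_) q' w' : (c *: x + y) q' w' = c *: x q' w' + y q' w' by [].
rewrite E /prodF.
have [q0 H0] := trunc_comp w Ha Hb; have [q1 H1] := truncR_comp w Ha Hb.
have [q2 H2] := trunc_comp w Ha Hb'; have [q3 H3] := truncR_comp w Ha Hb'.
pose Q := Num.max q0 q2; pose Q' := Num.max q1 q3.
have -> : (fun s t => al s ((c *: be + be' : field_) t w)) =
   (fun s t => c *: al s (be t w) + al s (be' t w)).
  by apply: funext => s; apply: funext => t; rewrite E (fld_lin Ha).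
have -> : (fun s t => (c *: be + be' : field_) t (al s w)) =
   (fun s t => c *: be t (al s w) + be' t (al s w)) by [].
rewrite (@PL_comb _ _ _ _ _ Q) ?(@PR_comb _ _ _ _ _ Q'); first last.
- by move=> s t; rewrite ge_max => /andP[]; intros; apply: H2.
- by move=> s t; rewrite ge_max => /andP[]; intros; apply: H0.
- by move=> s t; rewrite ge_max => /andP[]; intros; apply: H3.
- by move=> s t; rewrite ge_max => /andP[]; intros; apply: H1.
rewrite !scalerDr !scalerN !scalerA opprD addrACA; congr (_ + _ + _).
by rewrite mulrC.
Qed.

Lemma prodF_combl eps al al' be c m n : isfld al -> isfld al' -> isfld be ->
  prodF eps (c *: al + al' : field_) be m n =
  c *: prodF eps al be m n + prodF eps al' be m n.
Proof.
move=> Ha Ha' Hb; apply: funext => q; apply: funext => w.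
have E (x y : field_) q' w' : (c *: x + y) q' w' = c *: x q' w' + y q' w' by [].
rewrite E /prodF.
have [q0 H0] := trunc_comp w Ha Hb; have [q1 H1] := truncR_comp w Ha Hb.
have [q2 H2] := trunc_comp w Ha' Hb; have [q3 H3] := truncR_comp w Ha' Hb.
pose Q := Num.max q0 q2; pose Q' := Num.max q1 q3.
have -> : (fun s t => (c *: al + al' : field_) s (be t w)) =
   (fun s t => c *: al s (be t w) + al' s (be t w)) by [].
have -> : (fun s t => be t ((c *: al + al' : field_) s w)) =
   (fun s t => c *: be t (al s w) + be t (al' s w)).
  by apply: funext => s; apply: funext => t; rewrite E (fld_lin Hb).
rewrite (@PL_comb _ _ _ _ _ Q) ?(@PR_comb _ _ _ _ _ Q'); first last.
- by move=> s t; rewrite ge_max => /andP[]; intros; apply: H2.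
- by move=> s t; rewrite ge_max => /andP[]; intros; apply: H0.
- by move=> s t; rewrite ge_max => /andP[]; intros; apply: H3.
- by move=> s t; rewrite ge_max => /andP[]; intros; apply: H1.
rewrite !scalerDr !scalerN !scalerA opprD addrACA; congr (_ + _ + _).
by rewrite mulrC.
Qed.

(** ** The commutator of two products *)

Let binrS := binrS charF T_gt0 cop.

Lemma pascal_sum (N : nat) (G : nat -> M) a : Tint T a ->
  (forall i, (N <= i)%N -> G i = 0) ->
  \sum_(i < N) binr F (a + 1) i *: G i = \sum_(i < N) binr F a i *: (G i + G i.+1).
Proof.
move=> Ha HG; case: N HG => [|N] HG; first by rewrite !big_ord0.
under [RHS]eq_bigr => i _ do rewrite scalerDr.
rewrite big_split /= [X in _ = X + _]big_ord_recl [X in _ = _ + X]big_ord_recr /=.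
rewrite (HG N.+1) // scaler0 addr0 big_ord_recl !binr0 -addrA -big_split; congr (_ + _).
by apply: eq_bigr => i _; rewrite /bump /= add1n binrS // scalerDl.
Qed.

(** The right hand side of the commutator formula obeys the recursion of
    multiplication by x - z. *)
Lemma sum_rec (H : nat -> int -> rat -> rat -> M) (N : nat) (n n' : int) (m m' q : rat) :
  (forall i n m q, H i (n + 1) m q = H i n (m + 1) q - H i n m (q + 1)) ->
  (forall i n m q, (N <= i)%N -> H i n m q = 0) -> Tint T m' ->
  let S n' m' q := \sum_(i < N) \sum_(j < N) (binr F m' i * binr F n'%:~R j) *:
       H (i + j)%N (n + n' - j%:Z) (m + m' - i%:R) q in
  S (n' + 1) m' q = S n' (m' + 1) q - S n' m' (q + 1).
Proof.
move=> Hrec HN Hm S.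
have SE k a r : S k a r = \sum_(i < N) binr F a i *: \sum_(j < N) binr F k%:~R j *:
       H (i + j)%N (n + k - j%:Z) (m + a - i%:R) r.
  by apply: eq_bigr => i _; rewrite scaler_sumr; apply: eq_bigr => j _; rewrite scalerA.
rewrite !SE (@pascal_sum N (fun i => \sum_(j < N) binr F n'%:~R j *:
  H (i + j)%N (n + n' - j%:Z) (m + (m' + 1) - i%:R) q)) //; last first.
  by move=> i Hi; rewrite big1 // => j _; rewrite HN ?scaler0 // (leq_trans Hi) // leq_addr.
rewrite -sumrB; apply: eq_bigr => i _; rewrite -scalerBr; congr (_ *: _).
rewrite rmorphD /= (@pascal_sum N (fun j => H (i + j)%N (n + (n' + 1) - j%:Z) (m + m' - i%:R) q)) ?Tint_intr //;
  last by move=> j Hj; rewrite HN // (leq_trans Hj) // leq_addl.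
rewrite -big_split -sumrB; apply: eq_bigr => j _ /=.
rewrite -scalerDr -scalerBr; congr (_ *: _).
have -> : n + (n' + 1) - j%:Z = n + n' - j%:Z + 1 by ring.
rewrite Hrec addrAC; congr (_ + _ - _).
  by congr (H _ _ _ _); ring.
rewrite addSnnS; congr (H _ _ _ _); last by rewrite -natr1; ring.
by rewrite -addn1 PoszD; ring.
Qed.

Lemma PL_sub (A B : rat -> rat -> M) q0 e n m q : trunc A q0 -> trunc B q0 ->
  PL n (fun s t => A s t - e *: B s t) m q = PL n A m q - e *: PL n B m q.
Proof.
move=> HA HB; rewrite addrC -scaleNr -(PL_comb _ _ _ _ HB HA).
by apply: PL_ext => k; rewrite addrC scaleNr.
Qed.

Lemma PR_sub (A B : rat -> rat -> M) q0 e n m q : truncR A q0 -> truncR B q0 ->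
  PR n (fun s t => A s t - e *: B s t) m q = PR n A m q - e *: PR n B m q.
Proof.
move=> HA HB; rewrite addrC -scaleNr -(PR_comb _ _ _ _ HB HA).
by apply: PR_ext => k; rewrite addrC scaleNr.
Qed.

(** A nested product is the combination of the four double expansions. *)
Lemma prodF_nest al be ga e e' m n m' n' q w : isfld al -> isfld be -> isfld ga ->
  prodF e' al (prodF e be ga m n) m' n' q w =
  PL n' (fun s t => PL n (fun s' t' => al s (be s' (ga t' w))) m t) m' q
  - e *: PL n' (fun s t => PR n (fun s' t' => al s (ga t' (be s' w))) m t) m' q
  - e' *: (PR n' (fun s t => PL n (fun s' t' => be s' (ga t' (al s w))) m t) m' q
  - e *: PR n' (fun s t => PR n (fun s' t' => ga t' (be s' (al s w))) m t) m' q).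
Proof.
move=> Ha Hb Hg; rewrite {1}/prodF.
have E1 s t : al s (prodF e be ga m n t w) =
    PL n (fun s' t' => al s (be s' (ga t' w))) m t -
    e *: PR n (fun s' t' => al s (ga t' (be s' w))) m t.
  have [q0 H0] := trunc_comp w Hb Hg; have [q1 H1] := truncR_comp w Hb Hg.
  rewrite /prodF (linB (fld_lin Ha _)) (linZ (fld_lin Ha _)).
  by rewrite (PL_lin _ _ _ H0 (fld_lin Ha _)) (PR_lin _ _ _ H1 (fld_lin Ha _)).
have [q0 H0] := fld_tr Hg w.
have T1 : trunc (fun s t => PL n (fun s' t' => al s (be s' (ga t' w))) m t) q0.
  move=> s t Ht; apply: (@PL_trunc _ _ _ q0) => // s' t' Ht'.
  by rewrite H0 // (fld0 _ Hb) (fld0 _ Ha).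
have [q1 T2] : exists q1, trunc (fun s t => PR n (fun s' t' => al s (ga t' (be s' w))) m t) q1.
  have [q1 H1] := truncR_comp w Hb Hg.
  have [q2 H2] := @PR_trunc2 n m _ _ H1 (fun s => fld_tr Hg (be s w)).
  exists q2 => s t Ht; have := H2 _ Ht => /(congr1 (al s)).
  by rewrite (PR_lin _ _ _ H1 (fld_lin Ha _)) (fld0 _ Ha).
have [s0 Hs0] := fld_tr Ha w.
congr (_ - _ *: _).
- rewrite -(@PL_sub _ _ (Num.max q0 q1)).
  + by congr (PL _ _ _ _); apply: funext => s; apply: funext => t.
  + by move=> s t; rewrite ge_max => /andP[h0 h1]; apply: T1.
  + by move=> s t; rewrite ge_max => /andP[h0 h1]; apply: T2.
- rewrite -(@PR_sub _ _ s0) => [|s t Hs|s t Hs].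
  + by congr (PR _ _ _ _).
  + rewrite Hs0 // /PL (@nsumE _ _ _ 0) ?big_ord0 // => l _.
    by rewrite (fld0 _ Hg) (fld0 _ Hb) scaler0.
  + rewrite Hs0 // /PR (@nsumE _ _ _ 0) ?big_ord0 // => l _.
    by rewrite (fld0 _ Hb) (fld0 _ Hg) scaler0.
Qed.

Section Commutator.
Variables (al be ga : rat -> M -> M) (beI : nat -> rat -> M -> M) (N : nat).
Variables (eab eac ebc : F) (c : rat).
Hypotheses (Ha : isfld al) (Hb : isfld be) (Hg : isfld ga).
Hypothesis HI : forall i, isfld (beI i).
Hypothesis HN : forall i, (N <= i)%N -> beI i = 0.
Hypothesis eab2 : eab * eab = 1.
Hypothesis Tc : Tint T c.
Hypothesis comm : forall s t w, congZ s c ->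
  al s (be t w) - eab *: be t (al s w) =
  \sum_(i < N) binr F s i *: beI i (s + t - i%:R) w.

Let HabgL w : exists q0, forall s s' t, q0 <= t -> al s (be s' (ga t w)) = 0.
Proof.
have [q0 H] := fld_tr Hg w; exists q0 => s s' t Ht.
by rewrite H // (fld0 _ Hb) (fld0 _ Ha).
Qed.

Let HbagL w : exists q0, forall s s' t, q0 <= t -> be s' (al s (ga t w)) = 0.
Proof.
have [q0 H] := fld_tr Hg w; exists q0 => s s' t Ht.
by rewrite H // (fld0 _ Ha) (fld0 _ Hb).
Qed.

Let HIgL w : exists q0, forall i s t, q0 <= t -> beI i s (ga t w) = 0.
Proof.
have [q0 H] := fld_tr Hg w; exists q0 => i s t Ht.
by rewrite H // (fld0 _ (HI i)).
Qed.

Let HgIR w : exists s0, forall i s t, s0 <= s -> ga t (beI i s w) = 0.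
Proof.
have [s0 H] := @fin_bound (fun i s => beI i s w = 0) N (fun i => fld_tr (HI i) w).
exists s0 => i s t Hs; case: (ltnP i N) => iN; last by rewrite HN // (fld0 _ Hg).
by rewrite H // (fld0 _ Hg).
Qed.

(** In two of the four double expansions the modes of [al] and [be] are next to each other, and
    moving the former past the latter produces the fields [beI]. Both sides obey the same
    recursion in n', so that they are compared at n' = 0 only. *)
Lemma comm_LL (n n' : int) (m m' q : rat) w : congZ m' c ->
  PL n' (fun s t => PL n (fun s' t' =>
     al s (be s' (ga t' w)) - eab *: be s' (al s (ga t' w))) m t) m' q =
  \sum_(i < N) \sum_(j < N) (binr F m' i * binr F n'%:~R j) *:
     PL (n + n' - j%:Z) (fun s t => beI (i + j)%N s (ga t w)) (m + m' - i%:R) q.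
Proof.
have [q0 H0] := HabgL w; have [q1 H1] := HbagL w; have [q2 H2] := HIgL w.
pose Q := Num.max q0 q1.
pose Psi s s' t' := al s (be s' (ga t' w)) - eab *: be s' (al s (ga t' w)).
have HPsi s s' t : Q <= t -> Psi s s' t = 0.
  by rewrite /Psi ge_max => /andP[h0 h1]; rewrite H0 // H1 // scaler0 subr0.
have Htr k a : trunc (fun s t => PL k (fun s' t' => Psi s s' t') a t) Q.
  by move=> s t Ht; rewrite (@PL_trunc _ _ _ Q) // => s' t'; apply: HPsi.
move=> Hm; apply/eqP; rewrite -subr_eq0; apply/eqP.
pose h n' m' q := PL n' (fun s t => PL n (fun s' t' => Psi s s' t') m t) m' q -
  \sum_(i < N) \sum_(j < N) (binr F m' i * binr F n'%:~R j) *: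
     PL (n + n' - j%:Z) (fun s t => beI (i + j)%N s (ga t w)) (m + m' - i%:R) q.
apply: (@uniq_L _ _ h c q) (congZ_refl q) => //.
- move=> {Hm}n' {}m' q' Hm' Hq'; rewrite /h (PL_rec _ _ _ (Htr n m)).
  have -> := @sum_rec (fun i n m q => PL n (fun s t => beI i s (ga t w)) m q) N n n' m m' q'.
  - exact: subr4.
  - by move=> i k a r; rewrite (@PL_rec _ _ q2) // => s t; apply: H2.
  - move=> i k a r Hi; rewrite HN // /PL (@nsumE _ _ _ 0) ?big_ord0 // => l _.
    by rewrite scaler0.
  - by rewrite -[m'](subrK c) TintD // Tint_int.
- move=> k; exists (Num.max Q q2) => a r _ _; rewrite ge_max => /andP[h1 h2].
  rewrite /h (PL_trunc _ (Htr n m)) // big1 ?subr0 // => i _; rewrite big1 // => j _.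
  by rewrite (@PL_trunc _ _ _ q2) ?scaler0 // => s t; apply: H2.
- move=> {Hm}m' r Hm _; rewrite /h PL0.
  have -> : PL n (fun s' t' => Psi m' s' t') m r =
     PL n (fun s' t' => \sum_(i < N) binr F m' i *: beI i (s' + (m' - i%:R)) (ga t' w)) m r.
    apply: PL_ext => k; rewrite /Psi comm //; apply: eq_bigr => i _.
    by congr (_ *: beI _ _ _); ring.
  rewrite (@PL_sum _ _ _ _ _ _ q2) => [|i s t]; last exact: H2.
  apply/eqP; rewrite subr_eq0; apply/eqP/eq_bigr => i _.
  have := PL_shift (fun s t => beI i s (ga t w)) n m r (m' - i%:R) 0.
  rewrite addr0 => E.
  have -> : PL n (fun s t => beI i (s + (m' - i%:R)) (ga t w)) m r =
    PL n (fun s t => beI i s (ga t w)) (m + (m' - i%:R)) r.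
    by rewrite -E; apply: PL_ext => k; rewrite addr0.
  have N0 : (0 < N)%N := leq_ltn_trans (leq0n i) (ltn_ord i).
  rewrite (bigD1 (Ordinal N0)) //= big1 ?addr0 => [|j j0].
    by rewrite binr0 mulr1 addn0 !addrA ?subr0 ?addr0.
  have /negbTE j0' : (j != 0%N :> nat) by [].
  by rewrite (binr_0 charF T_gt0 cop) j0' mulr0 scale0r.
Qed.

Lemma comm_RR (n n' : int) (m m' q : rat) w : congZ m' c ->
  PR n' (fun s t => PR n (fun s' t' =>
     ga t' (al s (be s' w)) - eab *: ga t' (be s' (al s w))) m t) m' q =
  \sum_(i < N) \sum_(j < N) (binr F m' i * binr F n'%:~R j) *:
     PR (n + n' - j%:Z) (fun s t => ga t (beI (i + j)%N s w)) (m + m' - i%:R) q.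
Proof.
have [s2 H2] := HgIR w.
pose Psi s s' t' := ga t' (al s (be s' w)) - eab *: ga t' (be s' (al s w)).
have [S HS] : exists S, forall s (l : nat) t, S <= s -> Psi s (m + l%:R) t = 0.
  have [s0 H0] := fld_tr Ha w; have [s1 H1] := fld_tr Hb w.
  have [L HL] := rat_bound m s1.
  have [S HS] := @fin_bound (fun l s => al s (be (m + l%:R) w) = 0) L
     (fun l => fld_tr Ha (be (m + l%:R) w)).
  exists (Num.max s0 S) => s l t; rewrite ge_max /Psi => /andP[h0 h1].
  rewrite H0 // (fld0 _ Hb) (fld0 _ Hg) scaler0 subr0.
  case: (ltnP l L) => lL; first by rewrite HS // (fld0 _ Hg).
  by rewrite H1 ?HL // (fld0 _ Ha) (fld0 _ Hg).
have Htr k : truncR (fun s t => PR k (fun s' t' => Psi s s' t') m t) S.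
  move=> s t Ht; rewrite /PR (@nsumE _ _ _ 0) ?big_ord0 // => l _.
  by rewrite HS // scaler0.
move=> Hm; apply/eqP; rewrite -subr_eq0; apply/eqP.
pose h n' m' q := PR n' (fun s t => PR n (fun s' t' => Psi s s' t') m t) m' q -
  \sum_(i < N) \sum_(j < N) (binr F m' i * binr F n'%:~R j) *:
     PR (n + n' - j%:Z) (fun s t => ga t (beI (i + j)%N s w)) (m + m' - i%:R) q.
apply: (@uniq_R _ _ h c q) (congZ_refl q) => //.
- move=> {Hm}n' {}m' q' Hm' Hq'; rewrite /h (PR_rec _ _ _ (Htr n)).
  have -> := @sum_rec (fun i n m q => PR n (fun s t => ga t (beI i s w)) m q) N n n' m m' q'.
  - exact: subr4.
  - by move=> i k a r; rewrite (@PR_rec _ _ s2) // => s t; apply: H2.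
  - move=> i k a r Hi; rewrite HN // /PR (@nsumE _ _ _ 0) ?big_ord0 // => l _.
    by rewrite (fld0 _ Hg) scaler0.
  - by rewrite -[m'](subrK c) TintD // Tint_int.
- move=> k; exists (Num.max S (s2 - m + N%:R)) => a r _ _; rewrite ge_max => /andP[h1 h2].
  rewrite /h (PR_trunc _ (Htr n)) // big1 ?subr0 // => i _; rewrite big1 // => j _.
  rewrite (@PR_trunc _ _ _ s2) ?scaler0 // => [s t|]; first exact: H2.
  have : i%:R <= N%:R :> rat by rewrite ler_nat ltnW.
  lra.
- move=> {Hm}m' r Hm _; rewrite /h (PR0 _ _ (Htr n)).
  have -> : PR n (fun s' t' => Psi m' s' t') m r =
     PR n (fun s' t' => \sum_(i < N) binr F m' i *: ga t' (beI i (s' + (m' - i%:R)) w)) m r.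
    apply: PR_ext => k; rewrite /Psi -(linZ (fld_lin Hg _)) -(linB (fld_lin Hg _)) comm //.
    rewrite (lin_sum (fld_lin Hg _)); apply: eq_bigr => i _.
    by rewrite (linZ (fld_lin Hg _)); congr (_ *: ga _ (beI _ _ _)); ring.
  rewrite (@PR_sum _ _ _ _ _ _ (s2 - m' + N%:R)) => [|i s t Hs]; last first.
    case: (ltnP i N) => iN; last by rewrite HN // (fld0 _ Hg).
    apply: H2; have : i%:R <= N%:R :> rat by rewrite ler_nat ltnW.
    lra.
  apply/eqP; rewrite subr_eq0; apply/eqP/eq_bigr => i _.
  have := PR_shift (fun s t => ga t (beI i s w)) n m r (m' - i%:R) 0.
  rewrite addr0 => E.
  have -> : PR n (fun s t => ga t (beI i (s + (m' - i%:R)) w)) m r =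
    PR n (fun s t => ga t (beI i s w)) (m + (m' - i%:R)) r.
    by rewrite -E; apply: PR_ext => k; rewrite addr0.
  have N0 : (0 < N)%N := leq_ltn_trans (leq0n i) (ltn_ord i).
  rewrite (bigD1 (Ordinal N0)) //= big1 ?addr0 => [|j j0].
    by rewrite binr0 mulr1 addn0 !addrA ?subr0 ?addr0.
  have /negbTE j0' : (j != 0%N :> nat) by [].
  by rewrite (binr_0 charF T_gt0 cop) j0' mulr0 scale0r.
Qed.

(** The commutator formula: if the brackets of the modes of [al] and [be] are given by the
    fields [beI i], then so are the brackets of the operators ga -> al_(m', n') ga and
    ga -> be_(m, n) ga on fields. *)
Lemma prodF_comm (n n' : int) (m m' : rat) : congZ m' c ->
  prodF (eab * eac) al (prodF ebc be ga m n) m' n' =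
  eab *: (prodF (eab * ebc) be (prodF eac al ga m' n') m n : field_) +
  \sum_(i < N) \sum_(j < N) (binr F m' i * binr F n'%:~R j) *:
     (prodF (eac * ebc) (beI (i + j)%N) ga (m + m' - i%:R) (n + n' - j%:Z) : field_).
Proof.
move=> Hm; apply: funext => q; apply: funext => w.
have sumE (G : 'I_N -> 'I_N -> field_) : (\sum_(i < N) \sum_(j < N) G i j) q w =
    \sum_(i < N) \sum_(j < N) G i j q w.
  have E (I : Type) (r : seq I) (H : I -> field_) : (\sum_(i <- r) H i) q w = \sum_(i <- r) H i q w.
    by elim: r => [|i r IH]; rewrite ?big_nil // !big_cons -IH.
  by rewrite E; apply: eq_bigr => i _; rewrite E.
have addE (x y : field_) e : (e *: x + y) q w = e *: x q w + y q w by [].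
rewrite addE sumE.
have scE (x : field_) e : (e *: x) q w = e *: x q w by [].
under eq_bigr => i _ do under eq_bigr => j _ do rewrite scE /prodF scalerBr.
under eq_bigr => i _ do rewrite sumrB.
rewrite sumrB -comm_LL //.
under [X in _ + (_ - X)]eq_bigr => i _ do
  under eq_bigr => j _ do rewrite scalerA [_ * (eac * ebc)]mulrC -scalerA.
under [X in _ + (_ - X)]eq_bigr => i _ do rewrite -scaler_sumr.
rewrite -scaler_sumr -comm_RR //.
rewrite !prodF_nest //.
have [q0 H0] := HabgL w; have [q1 H1] := HbagL w; pose Q := Num.max q0 q1.
have h0 s s' t : Q <= t -> al s (be s' (ga t w)) = 0.
  by rewrite ge_max => /andP[h _]; apply: H0.
have h1 s s' t : Q <= t -> be s' (al s (ga t w)) = 0.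
  by rewrite ge_max => /andP[_ h]; apply: H1.
have tr2 (Psi : rat -> rat -> rat -> M) k m0 : (forall s s' t, Q <= t -> Psi s s' t = 0) ->
    trunc (fun s t => PL k (fun s' t' => Psi s s' t') m0 t) Q.
  by move=> H s t Ht; rewrite (@PL_trunc _ _ _ Q) // => s' t' Ht'; apply: H.
have -> : PL n' (fun s t => PL n (fun s' t' =>
     al s (be s' (ga t' w)) - eab *: be s' (al s (ga t' w))) m t) m' q =
   PL n' (fun s t => PL n (fun s' t' => al s (be s' (ga t' w))) m t) m' q -
   eab *: PL n' (fun s t => PL n (fun s' t' => be s' (al s (ga t' w))) m t) m' q.
  rewrite -(@PL_sub _ _ Q); [|exact: tr2|exact: tr2].
  apply: PL_ext => k; rewrite (@PL_sub _ _ Q) // => s t Ht; [exact: h0|exact: h1].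
have [s0 Hs0] := fld_tr Ha w; have [s1 Hs1] := fld_tr Hb w.
have tr3 (x y : rat -> M -> M) k m0 : isfld x -> isfld y ->
   exists s, truncR (fun s t => PR k (fun s' t' => ga t' (x s (y s' w))) m0 t) s.
  move=> Hx Hy; have [r0 Hr0] := fld_tr Hy w; have [L HL] := rat_bound m0 r0.
  have [S HS] := @fin_bound (fun l s => x s (y (m0 + l%:R) w) = 0) L
     (fun l => fld_tr Hx (y (m0 + l%:R) w)).
  exists S => s t Hs; rewrite /PR (@nsumE _ _ _ 0) ?big_ord0 // => l _.
  case: (ltnP l L) => lL; first by rewrite HS // (fld0 _ Hg) scaler0.
  by rewrite Hr0 ?HL // (fld0 _ Hx) (fld0 _ Hg) scaler0.
have tr4 (x y : rat -> M -> M) k m0 : isfld x -> isfld y ->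
   exists s, truncR (fun s t => PR k (fun s' t' => ga t' (y s' (x s w))) m0 t) s.
  move=> Hx Hy; have [r0 Hr0] := fld_tr Hx w.
  exists r0 => s t Hs; rewrite /PR (@nsumE _ _ _ 0) ?big_ord0 // => l _.
  by rewrite Hr0 // (fld0 _ Hy) (fld0 _ Hg) scaler0.
have -> : PR n' (fun s t => PR n (fun s' t' =>
     ga t' (al s (be s' w)) - eab *: ga t' (be s' (al s w))) m t) m' q =
   PR n' (fun s t => PR n (fun s' t' => ga t' (al s (be s' w))) m t) m' q -
   eab *: PR n' (fun s t => PR n (fun s' t' => ga t' (be s' (al s w))) m t) m' q.
  have [r1 Hr1] := tr3 al be n m Ha Hb; have [r2 Hr2] := tr4 al be n m Ha Hb.
  rewrite -(@PR_sub _ _ (Num.max r1 r2)).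
  - apply: PR_ext => k.
    have [v0 Hv0] := fld_tr Hb w; have [v1 Hv1] := fld_tr Hb (al (m' + k%:R) w).
    rewrite (@PR_sub _ _ (Num.max v0 v1)) // => s t; rewrite ge_max => /andP[g0 g1].
    + by rewrite Hv0 // (fld0 _ Ha) (fld0 _ Hg).
    + by rewrite Hv1 // (fld0 _ Hg).
  - by move=> s t; rewrite ge_max => /andP[g0 g1]; apply: Hr1.
  - by move=> s t; rewrite ge_max => /andP[g0 g1]; apply: Hr2.
(* All double expansions can be exchanged, so that the four of the other order appear. *)
rewrite (@exch_LL _ _ (fun s s' t => be s' (al s (ga t w))) n n' m m' q Q) //.
rewrite (@exch_LR _ _ (fun s s' t => al s (ga t (be s' w))) n n' m m' q s1); first last.
- move=> s'; have [t0 Ht0] := fld_tr Hg (be s' w); exists t0 => s t Ht.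
  by rewrite Ht0 // (fld0 _ Ha).
- by move=> s s' t Hs'; rewrite Hs1 // (fld0 _ Hg) (fld0 _ Ha).
rewrite (@exch_RL _ _ (fun s s' t => be s' (ga t (al s w))) n n' m m' q s0); first last.
- move=> s; have [t0 Ht0] := fld_tr Hg (al s w); exists t0 => s' t Ht.
  by rewrite Ht0 // (fld0 _ Hb).
- by move=> s s' t Hs; rewrite Hs0 // (fld0 _ Hg) (fld0 _ Hb).
rewrite (@exch_RR _ _ (fun s s' t => ga t (al s (be s' w))) n n' m m' q s1); first last.
- by move=> s'; have [v0 Hv0] := fld_tr Ha (be s' w); exists v0 => s t Hs; rewrite Hv0 // (fld0 _ Hg).
- by move=> s s' t Hs'; rewrite Hs1 // (fld0 _ Ha) (fld0 _ Hg).
rewrite !scalerBr !scalerA [eab * (eab * ebc)]mulrA eab2 mul1r.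
rewrite [ebc * eac]mulrC.
have -> : eac * ebc * eab = eab * eac * ebc by rewrite mulrC mulrA.
by rewrite !sub_sub [RHS]addrC subrKA [X in _ = _ - X]addrC.
Qed.

End Commutator.

End Fields.

(** * The vacuum field and divided powers of the derivation *)

Section Vacuum.
Variables (F : fieldType) (p T : nat).
Hypotheses (charF : p \in [pchar F]) (T_gt0 : (0 < T)%N) (cop : coprime T p).
Variable M : lmodType F.
Implicit Types (al be ga : rat -> M -> M) (n : int) (m q : rat) (w : M).

Let binrS := binrS charF T_gt0 cop.
Let PL_rec := PL_rec charF T_gt0 cop.
Let PR_rec := PR_rec charF T_gt0 cop.
Let PL0 := PL0 charF T_gt0 cop.
Let PR0 := PR0 charF T_gt0 cop.
Let prodF_rec := prodF_rec charF T_gt0 cop.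
Let prodF0 := prodF0 charF T_gt0 cop.
Notation Tint := (Tint T).
Notation isfld := (isfld T).

Lemma fld_comb0 al : (forall q w, al q w = 0) -> al = 0 :> field_ M.
Proof. by move=> H; apply: funext => q; apply: funext => w; rewrite H. Qed.

(** A family with the recursion of multiplication by x - z, over a Frobenius
    power of x: (x - z) ^ P = x ^ P - z ^ P. *)
Lemma frob_rec (H : rat -> int -> rat -> M) :
  (forall m n q, H m (n + 1) q = H (m + 1) n q - H m n (q + 1)) ->
  forall e m n q, H (m + (p ^ e)%:R) n q =
    H m n (q + (p ^ e)%:R) + H m (n + (p ^ e)%:Z) q.
Proof.
move=> Hrec.
have Hrec' m n q : H (m + 1) n q = H m n (q + 1) + H m (n + 1) q by rewrite Hrec [RHS]addrC subrK.
have many N m n q : H (m + N%:R) n q =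
    \sum_(i < N.+1) 'C(N, i)%:R *: H m (n + i%:Z) (q + (N - i)%N%:R).
  elim: N m n q => [|N IH] m n q.
    by rewrite big_ord_recl big_ord0 !addr0 bin0 scale1r.
  rewrite -natr1 addrA Hrec' !IH.
  rewrite [RHS]big_ord_recl /= [X in X + _ = _]big_ord_recl /= !bin0 -addrA.
  congr (_ + _); first by rewrite !subn0 -natr1 !addr0; congr (_ *: H _ _ _); ring.
  have -> : \sum_(i < N) 'C(N, bump 0 i)%:R *: H m (n + bump 0 i) (q + 1 + (N - bump 0 i)%:R) =
     \sum_(i < N.+1) 'C(N, i.+1)%:R *: H m (n + i.+1%:Z) (q + (N - i)%N%:R).
    rewrite [RHS]big_ord_recr /= bin_small // scale0r addr0; apply: eq_bigr => i _.
    rewrite /bump /= add1n; congr (_ *: H _ _ _).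
    by rewrite -[in RHS](subnSK (ltn_ord i)) -[in RHS]natr1; ring.
  rewrite -big_split; apply: eq_bigr => i _ /=.
  rewrite /bump /= add1n binS natrD scalerDl subSS; congr (_ + _ *: H _ _ _).
  by rewrite intS addrA.
move=> e m n q; have p_pr := pcharf_prime charF.
have [P HP] : exists P, (p ^ e = P.+1)%N.
  by exists (p ^ e).-1; rewrite prednK // expn_gt0 prime_gt0.
(* Only the two extreme binomial coefficients of p ^ e survive. *)
rewrite many HP big_ord_recl big_ord_recr /= big1 ?add0r; last first.
  by move=> i _; rewrite /bump /= add1n -HP (bin_pfactor charF) ?scale0r // HP !ltnS /=.
by rewrite bin0 binn !scale1r addr0 subn0 /bump add1n subnn addr0.
Qed.

(** For a local family, the shift of m by a large power of p is the multiplication by that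
    power of z. *)
Lemma frob_stable (H : rat -> int -> rat -> M) (N : int) :
  (forall m n q, H m (n + 1) q = H (m + 1) n q - H m n (q + 1)) ->
  (forall m n q, N <= n -> H m n q = 0) ->
  forall e j m n q, N <= n + (p ^ e)%:Z ->
    H (m + (p ^ e * j)%:R) n q = H m n (q + (p ^ e * j)%:R).
Proof.
move=> Hrec HN e; elim=> [|j IH] m n q Hn; first by rewrite muln0 !addr0.
rewrite mulnS natrD addrA addrAC (frob_rec Hrec) (HN _ _ _ Hn) addr0 IH //.
by rewrite -addrA [_%:R + _]addrC.
Qed.

(** The identity operator, as a constant field. *)
Definition idF : field_ M := fun q w => if q == -1 then w else 0.

Lemma idFE q w : idF q w = if q == -1 then w else 0. Proof. by []. Qed.

Lemma isfld_idF : isfld idF.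
Proof.
split=> [q c x y|w|q w]; rewrite /idF.
- by case: ifP => // _; rewrite scaler0 addr0.
- by exists 0 => q Hq; case: eqP => // E; move: Hq; rewrite E.
- by case: eqP => // ->; rewrite Tint_int.
Qed.

(** Nonnegative products vanish for fields whose modes supercommute. *)
Lemma prodF_nonneg eps al be : isfld al -> isfld be ->
  (forall s t w, al s (be t w) = eps *: be t (al s w)) ->
  forall n m, 0 <= n -> prodF eps al be m n = 0 :> field_ M.
Proof.
move=> Ha Hb H; case=> // n m _; elim: n m => [|n IH] m; apply: fld_comb0 => q w.
  by rewrite prodF0 // H subrr.
by rewrite -addn1 PoszD prodF_rec // !IH subrr.
Qed.

Lemma idF_comm al s t w : isfld al -> al s (idF t w) = 1 *: idF t (al s w).
Proof. by move=> Ha; rewrite /idF scale1r; case: ifP => // _; rewrite (fld0 _ Ha). Qed.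

Lemma idF_comm' al s t w : isfld al -> idF s (al t w) = 1 *: al t (idF s w).
Proof. by move=> Ha; rewrite idF_comm // !scale1r. Qed.

Lemma prodF_idl_ge0 ga n m : isfld ga -> 0 <= n -> prodF 1 idF ga m n = 0 :> field_ M.
Proof.
by move=> Hg; apply: prodF_nonneg => // [|s t w]; [exact: isfld_idF|exact: idF_comm'].
Qed.

Lemma prodF_idr_ge0 al n m : isfld al -> 0 <= n -> prodF 1 al idF m n = 0 :> field_ M.
Proof.
by move=> Hg; apply: prodF_nonneg => // [|s t w]; [exact: isfld_idF|exact: idF_comm].
Qed.

Lemma nsum_single (f : nat -> M) k0 : (forall k, k != k0 -> f k = 0) -> nsum f = f k0.
Proof.
move=> H; rewrite (@nsumE _ _ _ k0.+1) => [|k Hk]; last by rewrite H // gtn_eqF.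
by rewrite big_ord_recr /= big1 ?add0r // => i _; rewrite H // ltn_eqF.
Qed.

Lemma nsum0 (f : nat -> M) : (forall k, f k = 0) -> nsum f = 0.
Proof. by move=> H; rewrite (@nsumE _ _ _ 0) ?big_ord0. Qed.

Lemma prodF_idl0 ga n : isfld ga ->
  prodF 1 idF ga 0 n = if n == -1 then ga else 0 :> field_ M.
Proof.
move=> Hg; case: (lerP 0 n) => Hn.
  by rewrite prodF_idl_ge0 //; case: eqP => // E; rewrite E in Hn.
apply: funext => q; apply: funext => w; rewrite /prodF.
have -> : PR n (fun s t => ga t (idF s w)) 0 q = 0.
  apply: nsum0 => k; rewrite /idF add0r; case: eqP => [E|_]; last by rewrite (fld0 _ Hg) scaler0.
  by have : 0 <= (k%:R : rat) by []; rewrite E.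
rewrite scaler0 subr0; case: eqP => [->|n1].
  rewrite /PL (@nsum_single _ 0%N) => [|k k0].
    by rewrite /idF expr0 binr0 mulr1 scale1r addr0.
  rewrite /idF add0r; case: eqP => [E|_]; last by rewrite scaler0.
  case/negP: k0; rewrite -(pnatr_eq0 rat); apply/eqP.
  by move: E; rewrite intrN; lra.
apply: nsum0 => k; rewrite /idF add0r; case: eqP => [/eqP|_]; last by rewrite scaler0.
rewrite subr_eq => /eqP E.
have : n%:~R = (- 1 + k%:Z)%:~R :> rat by rewrite rmorphD /= -pmulrn.
by move/eqP; rewrite eqr_int => /eqP; lia.
Qed.

(** The only nonzero product of the identity with a field is the one of index -1, when the
    exponent of x is a multiple of a large power of p. *)
Lemma prodF_idl ga n e (d : nat) : isfld ga -> 0 <= n + (p ^ e)%:Z ->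
  prodF 1 idF ga (p ^ e * d)%:R n =
  if n == -1 then zsh (p ^ e * d)%:R ga else 0 :> field_ M.
Proof.
move=> Hg Hn; have Hid := isfld_idF; apply: funext => q; apply: funext => w.
have := @frob_stable (fun m n q => prodF 1 idF ga m n q w) 0 _ _ e d 0 n q Hn.
rewrite add0r => ->; last 2 first.
- by move=> m k r; rewrite prodF_rec.
- by move=> m k r Hk; rewrite prodF_idl_ge0.
by rewrite prodF_idl0 //; case: eqP.
Qed.

(** The divided power of order k of the derivation d/dz. *)
Definition dd (k : nat) be : field_ M := fun q w =>
  ((-1) ^+ k * binr F q k) *: be (q - k%:R) w.

Lemma isfld_dd k be : isfld be -> isfld (dd k be).
Proof.
move=> Hb; split=> [q c x y|w|q w Hq]; rewrite /dd.
- by rewrite (fld_lin Hb) scalerDr !scalerA mulrC.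
- have [q0 H] := fld_tr Hb w; exists (q0 + k%:R) => q Hq.
  by rewrite H ?scaler0 //; lra.
- rewrite (fld_T Hb) ?scaler0 //; apply: contra Hq => Hq.
  by rewrite -[q](subrK k%:R) TintD ?Tint_nat.
Qed.

Lemma dd0 be : dd 0 be = be.
Proof.
by apply: funext => q; apply: funext => w; rewrite /dd expr0 binr0 mulr1 scale1r subr0.
Qed.

Lemma dd_zsh k be c e : isfld be -> Tint c -> (k < p ^ e)%N ->
  dd k (zsh ((p ^ e)%:R * c) be) = zsh ((p ^ e)%:R * c) (dd k be).
Proof.
move=> Hb Hc Hk; apply: funext => q; apply: funext => w; rewrite /dd /zsh.
have -> : q - k%:R + (p ^ e)%:R * c = q + (p ^ e)%:R * c - k%:R by ring.
case: (boolP (Tint q)) => Hq; first by rewrite (binr_near charF T_gt0 cop).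
rewrite (fld_T Hb) ?scaler0 //; apply: contra Hq => Hq.
have -> : q = q + (p ^ e)%:R * c - k%:R + k%:R - (p ^ e)%:R * c by ring.
by rewrite TintB ?TintMn // TintD ?Tint_nat.
Qed.

(** The products with the identity on the right are the divided derivatives of x ^ m al(x). *)
Lemma prodF_idr al m k c : isfld al -> congZ m c ->
  (forall q w, ~~ congZ q c -> al q w = 0) ->
  prodF 1 al idF m (- k.+1%:Z) = dd k (zsh m al) :> field_ M.
Proof.
move=> Ha Hm Hc; apply: funext => q; apply: funext => w; rewrite /prodF /dd /zsh scale1r.
have bneg a i : binr F (- a.+1%:R) i = (-1) ^+ i * 'C(a + i, i)%:R.
  have -> : - a.+1%:R = i%:R - (a + i)%:R - 1 :> rat by rewrite -natr1 natrD; ring.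
  by rewrite binr_neg (binr_natE charF T_gt0 cop).
have sgn2 i : (-1) ^+ i * (-1) ^+ i = 1 :> F by rewrite -exprMn mulrNN mulr1 expr1n.
have n1 : (- k.+1%:Z)%:~R = - k.+1%:R :> rat by rewrite intrN -pmulrn.
case: (boolP (q \is a Num.int)) => [/intrP[z ->]|Hq]; last first.
  rewrite Hc; last first.
    apply: contra Hq => Hq; rewrite -[q](addrK (m - c - k%:R)) rpredB //.
      by have -> : q + (m - c - k%:R) = q - k%:R + m - c by ring.
    by rewrite rpredB ?natr_int.
  have noq x v : x \is a Num.int -> idF (q + x) v = 0.
    move=> Hx; rewrite /idF; case: eqP => // E; case/negP: Hq.
    by rewrite -[q](addrK x) E rpredB // rpredN.
  rewrite scaler0 /PL /PR nsum0 ?nsum0 ?subrr // => i.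
    by rewrite -addrA noq ?scaler0 // rpredB ?natr_int ?intr_int.
  by rewrite noq ?natr_int // (fld0 _ Ha) scaler0.
case: z => a.
- (* nonnegative mode: only the expansion in |z| > |x| contributes *)
  have -> : PL (- k.+1%:Z) (fun s t => al s (idF t w)) m a%:~R = 0.
    apply: nsum0 => i; rewrite /idF; case: eqP => [E|_]; last by rewrite (fld0 _ Ha) scaler0.
    by have : 0 <= a%:R + i%:R :> rat; [rewrite addr_ge0 | rewrite -pmulrn in E; rewrite E].
  rewrite sub0r -pmulrn (binr_natE charF T_gt0 cop); case: (ltnP a k) => ak.
    rewrite bin_small // mulr0 scale0r /PR nsum0 ?oppr0 // => i; rewrite /idF; case: eqP => [E|_].
      exfalso; move: E; rewrite n1 -natr1 => E.
      have : a%:R + 1 <= k%:R :> rat by rewrite natr1 ler_nat.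
      have : 0 <= i%:R :> rat by []. lra.
    by rewrite scaler0.
  rewrite /PR (@nsum_single _ (a - k)%N) => [|i Hi]; last first.
    rewrite /idF n1; case: eqP => [E|_]; last by rewrite scaler0.
    case/negP: Hi; rewrite -(eqr_nat rat) natrB //; apply/eqP.
    by move: E; rewrite -natr1; lra.
  rewrite /idF n1 natrB // ifT; last by apply/eqP; rewrite -natr1; ring.
  rewrite bneg subnKC // -scaleNr mulrA sgn2 mul1r.
  have -> : m + (a%:R - k%:R) = a%:R - k%:R + m by rewrite addrC.
  rewrite bin_sub //; congr (_ *: _).
  have -> : (-1) ^ (- k.+1%:Z) = (-1) ^+ k.+1 :> F by rewrite -exprnN invr_sign.
  by rewrite exprS; ring.
- (* negative mode: only the expansion in |x| > |z| contributes *)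
  have qa : (Negz a)%:~R = - a.+1%:R :> rat by rewrite NegzE intrN -pmulrn.
  have -> : PR (- k.+1%:Z) (fun s t => idF t (al s w)) m (Negz a)%:~R = 0.
    apply: nsum0 => i; rewrite /idF qa n1; case: eqP => [E|_]; last by rewrite scaler0.
    exfalso; move: E; rewrite -!natr1 => E.
    have : 0 <= i%:R :> rat by [].
    have : 0 <= k%:R :> rat by [].
    have : 0 <= a%:R :> rat by [].
    lra.
  rewrite subr0 qa /PL (@nsum_single _ a) => [|i Hi]; last first.
    rewrite /idF; case: eqP => [E|_]; last by rewrite (fld0 _ Ha) scaler0.
    case/negP: Hi; rewrite -(eqr_nat rat); apply/eqP.
    by move: E; rewrite -natr1; lra.
  rewrite /idF ifT; last by apply/eqP; rewrite -natr1; ring.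
  rewrite n1 !bneg !mulrA !sgn2 !mul1r.
  have -> : m + - k.+1%:R - a%:R = - a.+1%:R - k%:R + m by rewrite -!natr1; ring.
  congr (_%:R *: _); rewrite addnC -[in RHS](@bin_sub (a + k)) ?leq_addl //.
  by rewrite addnK.
Qed.

(** The Leibniz rule for [dd k] on products: both expansions are determined by
    their recursion in the exponent of x - z. *)
Section Leibniz.
Variables (E : int -> rat -> rat -> M) (Y : nat -> int -> rat -> rat -> M).
Hypothesis Erec : forall n m q, E (n + 1) m q = E n (m + 1) q - E n m (q + 1).
Hypothesis Yrec : forall j n m q, Y j (n + 1) m q = Y j n (m + 1) q - Y j n m (q + 1).

Let X k n m q : M := ((-1) ^+ k * binr F q k) *: E n m (q - k%:R).
Let Z k n m q : M := \sum_(i < k.+1) ((-1) ^+ i * binr F n%:~R i) *: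
   Y (k - i)%N (n - i%:Z) m q.

(** The two sides of the Leibniz rule differ by a family obeying the recursion of x - z, up to
    the difference of order k - 1. *)
Lemma leibniz_rec k n m q : Tint q ->
  X k (n + 1) m q - Z k (n + 1) m q =
  (X k n (m + 1) q - Z k n (m + 1) q) - (X k n m (q + 1) - Z k n m (q + 1)) -
  (if k is k'.+1 then X k' n m q - Z k' n m q else 0).
Proof.
move=> Hq.
have HX : X k (n + 1) m q = X k n (m + 1) q - X k n m (q + 1) -
     (if k is k'.+1 then X k' n m q else 0).
  rewrite /X Erec scalerBr; case: k => [|k]; first by rewrite !binr0 !subr0.
  rewrite binrS // -[RHS]addrA; congr (_ + _); rewrite -opprD; congr (- _).
  have -> : q + 1 - k.+1%:R = q - k%:R by rewrite -natr1; ring.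
  have -> : q - k.+1%:R + 1 = q - k%:R by rewrite -natr1; ring.
  rewrite -scalerDl; congr (_ *: _); rewrite exprS; ring.
have HZ : Z k (n + 1) m q = Z k n (m + 1) q - Z k n m (q + 1) -
     (if k is k'.+1 then Z k' n m q else 0).
  rewrite /Z -sumrB rmorphD /=.
  have HY i j : Y j (n + 1 - i%:Z) m q = Y j (n - i%:Z) (m + 1) q - Y j (n - i%:Z) m (q + 1).
    by rewrite -Yrec addrAC.
  case: k {HX} => [|k].
    by rewrite !big_ord1 !binr0 HY scalerBr [RHS]subr0.
  rewrite [LHS]big_ord_recl [X in _ = X - _]big_ord_recl /= !binr0 HY scalerBr -!addrA.
  congr (_ + (_ + _)).
  rewrite -sumrB; apply: eq_bigr => i _; rewrite /bump /= !add1n binrS ?Tint_intr //.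
  rewrite mulrDr scalerDl HY -scalerBr; congr (_ + _).
  rewrite subSS exprS mulN1r mulNr scaleNr; congr (- (_ *: _)).
  by rewrite -Yrec; congr (Y _ _ _ _); rewrite intS; ring.
rewrite HX HZ {HX HZ}; case: k => [|k]; first by rewrite !subr0; exact: subr4.
by rewrite subr4 [X in X - _ = _]subr4.
Qed.

End Leibniz.

Let DB (B : rat -> rat -> M) k s t := ((-1) ^+ k * binr F t k) *: B s (t - k%:R).

Lemma leibniz_L (B : rat -> rat -> M) q0 k n m q : trunc B q0 -> Tint q ->
  ((-1) ^+ k * binr F q k) *: PL n B m (q - k%:R) =
  \sum_(i < k.+1) ((-1) ^+ i * binr F n%:~R i) *: PL (n - i%:Z) (DB B (k - i)) m q.
Proof.
move=> HB Hq.
have HD j : trunc (DB B j) (q0 + j%:R).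
  by move=> s t Ht; rewrite /DB HB ?scaler0 //; lra.
have Er := fun n m q => PL_rec n m q HB.
have Yr j := fun n m q => PL_rec n m q (HD j).
pose h k n m q := ((-1) ^+ k * binr F q k) *: PL n B m (q - k%:R) -
  \sum_(i < k.+1) ((-1) ^+ i * binr F n%:~R i) *: PL (n - i%:Z) (DB B (k - i)) m q.
have Hdq r : congZ r q -> Tint r.
  by move=> H; rewrite -[r](subrK q) TintD // Tint_int.
suff H : forall n' m' q', congZ m' m -> congZ q' q -> h k n' m' q' = 0.
  by apply/eqP; rewrite -subr_eq0; apply/eqP; apply: H; apply: congZ_refl.
elim: k => [|k IH]; apply: uniq_L => [n' m' q' Hm Hd|n'|m' q' Hm Hd].
- by apply: etrans (@leibniz_rec (fun n m q => PL n B m q) (fun j n m q => PL n (DB B j) m q) Er Yr 0 n' m' q' (Hdq _ Hd)) _; rewrite [LHS]subr0.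
- exists q0 => m' q' _ _ Hq'; rewrite /h big_ord1 subr0 (PL_trunc _ HB) // scaler0 sub0r.
  by rewrite (PL_trunc _ (HD _)) ?scaler0 ?oppr0 // addr0.
- by rewrite /h big_ord1 !binr0 PL0 PL0 /DB binr0 mulr1 !expr0 !scale1r subrr.
- apply: etrans (@leibniz_rec (fun n m q => PL n B m q) (fun j n m q => PL n (DB B j) m q) Er Yr k.+1 n' m' q' (Hdq _ Hd)) _.
  by rewrite -/(h k n' m' q') IH // [LHS]subr0.
- exists (q0 + k.+1%:R) => m' q' _ _ Hq'; rewrite /h (PL_trunc _ HB) ?scaler0 ?sub0r; last by lra.
  rewrite big1 ?oppr0 // => i _; rewrite (PL_trunc _ (HD _)) ?scaler0 //.
  have : (k.+1 - i)%:R <= k.+1%:R :> rat by rewrite ler_nat leq_subr.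
  lra.
- rewrite /h big_ord_recl !binr0 PL0 big1 ?addr0 => [|i _]; last first.
    by rewrite lift0 (binr_0 charF T_gt0 cop) mulr0 scale0r.
  by rewrite expr0 mulr1 scale1r PL0 /DB subrr.
Qed.

Lemma leibniz_R (B : rat -> rat -> M) s0 k n m q : truncR B s0 -> Tint q ->
  ((-1) ^+ k * binr F q k) *: PR n B m (q - k%:R) =
  \sum_(i < k.+1) ((-1) ^+ i * binr F n%:~R i) *: PR (n - i%:Z) (DB B (k - i)) m q.
Proof.
move=> HB Hq.
have HD j : truncR (DB B j) s0 by move=> s t Hs; rewrite /DB HB ?scaler0.
have Er := fun n m q => PR_rec n m q HB.
have Yr j := fun n m q => PR_rec n m q (HD j).
pose h k n m q := ((-1) ^+ k * binr F q k) *: PR n B m (q - k%:R) -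
  \sum_(i < k.+1) ((-1) ^+ i * binr F n%:~R i) *: PR (n - i%:Z) (DB B (k - i)) m q.
have Hdq r : congZ r q -> Tint r.
  by move=> H; rewrite -[r](subrK q) TintD // Tint_int.
have tr k' n' : exists m0, forall m' q', congZ m' m -> congZ q' q -> m0 <= m' -> h k' n' m' q' = 0.
  exists s0 => m' q' _ _ Hm'; rewrite /h (PR_trunc _ HB) // ?scaler0 ?sub0r.
  by rewrite big1 ?oppr0 // => i _; rewrite (PR_trunc _ (HD _)) ?scaler0.
have PR0' j := fun m q => PR0 m q (HD j).
suff H : forall n' m' q', congZ m' m -> congZ q' q -> h k n' m' q' = 0.
  by apply/eqP; rewrite -subr_eq0; apply/eqP; apply: H; apply: congZ_refl.
elim: k => [|k IH]; apply: uniq_R => [n' m' q' Hm Hd|n'|m' q' Hm Hd]; try exact: tr.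
- by apply: etrans (@leibniz_rec (fun n m q => PR n B m q) (fun j n m q => PR n (DB B j) m q) Er Yr 0 n' m' q' (Hdq _ Hd)) _; rewrite [LHS]subr0.
- by rewrite /h big_ord1 !binr0 (PR0 _ _ HB) PR0' /DB binr0 mulr1 !expr0 !scale1r subrr.
- apply: etrans (@leibniz_rec (fun n m q => PR n B m q) (fun j n m q => PR n (DB B j) m q) Er Yr k.+1 n' m' q' (Hdq _ Hd)) _.
  by rewrite -/(h k n' m' q') IH // [LHS]subr0.
- rewrite /h big_ord_recl !binr0 (PR0 _ _ HB) big1 ?addr0 => [|i _]; last first.
    by rewrite lift0 (binr_0 charF T_gt0 cop) mulr0 scale0r.
  by rewrite expr0 mulr1 scale1r PR0' /DB subrr.
Qed.

Lemma dd_prodF eps al be m n k : isfld al -> isfld be ->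
  dd k (prodF eps al be m n) =
  \sum_(i < k.+1) ((-1) ^+ i * binr F n%:~R i) *:
     (prodF eps al (dd (k - i) be) m (n - i%:Z) : field_ M).
Proof.
move=> Ha Hb; apply: funext => q; apply: funext => w.
have sumE (I : Type) (r : seq I) (H : I -> field_ M) :
    (\sum_(i <- r) H i) q w = \sum_(i <- r) H i q w.
  by elim: r => [|i r IH]; rewrite ?big_nil // !big_cons -IH.
have scE (x : field_ M) e : (e *: x) q w = e *: x q w by [].
rewrite sumE; case: (boolP (Tint q)) => Hq; last first.
  rewrite (fld_T (isfld_dd _ (isfld_prodF _ _ _ Ha Hb))) // big1 // => i _.
  by rewrite scE (fld_T (isfld_prodF _ _ _ Ha (isfld_dd _ Hb))) // scaler0.
have [q0 H0] := trunc_comp w Ha Hb; have [s0 Hs0] := truncR_comp w Ha Hb.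
rewrite [LHS]/dd [in LHS]/prodF scalerBr [X in _ - X]scalerA [_ * eps]mulrC -[X in _ - X]scalerA.
rewrite (leibniz_L _ _ _ H0) //.
rewrite (leibniz_R _ _ _ Hs0) // scaler_sumr -sumrB; apply: eq_bigr => i _.
rewrite scE /prodF scalerBr !scalerA; congr (_ *: _ - _ *: _); last by rewrite mulrC.
  by congr (PL _ _ _ _); apply: funext => s; apply: funext => t; rewrite (linZ (fld_lin Ha _)).
Qed.

End Vacuum.

(** * Frobenius limits *)

(** The sequence f is eventually constant, with value y. *)
Definition evconst (Y : Type) (f : nat -> Y) y := exists K, forall k, (K <= k)%N -> f k = y.

Lemma evconst_uniq (Y : Type) (f : nat -> Y) x y : evconst f x -> evconst f y -> x = y.
Proof.
move=> [K HK] [L HL].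
by rewrite -(HK (maxn K L)) ?leq_maxl // (HL (maxn K L)) ?leq_maxr.
Qed.

Lemma evconst2 (Y Z U : Type) (h : Y -> Z -> U) f g y z :
  evconst f y -> evconst g z -> evconst (fun k => h (f k) (g k)) (h y z).
Proof.
move=> [K HK] [L HL]; exists (maxn K L) => k; rewrite geq_max => /andP[h1 h2].
by rewrite HK // HL.
Qed.

Lemma evconst_eq (Y : Type) (f g : nat -> Y) y : evconst f y ->
  (exists K, forall k, (K <= k)%N -> f k = g k) -> evconst g y.
Proof.
move=> [K HK] [L HL]; exists (maxn K L) => k; rewrite geq_max => /andP[h1 h2].
by rewrite -HL // HK.
Qed.
(** The eventual value of a sequence, and 0 if it has none. *)
Definition evlim (V : zmodType) (f : nat -> V) : V := xget 0 [set y | evconst f y]%classic.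

Lemma evlimE (V : zmodType) (f : nat -> V) y : evconst f y -> evlim f = y.
Proof. by move=> H; apply: xget_unique => // z Hz; apply: evconst_uniq Hz H. Qed.

Section Limits.
Variables (F : fieldType) (p T : nat).
Hypotheses (charF : p \in [pchar F]) (T_gt0 : (0 < T)%N) (cop : coprime T p).
Variable M : lmodType F.

Let p_pr : prime p := pcharf_prime charF.

(** Arbitrarily large powers of [p] that are congruent to 1 modulo [T] (see [Pk_mod]). *)
Definition Pk (k : nat) : nat := p ^ (totient T * k).

Lemma Pk_mod k : exists j, Pk k = (1 + j * T)%N.
Proof.
have : Pk k = 1 %[mod T].
  rewrite /Pk expnM -modnXm (Euler_exp_totient _) 1?coprime_sym //.
  by rewrite modnXm exp1n.
have Pk_gt0 : (0 < Pk k)%N by rewrite expn_gt0 prime_gt0.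
move=> /eqP; rewrite eqn_mod_dvd // => /dvdnP[j Hj]; exists j.
by rewrite -Hj subnKC.
Qed.

Lemma Pk_gt k : (k < Pk k)%N.
Proof.
rewrite /Pk expnM; have : (1 < p ^ totient T)%N.
  by rewrite -(exp1n (totient T)) ltn_exp2r ?prime_gt1 // totient_gt0.
by move=> H; apply: ltn_expl.
Qed.

Lemma Pk_cong k c : Tint T c -> congZ ((Pk k)%:R * c) c.
Proof.
move=> Hc; have [j ->] := Pk_mod k.
by rewrite /congZ natrD mulrDl mul1r addrC addKr natrM -mulrA [T%:R * c]mulrC rpredM ?natr_int.
Qed.

Lemma PkS k (r : nat) : exists j,
  (Pk k.+1)%:R * (r%:R / T%:R) = (Pk k)%:R * (r%:R / T%:R) + (Pk k * j)%:R :> rat.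
Proof.
have [j Hj] := Pk_mod 1; exists (j * r)%N.
have -> : Pk k.+1 = (Pk k * Pk 1)%N by rewrite /Pk muln1 mulnS expnD mulnC.
have T0 : T%:R != 0 :> rat by rewrite pnatr_eq0 -lt0n.
by rewrite Hj !(natrM, natrD); field.
Qed.

Variable h : rat -> int -> field_ M.
Hypothesis hrec : forall m n q w, h m (n + 1) q w = h (m + 1) n q w - h m n (q + 1) w.
Variable N : int.
Hypothesis hloc : forall m n, N <= n -> h m n = 0.

Lemma h_stable m k j n : N <= n + (Pk k)%:Z -> h (m + (Pk k * j)%:R) n = zsh (Pk k * j)%:R (h m n).
Proof.
move=> Hn; apply: funext => q; apply: funext => w.
have H1 m' n' q' : N <= n' -> h m' n' q' w = 0 by move=> H; rewrite hloc.
exact: (frob_stable charF (fun m n q => hrec m n q w) H1).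
Qed.

(** The sequence whose eventual value is the Frobenius limit of h along c + Z. *)
Definition hlim (c : rat) n k := zsh (- ((Pk k)%:R * c)) (h ((Pk k)%:R * c) n).

Lemma hlim_ev (r : nat) n : exists y, evconst (hlim (r%:R / T%:R) n) y.
Proof.
have [K HK] : exists K : nat, forall k, (K <= k)%N -> N <= n + (Pk k)%:Z.
  exists `|N - n|%N => k Hk; have := Pk_gt k; lia.
exists (hlim (r%:R / T%:R) n K); exists K => k Hk; rewrite -(subnK Hk).
elim: (k - K)%N => [//|d IH].
rewrite addSn -IH /hlim; have [j ->] := PkS (d + K) r.
have HN : N <= n + (Pk (d + K))%:Z by rewrite HK // leq_addl.
by rewrite (h_stable _ _ HN) zshA opprD addrNK.
Qed.

Lemma hlim_shift (c : rat) n (j : nat) y : evconst (hlim c n) y ->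
  evconst (hlim (c + j%:R) n) y.
Proof.
move=> H; apply: (evconst_eq H).
exists `|N - n|%N => k Hk; rewrite /hlim mulrDr -natrM h_stable ?zshA; last first.
  by have := Pk_gt k; lia.
by rewrite opprD addrNK.
Qed.

(** A family with the recursion of multiplication by x - z which is local is
    determined by its Frobenius limits. *)
Lemma hlim_inv (H : int -> field_ M) (N' : int) c :
  (forall n, N' <= n -> H n = 0) -> Tint T c ->
  (forall n, exists K, forall k, (K <= k)%N ->
     h ((Pk k)%:R * c) n = zsh ((Pk k)%:R * c) (H n)) ->
  forall m n q w, congZ m c ->
  h m n q w = nsum (fun i => binr F m i *: H (n + i%:Z) (q + m - i%:R) w).
Proof.
move=> HN Hc Hlim.
pose S m n q w := nsum (fun i => binr F m i *: H (n + i%:Z) (q + m - i%:R) w).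
have SE m n q w L : N' <= n + L%:Z ->
    S m n q w = \sum_(i < L) binr F m i *: H (n + i%:Z) (q + m - i%:R) w.
  by move=> HL; apply: nsumE => i Hi; rewrite HN ?scaler0 //; lia.
have Tm m : congZ m c -> Tint T m.
  by move=> Hm; rewrite -[m](subrK c) TintD // Tint_int.
have Srec m n q w : congZ m c -> S m (n + 1) q w = S (m + 1) n q w - S m n (q + 1) w.
  move=> Hm; pose L := `|N' - n|%N.
  rewrite !(SE _ _ _ _ L); try lia.
  rewrite (pascal_sum charF T_gt0 cop (G := fun i => H (n + i%:Z) (q + (m + 1) - i%:R) w)).
  - rewrite -sumrB; apply: eq_bigr => i _; rewrite -scalerBr; congr (_ *: _).
    have -> : q + (m + 1) - i%:R = q + 1 + m - i%:R by ring.
    rewrite [X in _ = X - _]addrC addrK -natr1.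
    have -> : q + (m + 1) - (i%:R + 1) = q + m - i%:R by ring.
    by rewrite intS addrA.
  - exact: Tm.
  - by move=> i Hi; rewrite HN //; lia.
(* The difference of the two sides obeys the same recursion and is shown to vanish by descending
   induction on n: if it does at n + 1, then at n it only depends on m + q. *)
pose d m n q w := h m n q w - S m n q w.
pose N2 := Num.max N N'.
suff D : forall t m n q w, (N2 - t%:Z <= n) -> congZ m c -> d m n q w = 0.
  move=> m n q w Hm; apply/eqP; rewrite -subr_eq0; apply/eqP.
  by apply: (D `|N2 - n|%N) => //; move: (N2); lia.
elim=> [|t IH] m n q w Hn Hm.
  move: Hn; rewrite subr0 ge_max => /andP[h1 h2].
  rewrite /d hloc // /S nsum0 ?subrr // => i.
  by rewrite HN ?scaler0 // ler_wpDr.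
have step m' q' : congZ m' c -> d (m' + 1) n q' w = d m' n (q' + 1) w.
  move=> Hm'; apply/eqP; rewrite -subr_eq0; apply/eqP.
  rewrite -(IH m' (n + 1) q' w) //; last by lia.
  by rewrite /d hrec Srec // subr4.
have many (j : nat) m' q' : congZ m' c -> d (m' + j%:R) n q' w = d m' n (q' + j%:R) w.
  move=> Hm'; elim: j q' => [|j IHj] q'; first by rewrite !addr0.
  rewrite -natr1 addrA step; last by apply: congZDi; rewrite ?natr_int.
  by rewrite IHj; congr (d _ _ _ _); ring.
have manyz (j : int) m' q' : congZ m' c -> d (m' + j%:~R) n q' w = d m' n (q' + j%:~R) w.
  case: j => j Hm'; first by rewrite -pmulrn many.
  rewrite NegzE intrN -pmulrn -[in RHS](subrK j.+1%:R m') many ?subrK //.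
  by apply: congZDi; rewrite ?rpredN ?natr_int.
(* So m can be taken to be P c with P a large power of p, where the sum reduces to its first
   term: the next binomial coefficients vanish, and H does so from the index n + P on. *)
have [K HK] := Hlim n.
pose k := maxn K `|N' - n|%N.
have /intrP[j Hj] : m - (Pk k)%:R * c \is a Num.int.
  by apply: (congZ_trans Hm); apply: congZ_sym; apply: Pk_cong.
have -> : m = (Pk k)%:R * c + j%:~R by rewrite -Hj addrC subrK.
rewrite manyz ?Pk_cong // /d HK ?leq_maxl // /S (@nsum_single _ _ _ 0%N) => [|i i0].
  by rewrite binr0 scale1r addr0 subr0 subrr.
case: (ltnP i (Pk k)) => Hi; first by rewrite (binr_small charF T_gt0 cop) ?scale0r // lt0n i0.
rewrite HN ?scaler0 //; have := Pk_gt k; have := leq_maxr K `|N' - n|%N.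
by rewrite -/k; lia.
Qed.

End Limits.

(** * Eigenspace projections *)

Section Eigenprojections.
Variables (F : fieldType) (U : lmodType F) (t : U -> U) (eta : F) (T : nat).
Hypotheses (t_lin : lin t) (t_iter : forall u, iter T t u = u).
Hypotheses (eta_prim : T.-primitive_root eta) (TF : T%:R != 0 :> F).

Let T_gt0 : (0 < T)%N := prim_order_gt0 eta_prim.

Lemma eta_neq0 : eta != 0.
Proof.
apply/eqP => E; have := prim_expr_order eta_prim.
by move/eqP; rewrite E expr0n gtn_eqF // eq_sym oner_eq0.
Qed.

Lemma eta_eq (i j : nat) : (i < T)%N -> (j < T)%N -> (eta ^+ i == eta ^+ j) = (i == j).
Proof. by move=> Hi Hj; rewrite (eq_prim_root_expr eta_prim) !modn_small. Qed.

Lemma root_sum (i j : nat) : (i < T)%N -> (j < T)%N ->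
  \sum_(k < T) (eta ^+ i / eta ^+ j) ^+ k = if i == j then T%:R else 0.
Proof.
move=> Hi Hj; have e0 := eta_neq0; case: (eqVneq i j) => [->|ij].
  rewrite divff ?expf_neq0 //; under eq_bigr do rewrite expr1n.
  by rewrite sumr_const card_ord.
set z := _ / _; have z1 : z != 1.
  by apply: contraNneq ij => /divr1_eq /eqP; rewrite eta_eq.
have zT : z ^+ T = 1.
  by rewrite expr_div_n -!exprM ![(_ * T)%N]mulnC !exprM (prim_expr_order eta_prim) !expr1n divr1.
by apply/eqP; have := subrX1 z T; rewrite zT subrr => /esym/eqP; rewrite mulf_eq0 subr_eq0 (negbTE z1).
Qed.

(** The projection onto the eigenspace of t for the eigenvalue eta ^ r. *)
Definition epr (r : nat) (u : U) : U :=
  T%:R^-1 *: \sum_(j < T) (eta ^+ r)^-1 ^+ j *: iter j t u.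

Lemma lin_iter j : lin (iter j t).
Proof. by elim: j => [|j IH] c x y //=; rewrite IH t_lin. Qed.

Lemma lin_epr r : lin (epr r).
Proof.
move=> c x y; rewrite /epr scalerA [c * _]mulrC -scalerA -scalerDr; congr (_ *: _).
rewrite scaler_sumr -big_split; apply: eq_bigr => j _ /=.
by rewrite lin_iter scalerDr !scalerA mulrC.
Qed.

Lemma epr_eigen r u : t (epr r u) = eta ^+ r *: epr r u.
Proof.
have e0 : eta ^+ r != 0 by rewrite expf_neq0 // eta_neq0.
rewrite /epr (linZ t_lin) (lin_sum t_lin) scalerA mulrC -scalerA; congr (_ *: _).
case: T T_gt0 t_iter (prim_expr_order eta_prim) => // T' _ tT eT.
rewrite big_ord_recr [in RHS]big_ord_recl /= scalerDr addrC scaler_sumr; congr (_ + _).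
  rewrite (linZ t_lin) -iterS tT scalerA expr0 mulr1; congr (_ *: _).
  have E : (eta ^+ r)^-1 ^+ T'.+1 = 1.
    by rewrite exprVn -exprM mulnC exprM eT expr1n invr1.
  by rewrite -[RHS]mul1r -E exprSr mulfVK.
apply: eq_bigr => j _; rewrite (linZ t_lin) -iterS /bump /= add1n exprS scalerA.
by rewrite mulrA divff // mul1r.
Qed.

Lemma epr_sum u : \sum_(r < T) epr r u = u.
Proof.
rewrite /epr -scaler_sumr exchange_big /=.
case: T T_gt0 TF eta_prim => // T' _ TF' ep.
rewrite big_ord_recl [X in _ + X]big1 ?addr0 => [|j _].
  under eq_bigr => i _ do rewrite /= expr0 scale1r.
  by rewrite sumr_const card_ord -scaler_nat scalerA mulVf // scale1r.
rewrite -scaler_suml.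
have -> : \sum_(i < T'.+1) (eta ^+ i)^-1 ^+ (lift ord0 j) = 0.
  have e0 := eta_neq0; set k := lift ord0 j.
  have z1 : (eta ^+ k)^-1 != 1.
    rewrite invr_eq1 -[1](expr0 eta) (eq_prim_root_expr ep) !modn_small //; apply: ltn_ord.
  have zT : (eta ^+ k)^-1 ^+ T'.+1 = 1.
    by rewrite exprVn -exprM mulnC exprM (prim_expr_order ep) expr1n invr1.
  under eq_bigr => i _ do rewrite exprVn -exprM mulnC exprM -exprVn.
  by apply/eqP; have := subrX1 (eta ^+ k)^-1 T'.+1; rewrite zT subrr => /esym/eqP; rewrite mulf_eq0 subr_eq0 (negbTE z1).
by rewrite scale0r.
Qed.

Lemma iter_eigen s u j : t u = eta ^+ s *: u -> iter j t u = (eta ^+ s) ^+ j *: u.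
Proof.
move=> H; elim: j => [|j IH] /=; first by rewrite scale1r.
by rewrite IH (linZ t_lin) H scalerA exprSr.
Qed.

Lemma epr_id r s u : (r < T)%N -> (s < T)%N -> t u = eta ^+ s *: u ->
  epr r u = if r == s then u else 0.
Proof.
move=> Hr Hs H; rewrite /epr.
under eq_bigr => j _ do rewrite (iter_eigen _ H) scalerA -exprMn mulrC.
rewrite -scaler_suml root_sum // eq_sym; case: eqP => _; last by rewrite scale0r scaler0.
by rewrite scalerA mulVf // scale1r.
Qed.

End Eigenprojections.

(** * Affine superalgebras *)

Lemma lin_bigsum (F : fieldType) (U V : lmodType F) (I : Type) (s : seq I) (f : I -> U -> V) :
  (forall i, lin (f i)) -> lin (fun x => \sum_(i <- s) f i x).
Proof.
move=> H c x y; rewrite scaler_sumr -big_split; apply: eq_bigr => i _ /=.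
by rewrite H.
Qed.

Section Loops.
Variables (F : fieldType) (g : vectType F) (K : choiceType).
Implicit Types (f h : loop g K) (a b : g).

Lemma loopZE c f k : (c *: f : loop g K)@_k = c *: f@_k.
Proof. exact: loop_scaleE. Qed.

Lemma loopDE f h k : (f + h : loop g K)@_k = f@_k + h@_k.
Proof. exact: mcoeffD. Qed.

Lemma lin_malgU k : lin (fun a => << a *g k >> : loop g K).
Proof.
move=> c a b; apply/malgP => j; rewrite mcoeffD loopZE !mcoeffU.
by case: eqP; rewrite ?mulr1n ?mulr0n ?scaler0 ?addr0.
Qed.

(** A sum of linear functions of the coefficients can be taken over any set containing the
    support. *)
Lemma suppsum_wide (V : lmodType F) (G : K -> g -> V) f (d : {fset K}) :
  (forall k, lin (G k)) -> (msupp f `<=` d)%fset ->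
  \sum_(k <- msupp f) G k f@_k = \sum_(k <- d) G k f@_k.
Proof.
move=> HG Hd; apply: big_fset_incl => // k _ Hk.
by rewrite mcoeff_outdom // (lin0 (HG k)).
Qed.

Lemma lin_suppsum (V : lmodType F) (G : K -> g -> V) :
  (forall k, lin (G k)) -> lin (fun f => \sum_(k <- msupp f) G k f@_k).
Proof.
move=> HG c f h.
pose d := (msupp f `|` msupp h `|` msupp (c *: f + h : loop g K))%fset.
rewrite !(@suppsum_wide _ _ _ d) //.
- rewrite scaler_sumr -big_split; apply: eq_bigr => k _ /=.
  by rewrite loopDE loopZE HG.
all: by apply/fsubsetP => k; rewrite /d !in_fsetU => ->; rewrite ?orbT.
Qed.

Lemma suppsum_U (V : lmodType F) (G : K -> g -> V) a n : (forall k, lin (G k)) ->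
  \sum_(k <- msupp (<< a *g n >> : loop g K)) G k (<< a *g n >> : loop g K)@_k = G n a.
Proof.
move=> HG; rewrite (@suppsum_wide _ _ _ [fset n]%fset) ?msuppU_le //.
by rewrite big_seq_fset1 mcoeffUU.
Qed.

End Loops.

Section AffineAlgebra.
Variables (F : fieldType) (g : vectType F) (gpar : bool -> {vspace g}).
Variables (br : g -> g -> g) (form : g -> g -> F).
Hypotheses (g_lie : is_lie_superalgebra gpar br).
Hypothesis form_g : is_invariant_form gpar br form.
Implicit Types a b : g.

Lemma br_linl b : lin (br^~ b).
Proof. by move=> c x y; rewrite (lie_linearl g_lie). Qed.

Lemma br_linr a : lin (br a).
Proof. by move=> c x y; rewrite (lie_linearr g_lie). Qed.

Lemma form_linl b : lin (fun a => form a b : F^o).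
Proof. by move=> c x y; rewrite (form_linear form_g). Qed.

Lemma form_linr a : lin (fun b => form a b : F^o).
Proof. by move=> c x y; rewrite !(form_sym form_g a) (form_linear form_g). Qed.

Lemma gpar_cap i : (gpar i :&: gpar (~~ i) = 0)%VS.
Proof. by case: i => /=; rewrite ?(lie_direct g_lie) // capvC (lie_direct g_lie). Qed.

Lemma gpar_sum i : (gpar i + gpar (~~ i))%VS = fullv.
Proof. by case: i => /=; rewrite ?(lie_sum g_lie) // addvC (lie_sum g_lie). Qed.

Lemma par_part_lin i : lin (par_part gpar i).
Proof. by move=> c x y; rewrite /par_part linearP. Qed.

Lemma par_part_in i a : par_part gpar i a \in gpar i.
Proof. exact: memv_pi. Qed.

Lemma par_part_id i a : a \in gpar i -> par_part gpar i a = a.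
Proof. by move=> H; rewrite /par_part daddv_pi_id ?gpar_cap. Qed.

Lemma par_part_sum a : par_part gpar false a + par_part gpar true a = a.
Proof.
rewrite /par_part /= daddv_pi_add ?(gpar_cap false) //.
by rewrite (gpar_sum false) memvf.
Qed.

Lemma par_part0 i a : a \in gpar i -> par_part gpar (~~ i) a = 0.
Proof.
move=> H; have := par_part_sum a; case: i H => /= H; rewrite (par_part_id H).
  by move/(canRL (addrK _)); rewrite subrr.
by move/(canRL (addKr _)); rewrite addNr.
Qed.

Section Bracket.
Variables (K : nzRingType) (iota : K -> F).

Let G1 m a n b : loop g K := << br a b *g m + n >>.
Let G2 m a n b : F^o :=
   ((if m + n == 0
        then iota m * form (par_part gpar false a) (par_part gpar false b)
        else 0) +
       (if m + n + 1 == 0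
        then form (par_part gpar true a) (par_part gpar true b)
        else 0)).

Let G1l m n b : lin (fun a => G1 m a n b).
Proof. by move=> c x y; rewrite /G1 br_linl lin_malgU. Qed.

Let G1r m a n : lin (G1 m a n).
Proof. by move=> c x y; rewrite /G1 br_linr lin_malgU. Qed.

Let G2l m n b : lin (fun a => G2 m a n b).
Proof.
move=> c x y; rewrite /G2 !par_part_lin !(form_linear form_g).
rewrite -[c *: _]/(c * _); case: ifP => _; case: ifP => _; ring.
Qed.

Let G2r m a n : lin (G2 m a n).
Proof.
move=> c x y; rewrite /G2 !par_part_lin !(form_sym form_g _ (_ + _)) !(form_linear form_g).
rewrite !(form_sym form_g _ (par_part _ _ a)).
rewrite -[c *: _]/(c * _); case: ifP => _; case: ifP => _; ring.
Qed.

Lemma affine_br_linl y : lin (fun x => affine_br gpar br form iota x y).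
Proof.
move=> c x x'; congr (_, _).
- by apply: (lin_suppsum (G := fun m a => \sum_(n <- msupp y.1) G1 m a n y.1@_n)) => m; apply: lin_bigsum.
- by apply: (lin_suppsum (G := fun m a => \sum_(n <- msupp y.1) G2 m a n y.1@_n)) => m; apply: lin_bigsum.
Qed.

Lemma affine_br_linr x : lin (affine_br gpar br form iota x).
Proof.
move=> c y y'; congr (_, _).
- have H : lin (fun f : loop g K => \sum_(m <- msupp x.1) \sum_(n <- msupp f) G1 m x.1@_m n f@_n).
    by apply: lin_bigsum => m; apply: lin_suppsum.
  exact: (H c y.1 y'.1).
- have H : lin (fun f : loop g K => \sum_(m <- msupp x.1) \sum_(n <- msupp f) G2 m x.1@_m n f@_n).
    by apply: lin_bigsum => m; apply: lin_suppsum.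
  exact: (H c y.1 y'.1).
Qed.

Lemma affine_br_tens a b (m n : K) : affine_br gpar br form iota (tens a m) (tens b n) =
  (<< br a b *g m + n >>, G2 m a n b).
Proof.
congr (_, _).
- have H k : lin (fun a => \sum_(n' <- msupp (<< b *g n >> : loop g K)) G1 k a n' (<< b *g n >> : loop g K)@_n').
    by apply: lin_bigsum.
  apply: etrans (suppsum_U a m H) _.
  exact: (suppsum_U b n (G1r m a)).
- have H k : lin (fun a => \sum_(n' <- msupp (<< b *g n >> : loop g K)) G2 k a n' (<< b *g n >> : loop g K)@_n').
    by apply: lin_bigsum.
  apply: etrans (suppsum_U a m H) _.
  exact: (suppsum_U b n (G2r m a)).
Qed.

Lemma affine_br_kkl y : affine_br gpar br form iota kk y = 0.
Proof. by rewrite /affine_br /kk /= msupp0 !big_seq_fset0. Qed.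

Lemma affine_br_kkr x : affine_br gpar br form iota x kk = 0.
Proof.
by rewrite /affine_br /kk /= msupp0; congr (_, _); apply: big1 => i _; rewrite big_seq_fset0.
Qed.

(** The coefficients of the central terms in the bracket of two homogeneous
    elements: [cen0] between odd elements, [cen1] between even ones. *)
Definition cen0 (i j : bool) a b : F := if i && j then form a b else 0.
Definition cen1 (i j : bool) a b : F := if ~~ i && ~~ j then form a b else 0.

Lemma affine_br_tens_hom i j a b (m n : K) : a \in gpar i -> b \in gpar j ->
  affine_br gpar br form iota (tens a m) (tens b n) =
  (if m + n == 0 then iota m * cen1 i j a b else 0 : F^o) *: kk +
  ((if m + n + 1 == 0 then cen0 i j a b else 0 : F^o) *: kk + tens (br a b) (m + n)).
Proof.
move=> Ha Hb; rewrite affine_br_tens /G2 /cen0 /cen1.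
have form0 : form 0 0 = 0 by exact: (lin0 (form_linl 0)).
have form0l x : form 0 x = 0 by exact: (lin0 (form_linl x)).
have form0r x : form x 0 = 0 by exact: (lin0 (form_linr x)).
congr (_, _); first by rewrite /= !scaler0 !add0r.
rewrite /= addr0 -![_ *: (1 : F^o)]/(_ * 1) !mulr1.
by case: i Ha => Ha; case: j Hb => Hb /=;
  rewrite ?(par_part_id Ha) ?(par_part_id Hb) ?(par_part0 Ha) ?(par_part0 Hb) ?form0l ?form0r ?mulr0.
Qed.

End Bracket.

End AffineAlgebra.

(** * The universal property of the induced module *)

(** A subspace [Wp] of U with an action of the affine superalgebra at level l, and a vector w0
    of it killed by g (x) F[t], receive a unique map from the induced module; only existence is
    needed. The relations of the action are assumed on [Wp] only. *)
Section Universal.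
Variables (F : fieldType) (g : vectType F) (gpar : bool -> {vspace g}).
Variables (br : g -> g -> g) (form : g -> g -> F) (l : F).
Local Notation L := (affine g int).
Local Notation Vaff := (Vaff gpar br form l).
Local Notation A := (free_algebra g).
Local Notation rel := (@induced_rel F g gpar br form l).

Variables (U : lmodType F) (Wp : U -> Prop) (act : L -> U -> U) (w0 : U).
Hypothesis Wp_comb : forall c u v, Wp u -> Wp v -> Wp (c *: u + v).
Hypothesis act_W : forall x u, Wp u -> Wp (act x u).
Hypothesis act_linl : forall c x y u, Wp u -> act (c *: x + y) u = c *: act x u + act y u.
Hypothesis act_linr : forall x c u v, Wp u -> Wp v ->
  act x (c *: u + v) = c *: act x u + act x v.
Hypothesis act_br : forall i j x y u, affine_par gpar i x -> affine_par gpar j y ->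
  Wp u -> act (affine_br gpar br form intr x y) u =
  act x (act y u) - (-1) ^+ (i && j) *: act y (act x u).
Hypothesis W0 : Wp w0.
Hypothesis act_w0 : forall x, nonneg_part x -> act x w0 = (l * x.2) *: w0.

Let Wp0 : Wp 0.
Proof. by rewrite -[0](subrr w0) addrC -scaleN1r; apply: Wp_comb. Qed.

Let Wp_sum (I : Type) (s : seq I) (c : I -> F) (f : I -> U) :
  (forall i, Wp (f i)) -> Wp (\sum_(i <- s) c i *: f i).
Proof.
by move=> H; elim: s => [|i s IH]; rewrite ?big_nil // big_cons; apply: Wp_comb.
Qed.

(** The action of a monomial of the free algebra. *)
Definition mact (m : {fmonom L}) (u : U) : U := foldr act u m.

Lemma mact_W m u : Wp u -> Wp (mact m u).
Proof. by rewrite /mact => Wu; elim: (m : seq _) => //= x s IH; apply: act_W. Qed.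

Lemma mact_lin m c u v : Wp u -> Wp v -> mact m (c *: u + v) = c *: mact m u + mact m v.
Proof.
move=> Wu Wv; rewrite /mact; elim: (m : seq _) => //= x s ->; apply: act_linr.
- exact: (@mact_W (FMonom s)).
- exact: (@mact_W (FMonom s)).
Qed.

Lemma mact0 m : mact m 0 = 0.
Proof. by have := mact_lin m (-1) Wp0 Wp0; rewrite scaler0 addr0 scaleN1r addNr. Qed.

Lemma mact_sum m (I : Type) (s : seq I) (c : I -> F) (f : I -> U) :
  (forall i, Wp (f i)) ->
  mact m (\sum_(i <- s) c i *: f i) = \sum_(i <- s) c i *: mact m (f i).
Proof.
move=> H; elim: s => [|i s IH]; first by rewrite !big_nil mact0.
by rewrite !big_cons mact_lin ?IH //; apply: Wp_sum.
Qed.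

(** The action of the free algebra. *)
Definition fact (f : A) (u : U) : U := \sum_(m <- msupp f) f@_m *: mact m u.

Lemma factE (d : {fset {fmonom L}}) f u : (msupp f `<=` d)%fset ->
  fact f u = \sum_(m <- d) f@_m *: mact m u.
Proof.
move=> Hd; apply: big_fset_incl => // m _ Hm.
by rewrite mcoeff_outdom // scale0r.
Qed.

Lemma fact_W f u : Wp u -> Wp (fact f u).
Proof. by move=> Wu; apply: Wp_sum => m; apply: mact_W. Qed.

Lemma fact_comb c f h u : fact (c *: f + h) u = c *: fact f u + fact h u.
Proof.
pose d := (msupp f `|` msupp h `|` msupp (c *: f + h : A))%fset.
rewrite !(@factE d); last first.
all: try by apply/fsubsetP => k; rewrite /d !in_fsetU => ->; rewrite ?orbT.
rewrite scaler_sumr -big_split; apply: eq_bigr => k _ /=.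
by rewrite mcoeffD mcoeffZ scalerDl scalerA.
Qed.

Lemma factU c m u : fact (<< c *g m >> : A) u = c *: mact m u.
Proof.
by rewrite (@factE [fset m]%fset) ?msuppU_le // big_seq_fset1 mcoeffUU.
Qed.

Lemma fact0 u : fact 0 u = 0.
Proof. by rewrite /fact msupp0 big_seq_fset0. Qed.

Lemma factD f h u : fact (f + h) u = fact f u + fact h u.
Proof. by rewrite -[f in LHS]scale1r fact_comb scale1r. Qed.

Lemma factZ c f u : fact (c *: f) u = c *: fact f u.
Proof. by rewrite -[_ *: f]addr0 fact_comb fact0 addr0. Qed.

Lemma factN f u : fact (- f) u = - fact f u.
Proof.
by have /eqP := factD f (- f) u; rewrite subrr fact0 eq_sym addrC addr_eq0 => /eqP.
Qed.

Lemma fact_sum (I : Type) (s : seq I) (f : I -> A) u :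
  fact (\sum_(i <- s) f i) u = \sum_(i <- s) fact (f i) u.
Proof. by elim: s => [|i s IH]; rewrite ?big_nil ?fact0 // !big_cons factD IH. Qed.

Lemma factM f h u : Wp u -> fact (f * h) u = fact f (fact h u).
Proof.
move=> Wu; rewrite malgME fact_sum {2}/fact; apply: eq_bigr => m _.
rewrite fact_sum {2}/fact mact_sum; last by move=> ?; apply: mact_W.
rewrite scaler_sumr; apply: eq_bigr => m' _.
by rewrite factU scalerA /mact fmM foldr_cat.
Qed.

Lemma fact_gen x u : fact (gen x) u = act x u.
Proof. by rewrite /gen factU scale1r /mact fmU. Qed.

Lemma fact1 u : fact 1 u = u.
Proof.
have -> : (1 : A) = << 1 *g (mone : {fmonom L}) >> by [].
by rewrite factU scale1r /mact fm1.
Qed.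

Lemma fact_bracket c x y z u : Wp u ->
  fact (gen x * gen y - c *: (gen y * gen x) - gen z) u =
  act x (act y u) - c *: act y (act x u) - act z u.
Proof.
move=> Wu; have E a b : fact (gen a * gen b) u = act a (act b u).
  by apply: etrans (factM (gen a) (gen b) Wu) _; rewrite (fact_gen b) (fact_gen a).
apply: etrans (factD _ _ u) _; congr (_ + _); last first.
  by apply: etrans (factN _ u) _; rewrite (fact_gen z).
apply: etrans (factD _ _ u) _; congr (_ + _); first exact: E.
by apply: etrans (factN _ u) _; congr (- _); apply: etrans (factZ c _ u) _; congr (_ *: _); exact: E.
Qed.

Lemma fact_rel f : lspan rel f -> fact f w0 = 0.
Proof.
elim=> [|c v w Hv _ IH]; first exact: fact0.
rewrite fact_comb IH addr0; apply/eqP; rewrite scaler_eq0; apply/orP; right; apply/eqP.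
case: Hv => [a b d x y|a b i j x y Hx Hy|a x Hx].
- have Wb := fact_W b W0.
  rewrite (factM _ _ W0) (factM _ _ Wb) factD factN fact_comb !fact_gen act_linl // subrr.
  by rewrite [LHS]big1 // => m _; rewrite mact0 scaler0.
- have Wb := fact_W b W0.
  rewrite (factM _ _ W0) (factM _ _ Wb) fact_bracket // (act_br Hx Hy) // subrr.
  by rewrite [LHS]big1 // => m _; rewrite mact0 scaler0.
- rewrite factD factN factZ factM // fact_gen act_w0 //.
  rewrite /fact; apply/eqP; rewrite subr_eq0; apply/eqP.
  rewrite scaler_sumr; apply: eq_bigr => m _.
  have := mact_lin m (l * x.2) W0 Wp0; rewrite !addr0 mact0 addr0 => ->.
  by rewrite !scalerA mulrC.
Qed.

(** The map from the induced module: apply a representative to w0. *)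
Definition uphi (v : Vaff) : U := fact (lquot_repr v) w0.

Lemma uphi_pi f : uphi (lquot_pi rel f) = fact f w0.
Proof.
have /lquot_eqP/fact_rel : lquot_pi rel (lquot_repr (lquot_pi rel f)) = lquot_pi rel f.
  by rewrite lquot_reprK.
by rewrite factD factN => /eqP; rewrite subr_eq0 => /eqP.
Qed.

Lemma uphi_lin : lin uphi.
Proof.
move=> c v w; rewrite -[v]lquot_reprK -[w]lquot_reprK.
rewrite -[c *: _]/(lquot_scale c _) lquot_piZ -lquot_piD !uphi_pi.
exact: fact_comb.
Qed.

Lemma uphi_W v : Wp (uphi v).
Proof. exact: fact_W. Qed.

Lemma uphi_vac : uphi (Vvac gpar br form l) = w0.
Proof. by rewrite /Vvac uphi_pi fact1. Qed.

Lemma uphi_act x v : uphi (Vact x v) = act x (uphi v).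
Proof. by rewrite /Vact uphi_pi factM // fact_gen. Qed.

End Universal.

(** * The twisted fields on the module *)

Lemma int_bound2 (x : int) (P : nat) : (absz x + 2 < P)%N ->
  0 <= x + P%:Z /\ 0 <= x - 1 + P%:Z.
Proof. lia. Qed.

Lemma int_eqm1 (x : int) : ((x + 1 == 0) = (x == -1)) * ((x == 0) = (x - 1 == -1)).
Proof. by split; apply/eqP/eqP => E; lia. Qed.

(** Sums over parity and degree with a single nonzero term. *)
Lemma sum_pick (V : zmodType) (m : nat) (f : bool -> 'I_m -> V) (i0 : bool) (r0 : 'I_m) x :
  (forall i r, f i r = if (i == i0) && (r == r0) then x else 0) ->
  \sum_(i : bool) \sum_(r < m) f i r = x.
Proof.
move=> H; rewrite (bigD1 i0) // (bigD1 r0) // H !eqxx /= !big1 ?addr0 // => [i /negbTE i1|r /negbTE r1].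
  by rewrite big1 // => r _; rewrite H i1.
by rewrite H r1 andbF.
Qed.

(** M is a locally truncated module of level l of the twisted affine superalgebra. *)
Section Module.
Variables (F : fieldType) (p : nat) (charF : p \in [pchar F]).
Variables (g : vectType F) (gpar : bool -> {vspace g}) (br : g -> g -> g).
Hypothesis g_lie : is_lie_superalgebra gpar br.
Hypothesis g_odd : forall u v, u \in gpar true -> v \in gpar true -> br u v = 0.
Variables (form : g -> g -> F) (form_g : is_invariant_form gpar br form).
Variables (tau : 'End(g)) (tau_aut : is_lie_automorphism gpar br tau).
Hypothesis tau_form : forall a b, form (tau a) (tau b) = form a b.
Variables (T : nat) (cop : coprime T p).
Hypothesis tau_iter : forall a, iter T tau a = a.
Variables (eta : F) (eta_prim : T.-primitive_root eta) (l : F).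
Variables (M : lmodType F) (rho : affine g rat -> M -> M).
Hypothesis rho_mod : is_affine_module gpar br form (ratr : rat -> F)
               (twisted_affine tau eta T) rho.
Hypothesis rho_level : has_level rho l.
Hypothesis rho_trunc : locally_truncated tau eta T rho.

Let T_gt0 : (0 < T)%N := prim_order_gt0 eta_prim.

Implicit Types (a b : g) (q m : rat) (n : int) (w : M) (r s : nat) (i j c : bool).
Local Notation eigen := (eigen tau eta).
Local Notation isfld := (isfld T).
Local Notation Fd := (field_ M).
Local Notation idF := (@idF F M).
Local Notation prodF := (@prodF F M).
Local Notation S := (twisted_affine tau eta T).

(** The field a_tau, for [a] of degree [r] modulo [T]; [r] need not be smaller than [T]. *)
Definition fldA r a : Fd := tau_field T rho r a.

Lemma eigen_mod r a : eigen r a -> eigen (r %% T) a.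
Proof. by rewrite /Defs.eigen (prim_expr_mod eta_prim). Qed.

Lemma div_mod r : (r%:R / T%:R : rat) = (r %% T)%:R / T%:R + (r %/ T)%:R.
Proof.
have T0 : T%:R != 0 :> rat by rewrite pnatr_eq0 -lt0n.
by rewrite {1}(divn_eq r T) natrD natrM mulrDl mulfK // addrC.
Qed.

Lemma S_tens r a q : eigen r a -> congZ q (r%:R / T%:R) -> S (tens a q).
Proof.
move=> Ha Hq q'; rewrite mcoeffU; case: (q =P q') => [<- _|_]; last by rewrite mulr0n eqxx.
exists (r %% T)%N; split; [by rewrite ltn_mod | | exact: eigen_mod].
have := Hq; rewrite /congZ div_mod opprD addrA => H.
by rewrite -[_ - _](subrK (r %/ T)%:R) rpredD ?natr_int.
Qed.

Lemma S_kk (e : F) x : S x -> S (e *: (kk : affine g rat) + x).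
Proof.
move=> H q; have -> : (e *: (kk : affine g rat) + x).1 = x.1 by rewrite /= scaler0 add0r.
exact: H.
Qed.

Lemma S_kk0 : S (kk : affine g rat).
Proof. by move=> q; rewrite mcoeff0 eqxx. Qed.

Lemma tens_lin (K : choiceType) (k : K) : lin (fun a : g => tens a k : affine g K).
Proof. by move=> e a b; congr (_, _); [exact: lin_malgU | rewrite /= scaler0 addr0]. Qed.

Lemma fldA_comb r e a b : eigen r a -> eigen r b ->
  fldA r (e *: a + b) = e *: fldA r a + fldA r b.
Proof.
move=> Ha Hb; apply: funext => q; apply: funext => w.
have -> : (e *: fldA r a + fldA r b) q w = e *: fldA r a q w + fldA r b q w by [].
rewrite /fldA /tau_field; case: ifP => Hq; last by rewrite scaler0 addr0.
by rewrite tens_lin (rho_linearl rho_mod) //; apply: S_tens Hq.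
Qed.

Lemma fldA_off r a q w : ~~ congZ q (r%:R / T%:R) -> fldA r a q w = 0.
Proof. by rewrite /fldA /tau_field /congZ => /negbTE ->. Qed.

Lemma fldA_on r a q w : congZ q (r%:R / T%:R) -> fldA r a q w = rho (tens a q) w.
Proof. by rewrite /fldA /tau_field /congZ => ->. Qed.

Lemma fldA_mod r a : fldA (r %% T) a = fldA r a.
Proof.
apply: funext => q; apply: funext => w; rewrite /fldA /tau_field (div_mod r) opprD addrA.
set x := q - _; have -> // : (x - (r %/ T)%:R \is a Num.int) = (x \is a Num.int).
by apply/idP/idP => H; [rewrite -[x](subrK (r %/ T)%:R) rpredD | rewrite rpredB];
  rewrite ?natr_int.
Qed.

Lemma isfld_fldA r a : eigen r a -> isfld (fldA r a).
Proof.
move=> Ha; split.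
- move=> q e x y; rewrite /fldA /tau_field; case: ifP => Hq; last by rewrite scaler0 addr0.
  by rewrite (rho_linearr rho_mod) //; apply: S_tens Hq.
- move=> w; have [N HN] := rho_trunc w (ltn_pmod r T_gt0).
  exists (N%:~R + (r %% T)%:R / T%:R) => q Hq; rewrite -fldA_mod.
  case: (boolP (congZ q ((r %% T)%:R / T%:R))) => Hc; last by rewrite fldA_off.
  rewrite fldA_on //; move: Hc => /intrP[k Hk].
  have -> : q = k%:~R + (r %% T)%:R / T%:R by rewrite -Hk subrK.
  apply: HN; last exact: eigen_mod.
  by rewrite -(ler_int rat) -Hk; lra.
- move=> q w Hq; apply: fldA_off; apply: contra Hq => Hq.
  by rewrite -[q](subrK (r%:R / T%:R)) TintD ?Tint_div // Tint_int.
Qed.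

(** The form pairs the degree r with the degree - r, as tau preserves it. *)
Lemma form_eigen r s a b : eigen r a -> eigen s b -> form a b != 0 -> (T %| r + s)%N.
Proof.
rewrite /Defs.eigen => Ha Hb H.
have := tau_form a b; rewrite Ha Hb.
have -> : form (eta ^+ r *: a) (eta ^+ s *: b) = eta ^+ (r + s) * form a b.
  rewrite exprD -mulrA; have := linZ (form_linl form_g (eta ^+ s *: b)) (eta ^+ r) a => ->.
  by have := linZ (form_linr form_g a) (eta ^+ s) b => ->.
move=> E; rewrite (prim_order_dvd eta_prim); apply/eqP.
by apply: (mulIf H); rewrite E mul1r.
Qed.

Lemma eigen_br r s a b : eigen r a -> eigen s b -> eigen (r + s) (br a b).
Proof.
rewrite /Defs.eigen => Ha Hb; rewrite (aut_br tau_aut) Ha Hb.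
rewrite exprD (linZ (br_linl g_lie _)) (linZ (br_linr g_lie _)).
by rewrite scalerA.
Qed.

(** The fields which give the brackets of the modes of two elements of [g],
    that is, the nonnegative products of these elements. *)
Definition brF i j r s a b (k : nat) : Fd :=
  match k with
  | 0%N => (l * cen0 form i j a b) *: idF + fldA (r + s) (br a b)
  | 1%N => (l * cen1 form i j a b) *: idF
  | _ => 0
  end.

Lemma isfld_brF i j r s a b k : eigen r a -> eigen s b -> isfld (brF i j r s a b k).
Proof.
move=> Ha Hb; have Hid := isfld_idF T M.
case: k => [|[|k]]; last exact: isfld0.
  by apply: isfld_comb => //; apply: isfld_fldA; exact: eigen_br.
by rewrite /brF -[_ *: _]addr0; apply: isfld_comb => //; exact: isfld0.
Qed.

(** The brackets of the twisted affine superalgebra, with the binomial coefficients of the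
    exponent m made explicit: 1 for the field [brF 0], and m for [brF 1]. *)
Lemma fldA_comm i j r s a b m q w : a \in gpar i -> b \in gpar j ->
  eigen r a -> eigen s b -> congZ m (r%:R / T%:R) ->
  fldA r a m (fldA s b q w) - (-1) ^+ (i && j) *: fldA s b q (fldA r a m w) =
  \sum_(k < 2) binr F m k *: brF i j r s a b k (m + q - k%:R) w.
Proof.
move=> Ha Hb Ea Eb Hm.
have TD : (r + s)%:R / T%:R = r%:R / T%:R + s%:R / T%:R :> rat by rewrite natrD mulrDl.
rewrite big_ord_recr big_ord1 /= binr0 binr1 scale1r subr0.
have -> : ((l * cen0 form i j a b) *: idF + fldA (r + s) (br a b)) (m + q) w =
   (l * cen0 form i j a b) *: idF (m + q) w + fldA (r + s) (br a b) (m + q) w by [].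
have -> : ((l * cen1 form i j a b) *: idF) (m + q - 1) w =
   (l * cen1 form i j a b) *: idF (m + q - 1) w by [].
case: (boolP (congZ q (s%:R / T%:R))) => Hq; last first.
  rewrite (fldA_off _ _ Hq) (fldA_off _ _ Hq) (fld0 _ (isfld_fldA Ea)) scaler0 subrr.
  have Hmq : ~~ congZ (m + q) ((r + s)%:R / T%:R).
    apply: contra Hq => H; rewrite TD in H.
    by have := congZD H (congZN Hm); rewrite [m + q]addrC !addrK [_ + s%:R / _]addrC addrK.
  rewrite (fldA_off _ _ Hmq) addr0.
  have nid (k : int) : form a b != 0 -> idF (m + q - k%:~R) w = 0.
    move=> /(form_eigen Ea Eb) /dvdnP[d Hd]; rewrite /idF; case: eqP => // E.
    case/negP: Hmq; rewrite Hd natrM mulfK ?pnatr_eq0 -?lt0n //.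
    rewrite /congZ -[m + q](subrK k%:~R) E.
    by rewrite !(rpredB, rpredD, rpredN) ?natr_int ?intr_int.
  rewrite /cen0 /cen1; have [f0|f0] := eqVneq (form a b) 0.
    by rewrite f0 !if_same !mulr0 !scale0r scaler0 addr0.
  by have := nid 0 f0; rewrite subr0 => ->; rewrite (nid 1 f0) !scaler0 addr0.
have Hmq : congZ (m + q) ((r + s)%:R / T%:R) by rewrite TD; apply: congZD.
rewrite !fldA_on //.
have := rho_br rho_mod w (S_tens Ea Hm) (S_tens Eb Hq).
have tp (k : bool) a' (q' : rat) : a' \in gpar k -> affine_par gpar k (tens a' q').
  move=> Ha'; split=> // x; rewrite mcoeffU; case: (q' =P x) => _; rewrite ?mulr1n //.
  by rewrite mulr0n mem0v.
move=> /(_ _ _ (tp _ _ _ Ha) (tp _ _ _ Hb)) <-.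
rewrite (affine_br_tens_hom g_lie form_g _ _ _ Ha Hb).
have St := S_tens (eigen_br Ea Eb) Hmq.
rewrite (rho_linearl rho_mod) ?(rho_linearl rho_mod) //; try exact: S_kk0; try exact: S_kk.
rewrite !rho_level /idF addrC -!addrA; congr (_ + _).
  have -> : (m + (q - 1) == -1) = (m + q == 0) by apply/eqP/eqP => E; lra.
  by case: ifP => _; rewrite ?scale0r ?scaler0 // !scalerA; congr (_ *: _); ring.
congr (_ + _); have -> : (m + (q + 1) == 0) = (m + q == -1) by apply/eqP/eqP => E; lra.
by case: ifP => _; rewrite ?scale0r ?scaler0 // !scalerA mulrC.
Qed.

(** ** The space of fields local to the a_tau *)

Local Notation W := (bool -> Fd).
Implicit Types (be ga : W).

(** The Koszul sign. *)
Definition ksg i j : F := (-1) ^+ (i && j).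

Lemma ksg2 i j : ksg i j * ksg i j = 1.
Proof. by rewrite /ksg; case: (i && j); rewrite ?expr0 ?expr1 ?mulr1 ?mulrNN ?mulr1. Qed.

Lemma ksg0r i : ksg i false = 1.
Proof. by rewrite /ksg andbF. Qed.

Lemma ksgC i j : ksg i j = ksg j i. Proof. by rewrite /ksg andbC. Qed.

Lemma ksgDl i j c : ksg i c * ksg j c = ksg (i (+) j) c.
Proof.
by rewrite /ksg; case: i; case: j; case: c; rewrite /= ?expr0 ?expr1 ?mulr1 ?mul1r ?mulrNN ?mulr1.
Qed.

Lemma ksgDr i j c : ksg c i * ksg c j = ksg c (i (+) j).
Proof. by rewrite !(ksgC c) ksgDl. Qed.

(** Pairs of fields, seen as formal sums of an even and of an odd field, which are local to the
    fields a_tau. The component of parity c is [be c]. *)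
Record inW be : Prop := InW {
  W_fld : forall c, isfld (be c);
  W_loc : forall i r a, a \in gpar i -> eigen r a ->
    exists N : int, forall n, N <= n -> forall m c,
      prodF (ksg i c) (fldA r a) (be c) m n = 0
}.

(** The products of a_tau, for [a] of parity [i], with a pair of fields. The component of
    parity c comes from the one of parity c + i. *)
Definition gop i r a m n be : W := fun c =>
  prodF (ksg i (c (+) i)) (fldA r a) (be (c (+) i)) m n.

Lemma prodF_off e (al al' : Fd) (c m : rat) n : isfld al' ->
  (forall q w, ~~ congZ q c -> al q w = 0) -> ~~ congZ m c -> prodF e al al' m n = 0 :> Fd.
Proof.
move=> Hal' H Hm; apply: funext => q; apply: funext => w.
have Hm' (z : rat) : z \is a Num.int -> ~~ congZ (m + z) c.
  move=> Hz; apply: contra Hm => Hm; rewrite -[m](addrK z); apply: congZDi => //.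
  by rewrite rpredN.
rewrite prodFE /PL /PR !nsum0 ?scaler0 ?subrr // => k.
  by rewrite (H (m + k%:R)) ?(fld0 _ Hal') ?scaler0 // Hm' ?natr_int.
by rewrite H ?scaler0 // -addrA Hm' // rpredB ?intr_int ?natr_int.
Qed.

Lemma prodF_zero e (al : Fd) m n : isfld al -> prodF e al 0 m n = 0 :> Fd.
Proof.
move=> Ha; have H0 := isfld0 T M.
by have := prodF_combr e (-1) m n Ha H0 H0; rewrite scaler0 addr0 scaleN1r addNr.
Qed.

Lemma prodF_scl e x (al be' : Fd) m n : isfld al -> isfld be' ->
  prodF e (x *: al) be' m n = x *: (prodF e al be' m n : Fd) :> Fd.
Proof.
move=> Ha Hb; have H0 := isfld0 T M.
have E0 : prodF e (0 : Fd) be' m n = 0 :> Fd.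
  by have := prodF_combl e (-1) m n H0 H0 Hb; rewrite scaler0 addr0 scaleN1r addNr.
by have := prodF_combl e x m n Ha H0 Hb; rewrite !addr0 E0 addr0.
Qed.

(** The bracket fields are local to every field of the space: they are combinations of the
    identity and of the field of [a, b]. *)
Lemma brF_loc i j r s a b be : a \in gpar i -> b \in gpar j -> eigen r a -> eigen s b ->
  inW be -> exists N : int, forall n, N <= n -> forall m c k,
    prodF (ksg i c * ksg j c) (brF i j r s a b k) (be c) m n = 0 :> Fd.
Proof.
move=> Ha Hb Ea Eb Wb.
have [N HN] := W_loc Wb (lie_graded g_lie Ha Hb) (eigen_br Ea Eb).
have Hid := isfld_idF T M.
exists (Num.max N 0) => n; rewrite ge_max => /andP[h1 h2] m c [|[|k]]; last first.
- have H0 := isfld0 T M.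
  by have := prodF_combl (ksg i c * ksg j c) (-1) m n H0 H0 (W_fld Wb c); rewrite scaler0 addr0 scaleN1r addNr.
- rewrite /brF prodF_scl ?W_fld //; last exact: W_fld Wb c.
  rewrite /cen1; case: i Ha HN => /=; rewrite ?mulr0 ?scale0r // => Ha HN.
  case: j Hb HN => /=; rewrite ?mulr0 ?scale0r // => Hb HN.
  by rewrite /ksg /= !expr0 mulr1 (prodF_idl_ge0 charF T_gt0 cop) ?scaler0 //; exact: W_fld Wb c.
- rewrite /brF (prodF_combl _ _ _ _ Hid (isfld_fldA (eigen_br Ea Eb)) (W_fld Wb c)).
  rewrite ksgDl HN // addr0 /cen0.
  case: i Ha HN => /=; rewrite ?mulr0 ?scale0r // => Ha HN.
  case: j Hb HN => /=; rewrite ?mulr0 ?scale0r // => Hb HN.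
  by rewrite /ksg /= !expr0 (prodF_idl_ge0 charF T_gt0 cop) ?scaler0 //; exact: W_fld Wb c.
Qed.

(** The commutator formula for the operators of two elements of [g]. *)
Lemma gop_comm i j r s a b m m' n n' be c : a \in gpar i -> b \in gpar j ->
  eigen r a -> eigen s b -> inW be -> congZ m' (r%:R / T%:R) ->
  gop i r a m' n' (gop j s b m n be) c =
  ksg i j *: gop j s b m n (gop i r a m' n' be) c +
  \sum_(k < 2) \sum_(k' < 2) (binr F m' k * binr F n'%:~R k') *:
    (prodF (ksg i (c (+) i (+) j) * ksg j (c (+) i (+) j)) (brF i j r s a b (k + k')%N)
       (be (c (+) i (+) j)) (m + m' - k%:R) (n + n' - k'%:Z) : Fd).
Proof.
move=> Ha Hb Ea Eb Wb Hm; rewrite /gop.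
have Fa := isfld_fldA Ea; have Fb := isfld_fldA Eb; set d := c (+) i (+) j.
have Ed : c (+) j (+) i = d by rewrite /d addbAC.
rewrite Ed.
have H0 k : (2 <= k)%N -> brF i j r s a b k = 0 by case: k => [|[|k]].
have HT := prodF_comm charF T_gt0 cop (ksg i d) (ksg j d) Fa Fb (W_fld Wb d)
  (fun k => isfld_brF i j k Ea Eb) H0 (ksg2 i j) (Tint_div T_gt0 r)
  (fun x y w => fldA_comm y w Ha Hb Ea Eb) n n' m Hm.
have e1 : ksg i (c (+) i) = ksg i j * ksg i d.
  by rewrite ksgDr /d; congr (ksg _ _); case: (c); case: (i); case: (j).
have e2 : ksg j (c (+) j) = ksg i j * ksg j d.
  by rewrite [ksg i j]ksgC ksgDr /d; congr (ksg _ _); case: (c); case: (i); case: (j).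
by rewrite e1 e2 HT.
Qed.

(** An analogue of Dong's lemma: products with a_tau preserve locality. *)
Lemma gop_W i r a m n be : a \in gpar i -> eigen r a -> inW be -> inW (gop i r a m n be).
Proof.
move=> Ha Ea Wb; split=> [c|j s b Hb Eb].
  by apply: isfld_prodF; [exact: isfld_fldA | exact: W_fld].
have [N1 HN1] := W_loc Wb Hb Eb.
have [N2 HN2] := brF_loc Hb Ha Eb Ea Wb.
exists (Num.max N1 (N2 + 2 - n)) => n'; rewrite ge_max => /andP[h1 h2] m' c.
have Wg c' : isfld (gop i r a m n be c').
  by apply: isfld_prodF; [exact: isfld_fldA | exact: W_fld].
case: (boolP (congZ m' (s%:R / T%:R))) => Hm; last first.
  by apply: (prodF_off _ _ (Wg c) _ Hm) => q w; apply: fldA_off.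
have := gop_comm m n n' (c (+) j) Hb Ha Eb Ea Wb Hm.
rewrite {1}/gop addbK => ->; rewrite {1}/gop [X in prodF _ _ X]/gop.
rewrite HN1 // prodF_zero; last exact: isfld_fldA.
rewrite scaler0 add0r big1 // => k _; rewrite big1 // => k' _.
by rewrite HN2 ?scaler0 //; have := ltn_ord k'; lia.
Qed.

(** ** The action of the affine superalgebra on fields *)

Let Pk := Pk p T.

Definition zshW (e : rat) be : W := fun c => zsh e (be c).

(** The sequence whose eventual value is the action of [a (x) t ^ n]. *)
Definition Fop k i r a n be : W :=
  zshW (- ((Pk k)%:R * (r%:R / T%:R))) (gop i r a ((Pk k)%:R * (r%:R / T%:R)) n be).

(** The action of [a (x) t ^ n], for [a] homogeneous of degree [r] modulo [T]. *)
Definition actA i r a n be : W := evlim (fun k => Fop k i r a n be).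

Lemma gop_rec i r a be c : eigen r a -> inW be -> forall m n q w,
  gop i r a m (n + 1) be c q w = gop i r a (m + 1) n be c q w - gop i r a m n be c (q + 1) w.
Proof.
by move=> Ea Wb m n q w; apply: (prodF_rec charF T_gt0 cop); [exact: isfld_fldA|exact: W_fld].
Qed.

Lemma gop_loc i r a be : a \in gpar i -> eigen r a -> inW be ->
  exists N : int, forall c m n, N <= n -> gop i r a m n be c = 0.
Proof.
move=> Ha Ea Wb; have [N HN] := W_loc Wb Ha Ea.
by exists N => c m n Hn; rewrite /gop HN.
Qed.

Lemma evconst_W (f : nat -> W) : (forall c, exists y, evconst (fun k => f k c) y) ->
  exists y, evconst f y.
Proof.
move=> H; have [y0 [K0 H0]] := H false; have [y1 [K1 H1]] := H true.
exists (fun c => if c then y1 else y0); exists (maxn K0 K1) => k.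
rewrite geq_max => /andP[h0 h1]; apply: funext => -[]; [exact: H1|exact: H0].
Qed.

Lemma Fop_ev i r a n be : a \in gpar i -> eigen r a -> inW be ->
  evconst (fun k => Fop k i r a n be) (actA i r a n be).
Proof.
move=> Ha Ea Wb; have [N HN] := gop_loc Ha Ea Wb.
have [y Hy] : exists y, evconst (fun k => Fop k i r a n be) y.
  by apply: evconst_W => c; exact: (hlim_ev charF T_gt0 cop (gop_rec i c Ea Wb) (HN c) r n).
by rewrite /actA (evlimE Hy).
Qed.

(** The action only depends on the degree modulo T. *)
Lemma actA_mod i r a n be : a \in gpar i -> eigen r a -> inW be ->
  actA i (r %% T) a n be = actA i r a n be.
Proof.
move=> Ha Ea Wb; have [N HN] := gop_loc Ha (eigen_mod Ea) Wb.
have H1 := Fop_ev n Ha (eigen_mod Ea) Wb.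
apply: evconst_uniq (Fop_ev n Ha Ea Wb).
have [K HK] : exists K, forall k, (K <= k)%N -> forall c,
    hlim p T (fun m n => gop i (r %% T) a m n be c) (r%:R / T%:R) n k = actA i (r %% T) a n be c.
  have H c : evconst (hlim p T (fun m n => gop i (r %% T) a m n be c) ((r %% T)%:R / T%:R + (r %/ T)%:R) n)
      (actA i (r %% T) a n be c).
    apply: (hlim_shift charF T_gt0 cop (h := fun m n => gop i (r %% T) a m n be c)
      (gop_rec i c (eigen_mod Ea) Wb) (HN c)).
    by have [K HK] := H1; exists K => k Hk; rewrite -(HK k Hk).
  rewrite -div_mod in H.
  have [K0 H0] := H false; have [K1 H2] := H true; exists (maxn K0 K1) => k.
  by rewrite geq_max => /andP[h0 h1] -[]; [exact: H2|exact: H0].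
exists K => k Hk; apply: funext => c; rewrite -(HK k Hk c) /Fop /zshW /hlim.
by rewrite /gop fldA_mod.
Qed.

Lemma actA_uniq i r a n be y : a \in gpar i -> eigen r a -> inW be ->
  evconst (fun k => Fop k i r a n be) y -> actA i r a n be = y.
Proof. by move=> Ha Ea Wb; apply: evconst_uniq; apply: Fop_ev. Qed.

Lemma prodF_lin_W e i r a be ga m n c d : eigen r a -> inW be -> inW ga ->
  prodF e (fldA r a) ((d *: be + ga) c) m n =
  d *: (prodF e (fldA r a) (be c) m n : Fd) + prodF e (fldA r a) (ga c) m n.
Proof.
move=> Ea Wb Wg; apply: prodF_combr => //; first [exact: isfld_fldA|exact: W_fld].
Qed.

Lemma inW_comb d be ga : inW be -> inW ga -> inW (d *: be + ga).
Proof.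
move=> Wb Wg; split=> [c|i r a Ha Ea].
  by apply: isfld_comb; exact: W_fld.
have [N1 H1] := W_loc Wb Ha Ea; have [N2 H2] := W_loc Wg Ha Ea.
exists (Num.max N1 N2) => n; rewrite ge_max => /andP[h1 h2] m c.
by rewrite prodF_lin_W // H1 // H2 // scaler0 addr0.
Qed.

Lemma actA_combr i r a n be ga d : a \in gpar i -> eigen r a -> inW be -> inW ga ->
  actA i r a n (d *: be + ga) = d *: actA i r a n be + actA i r a n ga.
Proof.
move=> Ha Ea Wb Wg; apply: actA_uniq => //; first exact: inW_comb.
apply: (evconst_eq (evconst2 (fun x y => d *: x + y) (Fop_ev n Ha Ea Wb) (Fop_ev n Ha Ea Wg))).
exists 0%N => k _; apply: funext => c; apply: funext => q.
rewrite /Fop /zshW /zsh; set q' := q + _; set m := _ * _.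
have -> : (d *: (fun c q => gop i r a m n be c (q + - m) : M -> M) + (fun c q => gop i r a m n ga c (q + - m)) : W) c q =
   (d *: (gop i r a m n be c : Fd) + gop i r a m n ga c) q' by [].
by rewrite /gop prodF_lin_W.
Qed.

Lemma eigen_comb r d a b : eigen r a -> eigen r b -> eigen r (d *: a + b).
Proof.
by rewrite /Defs.eigen => Ha Hb; rewrite linearP /= Ha Hb scalerDr !scalerA mulrC.
Qed.

Lemma actA_combl i r a b n be d : a \in gpar i -> eigen r a -> b \in gpar i ->
  eigen r b -> inW be ->
  actA i r (d *: a + b) n be = d *: actA i r a n be + actA i r b n be.
Proof.
move=> Ha Ea Hb Eb Wb; apply: actA_uniq => //; [by rewrite memvD ?memvZ | exact: eigen_comb|].
apply: (evconst_eq (evconst2 (fun x y => d *: x + y) (Fop_ev n Ha Ea Wb) (Fop_ev n Hb Eb Wb))).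
exists 0%N => k _; apply: funext => c; apply: funext => q.
rewrite /Fop /zshW /zsh; set q' := q + _; set m := _ * _.
have -> : (d *: (fun c q => gop i r a m n be c (q + - m) : M -> M) + (fun c q => gop i r b m n be c (q + - m)) : W) c q =
   (d *: (gop i r a m n be c : Fd) + gop i r b m n be c) q' by [].
rewrite /gop fldA_comb // (prodF_combl _ _ _ _ (isfld_fldA Ea) (isfld_fldA Eb)) //.
exact: W_fld.
Qed.

Lemma Fop_W k i r a n be : a \in gpar i -> eigen r a -> inW be -> inW (Fop k i r a n be).
Proof.
move=> Ha Ea Wb; have Wg m := gop_W m n Ha Ea Wb; split=> [c|j s b Hb Eb].
  apply: isfld_zsh; last exact: W_fld (Wg _) c.
  by apply: TintN; apply: TintMn; apply: Tint_div.
have [N HN] := W_loc (Wg ((Pk k)%:R * (r%:R / T%:R))) Hb Eb.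
by exists N => n' Hn' m c; rewrite /Fop /zshW prodF_zsh HN.
Qed.

Lemma actA_W i r a n be : a \in gpar i -> eigen r a -> inW be -> inW (actA i r a n be).
Proof.
by move=> Ha Ea Wb; have [K HK] := Fop_ev n Ha Ea Wb; rewrite -(HK K) //; exact: Fop_W.
Qed.

Lemma Fop_Fop k i j r s a b n n' be c :
  Fop k i r a n' (Fop k j s b n be) c =
  zsh (- ((Pk k)%:R * ((r + s)%:R / T%:R)))
    (gop i r a ((Pk k)%:R * (r%:R / T%:R)) n' (gop j s b ((Pk k)%:R * (s%:R / T%:R)) n be) c).
Proof.
rewrite /Fop {1}/zshW {1}/gop /zshW prodF_zsh zshA /gop.
by rewrite natrD mulrDl mulrDr opprD.
Qed.

(** The bracket relations of the affine superalgebra. *)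
Lemma actA_br i j r s a b n n' be : a \in gpar i -> b \in gpar j ->
  eigen r a -> eigen s b -> inW be ->
  actA i r a n' (actA j s b n be) = ksg i j *: actA j s b n (actA i r a n' be) +
  (actA (i (+) j) (r + s) (br a b) (n' + n) be +
   ((if n' + n + 1 == 0 then l * cen0 form i j a b else 0) *: be +
    (if n' + n == 0 then l * (n'%:~R * cen1 form i j a b) else 0) *: be)).
Proof.
move=> Ha Hb Ea Eb Wb; apply: funext => c.
have Hab := lie_graded g_lie Ha Hb; have Eab := eigen_br Ea Eb.
have [K1 H1] := Fop_ev n Hb Eb Wb.
have [K2 H2] := Fop_ev n' Ha Ea Wb.
have [K3 H3] := Fop_ev n' Ha Ea (actA_W n Hb Eb Wb).
have [K4 H4] := Fop_ev n Hb Eb (actA_W n' Ha Ea Wb).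
have [K5 H5] := Fop_ev (n' + n) Hab Eab Wb.
(* The limits are computed at one common index k, beyond the one from which each of them is
   reached, and with P > |n + n'| + 2 for the products with the identity. *)
pose K6 := (absz (n + n')%R + 2)%N.
pose k := maxn K1 (maxn K2 (maxn K3 (maxn K4 (maxn K5 K6)))).
rewrite -(H3 k) -?(H1 k) -?(H4 k) -?(H2 k) -?(H5 k) ?leq_max ?leqnn ?orbT //.
have kP : (k < Pk k)%N := Pk_gt charF T_gt0 k.
have K6P : (K6 < Pk k)%N by apply: leq_ltn_trans kP; rewrite /k !leq_max leqnn !orbT.
move: K6P {H1 H2 H3 H4 H5 kP} => K6P.
have -> : Fop k i r a n' (Fop k j s b n be) c = _ := Fop_Fop k i j r s a b n n' be c.
have addWE (x y : W) e : (e *: x + y) c = e *: x c + y c by [].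
rewrite addWE Fop_Fop.
set m' := (Pk k)%:R * (r%:R / T%:R); set m := (Pk k)%:R * (s%:R / T%:R).
have Hm' : congZ m' (r%:R / T%:R).
  exact: (Pk_cong charF cop k (Tint_div T_gt0 r)).
rewrite (gop_comm m n n' c Ha Hb Ea Eb Wb Hm').
have b1 : binr F m' 1 = 0.
  by apply: (binr_small charF T_gt0 cop (e := (totient T * k)%N) (Tint_div T_gt0 r));
     apply: leq_ltn_trans K6P; rewrite /K6 addn2.
set d := c (+) i (+) j.
have Em : m + m' = (Pk k)%:R * ((r + s)%:R / T%:R) by rewrite natrD /m /m'; ring.
have Hid := isfld_idF T M; have Fab := isfld_fldA Eab; have Wd := W_fld Wb d.
rewrite !big_ord_recl !big_ord0 /= !addr0 /bump /= ?addn0 ?add0n.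
rewrite b1 !mul0r !scale0r !addr0 !binr0 !mul1r scale1r binr1 ratr_int [(s + r)%N]addnC.
rewrite /brF (prodF_combl _ _ _ _ Hid Fab Wd) prodF_scl // Em ksgDl.
have -> : prodF (ksg (i (+) j) d) (fldA (r + s) (br a b)) (be d) ((Pk k)%:R * ((r + s)%:R / T%:R)) (n + n') =
   gop (i (+) j) (r + s) (br a b) ((Pk k)%:R * ((r + s)%:R / T%:R)) (n' + n) be c.
  have Ed : d = c (+) (i (+) j) by rewrite /d addbA.
  by rewrite /gop -Ed addrC.
set Z := zsh _.
have ZD (x y : Fd) e : Z (e *: x + y) = e *: Z x + Z y by [].
have ZD' (x y : Fd) : Z (x + y) = Z x + Z y by [].
have ZZ (x : Fd) e : Z (e *: x) = e *: Z x by [].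
have addWD (x y : W) : (x + y) c = x c + y c by [].
have scW (x : W) e : (e *: x) c = e *: x c by [].
rewrite ZD !ZD' !ZZ !addWD !scW; congr (_ + _).
rewrite [X in X + _]addrC -addrA; congr (_ + _).
have Hidl : form a b != 0 -> i = j -> forall k' : int, 0 <= k' + (Pk k)%:Z ->
   Z (prodF (ksg (i (+) j) d) idF (be d) ((Pk k)%:R * ((r + s)%:R / T%:R)) k') =
   if k' == -1 then be c else 0.
  move=> f0 ij k' Hk'; have [e He] := dvdnP (form_eigen Ea Eb f0).
  have Ed : d = c by rewrite /d ij addbK.
  have E : (Pk k)%:R * ((r + s)%:R / T%:R) = (Pk k * e)%:R :> rat.
    by rewrite He natrM mulfK ?pnatr_eq0 -?lt0n // natrM.
  rewrite /Z E ij addbb Ed /ksg expr0.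
  rewrite (prodF_idl charF T_gt0 cop e (W_fld Wb c) Hk').
  by case: ifP => // _; rewrite zshA addNr zsh0.
have [Hn0 Hn1] := int_bound2 K6P; rewrite [n' + n]addrC.
have [e1 e2] := int_eqm1 (n + n').
rewrite e1 e2; congr (_ + _).
- rewrite /cen0; case: (boolP (i && j)) => [/andP[i1 j1]|_]; last by rewrite mulr0 if_same !scale0r.
  have [f0|f0] := eqVneq (form a b) 0; first by rewrite f0 mulr0 if_same !scale0r.
  rewrite Hidl //; last by rewrite i1 j1.
  by case: ifP => _; rewrite ?scale0r ?scaler0.
- rewrite scalerA /cen1.
  case: (boolP (~~ i && ~~ j)) => [/andP[i1 j1]|_]; last by rewrite !mulr0 if_same !scale0r.
  have [f0|f0] := eqVneq (form a b) 0; first by rewrite f0 !mulr0 if_same !scale0r.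
  rewrite Hidl //; last by move: i1 j1; case: (i); case: (j).
  by case: ifP => _; rewrite ?scale0r ?scaler0 // mulrCA.
Qed.

(** Homogeneous components of the elements of [g]. *)
Definition prg i r a : g := par_part gpar i (epr tau eta T r a).

Let TF : T%:R != 0 :> F := T_neq0 charF cop.

Let tau_lin : lin tau.
Proof. by move=> e a b; rewrite linearP. Qed.

Lemma prg_lin i r : lin (prg i r).
Proof. by move=> e a b; rewrite /prg (lin_epr eta T tau_lin r) par_part_lin. Qed.

Lemma prg_in i r a : prg i r a \in gpar i.
Proof. exact: par_part_in. Qed.

Lemma tau_par i a : tau (par_part gpar i a) = par_part gpar i (tau a).
Proof.
have := par_part_sum g_lie a => /(congr1 tau) E.
have H k x : tau (par_part gpar k x) \in gpar k by apply: (aut_par tau_aut); apply: par_part_in.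
rewrite -E (linD tau_lin) (linD (par_part_lin gpar i)).
by case: i; rewrite ?(par_part_id g_lie (H _ _)) ?(par_part0 g_lie (H false a)) ?(par_part0 g_lie (H true a)) ?add0r ?addr0.
Qed.

Lemma prg_eigen i r a : eigen r (prg i r a).
Proof.
rewrite /Defs.eigen /prg tau_par (epr_eigen tau_lin tau_iter eta_prim).
by rewrite (linZ (par_part_lin gpar i)).
Qed.

Lemma prg_sum a : \sum_(i : bool) \sum_(r < T) prg i r a = a.
Proof.
rewrite big_bool /= /prg -!(lin_sum (par_part_lin gpar _)) (epr_sum _ eta_prim TF).
by rewrite addrC (par_part_sum g_lie).
Qed.

Lemma prg_id i j r s a : (r < T)%N -> (s < T)%N -> a \in gpar j -> eigen s a ->
  prg i r a = if (i == j) && (r == s) then a else 0.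
Proof.
move=> Hr Hs Ha Ea; rewrite /prg (epr_id tau_lin eta_prim TF Hr Hs Ea) andbC.
case: eqP => _ /=; last by rewrite (lin0 (par_part_lin gpar i)).
case: (eqVneq i j) => [->|ij]; first exact: (par_part_id g_lie Ha).
have -> : i = ~~ j by move: ij; case: (i); case: (j).
exact: (par_part0 g_lie Ha).
Qed.

(** The action of the untwisted affine superalgebra on pairs of fields, k acting as l. *)
Definition act (x : affine g int) be : W :=
  \sum_(n <- msupp x.1) \sum_(i : bool) \sum_(r < T) actA i r (prg i r x.1@_n) n be
  + (l * x.2) *: be.

Lemma actA_lin_prg i r n be : inW be -> lin (fun a => actA i r (prg i r a) n be).
Proof.
move=> Wb e a b; rewrite prg_lin actA_combl //; try exact: prg_in; exact: prg_eigen.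
Qed.

Let act_lin_sum n be : inW be ->
  lin (fun a => \sum_(i : bool) \sum_(r < T) actA i r (prg i r a) n be).
Proof.
by move=> Wb; apply: lin_bigsum => i; apply: lin_bigsum => r; apply: actA_lin_prg.
Qed.

Lemma act_linl e x y be : inW be -> act (e *: x + y) be = e *: act x be + act y be.
Proof.
move=> Wb; have H : lin (fun f : loop g int => \sum_(n <- msupp f)
    \sum_(i : bool) \sum_(r < T) actA i r (prg i r f@_n) n be).
  by apply: (lin_suppsum (G := fun n a => \sum_(i : bool) \sum_(r < T) actA i r (prg i r a) n be)) => n; apply: act_lin_sum.
rewrite /act (H e x.1 y.1) scalerDr addrACA; congr (_ + _).
by rewrite scalerA -scalerDl; congr (_ *: _); rewrite /= mulrDr mulrCA.
Qed.

Lemma act_tens i r a n be : a \in gpar i -> eigen r a -> inW be ->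
  act (tens a n) be = actA i r a n be.
Proof.
move=> Ha Ea Wb; rewrite /act mulr0 scale0r addr0.
apply: etrans (suppsum_U a n (act_lin_sum ^~ be ^~ Wb)) _.
have actA0 i' r' : actA i' r' 0 n be = 0.
  have M0 : 0 \in gpar i' by exact: mem0v.
  have E0 : eigen r' 0 by rewrite /Defs.eigen linear0 scaler0.
  by have := actA_combl n (-1) M0 E0 M0 E0 Wb; rewrite scaler0 addr0 scaleN1r addNr.
apply: (@sum_pick _ _ _ i (Ordinal (ltn_pmod r T_gt0))) => i' r'.
rewrite (prg_id _ (ltn_ord r') (ltn_pmod r T_gt0) Ha (eigen_mod Ea)).
have -> : (nat_of_ord r' == r %% T)%N = (r' == Ordinal (ltn_pmod r T_gt0)) by [].
by case: ifP => // /andP[/eqP -> /eqP ->]; rewrite actA_mod.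
Qed.

Lemma act_kk be : act kk be = l *: be.
Proof. by rewrite /act msupp0 big_seq_fset0 add0r mulr1. Qed.

Lemma inW0 : inW 0.
Proof.
split=> [c|i r a Ha Ea]; first exact: isfld0.
by exists 0 => n _ m c; rewrite prodF_zero //; exact: isfld_fldA.
Qed.

Lemma inW_sum (I : Type) (s : seq I) (f : I -> W) : (forall k, inW (f k)) ->
  inW (\sum_(k <- s) f k).
Proof.
move=> H; elim: s => [|k s IH]; first by rewrite big_nil; exact: inW0.
by rewrite big_cons -[f k]scale1r; apply: inW_comb.
Qed.

Lemma act_W x be : inW be -> inW (act x be).
Proof.
move=> Wb; rewrite /act addrC; apply: inW_comb => //.
apply: inW_sum => n; apply: inW_sum => i; apply: inW_sum => r.
by apply: actA_W => //; [exact: prg_in|exact: prg_eigen].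
Qed.

Lemma act_linr x e be ga : inW be -> inW ga -> act x (e *: be + ga) = e *: act x be + act x ga.
Proof.
move=> Wb Wg; rewrite /act [e *: (_ + _ *: be)]scalerDr [RHS]addrACA; congr (_ + _); last first.
  by rewrite scalerDr !scalerA mulrC.
rewrite scaler_sumr -big_split; apply: eq_bigr => n _ /=.
rewrite scaler_sumr -big_split; apply: eq_bigr => i _ /=.
rewrite scaler_sumr -big_split; apply: eq_bigr => r _ /=.
by rewrite actA_combr //; [exact: prg_in|exact: prg_eigen].
Qed.

Let act0 x : act x 0 = 0.
Proof. by have := act_linr x (-1) inW0 inW0; rewrite scaler0 addr0 scaleN1r addNr. Qed.

Let act0l be : inW be -> act 0 be = 0.
Proof. by move=> Wb; have := act_linl (-1) 0 0 Wb; rewrite scaler0 addr0 scaleN1r addNr. Qed.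

(** The elements of parity i are spanned by the a (x) t ^ n, for [a] homogeneous of parity i,
    and by k if i is even. *)
Lemma affine_ind i (P : affine g int -> Prop) : P 0 ->
  (forall e x y, P x -> P y -> P (e *: x + y)) -> (i = false -> P kk) ->
  (forall r a n, a \in gpar i -> eigen r a -> P (tens a n)) ->
  forall x, affine_par gpar i x -> P x.
Proof.
move=> P0 Pc Pk' Pt x [Hx Hx2].
have Psum (I : Type) (s : seq I) (f : I -> affine g int) : (forall k, P (f k)) -> P (\sum_(k <- s) f k).
  by move=> H; elim: s => [|k s IH]; rewrite ?big_nil // big_cons -[f k]scale1r; apply: Pc.
have -> : x = x.2 *: kk + \sum_(n <- msupp x.1) \sum_(r < T) tens (epr tau eta T r x.1@_n) n.
  have E : \sum_(n <- msupp x.1) \sum_(r < T) tens (epr tau eta T r x.1@_n) n = (x.1, 0) :> affine g int.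
    transitivity (\sum_(n <- msupp x.1) tens x.1@_n n : affine g int).
      by apply: eq_bigr => n _; rewrite -(lin_sum (tens_lin n)) (epr_sum _ eta_prim TF).
    have E2 (s : seq int) : \sum_(n <- s) tens x.1@_n n = (\sum_(n <- s) << x.1@_n *g n >>, 0) :> affine g int.
      by elim: s => [|n s IH]; rewrite ?big_nil // !big_cons IH; congr (_, _); rewrite /= addr0.
    by rewrite E2 -monalgE.
  by rewrite E; case: x {Hx Hx2 E} => f e; congr (_, _); rewrite /= ?scaler0 ?add0r // addr0 -[e *: _]/(e * _) mulr1.
have Hepr n r : epr tau eta T r x.1@_n \in gpar i.
  rewrite /epr memvZ // memv_suml // => j _; rewrite memvZ //.
  elim: (nat_of_ord j) => [|k IH] /=; first exact: Hx.
  exact: (aut_par tau_aut).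
have HS : P (\sum_(n <- msupp x.1) \sum_(r < T) tens (epr tau eta T r x.1@_n) n).
  by apply: (Psum) => n; apply: (Psum) => r; apply: (Pt r) => //; exact: (epr_eigen tau_lin tau_iter eta_prim).
case: i {Psum Pt Hepr Hx} Hx2 Pk' => [/(_ isT) ->|_ Pk']; first by rewrite scale0r add0r.
by apply: Pc => //; exact: Pk'.
Qed.

Lemma act_br i j x y be : affine_par gpar i x -> affine_par gpar j y -> inW be ->
  act (affine_br gpar br form intr x y) be =
  act x (act y be) - (-1) ^+ (i && j) *: act y (act x be).
Proof.
move=> Hx Hy Wb; rewrite -/(ksg i j).
pose AB x y : affine g int := affine_br gpar br form intr x y.
pose Q x y := act (AB x y) be =
  act x (act y be) - ksg i j *: act y (act x be).
have AWx z := act_W z Wb.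
have scomb (X : lmodType F) e (a1 a2 b1 b2 : X) f :
    e *: a1 + a2 - f *: (e *: b1 + b2) = e *: (a1 - f *: b1) + (a2 - f *: b2).
  by rewrite scalerBr scalerDr opprD addrACA; congr (_ - _ + _); rewrite !scalerA mulrC.
suff: Q x y by [].
elim/(@affine_ind i): x / Hx.
- by rewrite /Q /AB (lin0 (affine_br_linl g_lie form_g intr y)) !act0l // act0 scaler0 subr0.
- move=> e x1 x2 Q1 Q2; have E : AB (e *: x1 + x2) y = e *: AB x1 y + AB x2 y := affine_br_linl g_lie form_g intr y e x1 x2.
  rewrite /Q E (act_linl e _ _ Wb) Q1 Q2.
  by rewrite (act_linl _ _ _ (AWx y)) (act_linl _ _ _ Wb) act_linr // scomb.
- move=> i0; rewrite /Q /AB affine_br_kkl act0l // !act_kk /ksg i0 expr0 scale1r.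
  by have := act_linr y l Wb inW0; rewrite act0 !addr0 => ->; rewrite subrr.
move=> r a n Ha Ea; elim/(@affine_ind j): y / Hy.
- by rewrite /Q /AB (lin0 (affine_br_linr g_lie form_g intr _)) !act0l // act0 scaler0 subr0.
- move=> e x1 x2 Q1 Q2; have E : AB (tens a n) (e *: x1 + x2) = e *: AB (tens a n) x1 + AB (tens a n) x2 :=
    affine_br_linr g_lie form_g intr (tens a n) e x1 x2.
  rewrite /Q E (act_linl e _ _ Wb) Q1 Q2.
  by rewrite (act_linl _ _ _ (AWx (tens a n))) (act_linl _ _ _ Wb) act_linr // scomb.
- move=> j0; rewrite /Q /AB affine_br_kkr act0l // !act_kk /ksg j0 andbF expr0 scale1r.
  by have := act_linr (tens a n) l Wb inW0; rewrite act0 !addr0 => ->; rewrite subrr.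
move=> s b n' Hb Eb; rewrite /Q /AB (affine_br_tens_hom g_lie form_g _ _ _ Ha Hb).
rewrite !act_linl // act_kk (act_tens n Ha Ea Wb) (act_tens n' Hb Eb Wb).
rewrite (act_tens n Ha Ea (actA_W _ Hb Eb Wb)) (act_tens n' Hb Eb (actA_W _ Ha Ea Wb)).
rewrite (act_tens _ (lie_graded g_lie Ha Hb) (eigen_br Ea Eb) Wb).
rewrite (actA_br n' n Ha Hb Ea Eb Wb) [RHS]addrAC subrr add0r [LHS]addrA [LHS]addrC.
congr (_ + _); rewrite [LHS]addrC !scalerA.
by congr (_ *: _ + _ *: _); case: ifP => _; rewrite ?mul0r //; ring.
Qed.

(** The identity operator, as an even field. *)
Definition w0 : W := fun c => if c then 0 else idF.

Lemma inW_w0 : inW w0.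
Proof.
split=> [[]|i r a Ha Ea]; [exact: isfld0|exact: isfld_idF|].
exists 0 => n Hn m [] /=; first by rewrite prodF_zero //; exact: isfld_fldA.
by rewrite /ksg andbF expr0 (prodF_idr_ge0 charF T_gt0 cop) //; exact: isfld_fldA.
Qed.

Lemma act_w0 x : nonneg_part x -> act x w0 = (l * x.2) *: w0.
Proof.
move=> Hx; rewrite /act big1 ?add0r // => n _; rewrite big1 // => i _; rewrite big1 // => r _.
case: (ltrP n 0) => Hn.
  by rewrite Hx // (lin0 (actA_lin_prg i r n inW_w0)).
apply: actA_uniq; [exact: prg_in|exact: prg_eigen|exact: inW_w0|].
exists 0%N => k _; apply: funext => c; rewrite /Fop /zshW /gop /w0.
have Fp := isfld_fldA (prg_eigen i r x.1@_n).
have Z0 e : zsh e (0 : Fd) = 0 by [].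
case: (c (+) i); first by rewrite prodF_zero.
by rewrite /ksg andbF expr0 (prodF_idr_ge0 charF T_gt0 cop).
Qed.

End Module.

(** * The induced module *)

Section InducedModule.
Variables (F : fieldType) (g : vectType F) (gpar : bool -> {vspace g}).
Variables (br : g -> g -> g) (form : g -> g -> F) (l : F).
Local Notation L := (affine g int).
Local Notation Vaff := (Vaff gpar br form l).
Local Notation A := (free_algebra g).
Local Notation rel := (@induced_rel F g gpar br form l).
Local Notation pi := (lquot_pi rel).

Lemma lspan1 (U : lmodType F) (G : U -> Prop) x : G x -> lspan G x.
Proof. by move=> Gx; rewrite -[x]addr0 -[x]scale1r; apply: lspan_cons => //; apply: lspan0. Qed.

(** The product of the free algebra is also linear on the right; its left algebra structure only
    says so on the left. *)
Lemma mulZr (c : F) (x f : A) : x * (c *: f) = c *: (x * f).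
Proof.
apply: etrans (malgMEw (fsubset_refl _) (msuppZ_le c f)) _.
rewrite malgME scaler_sumr; apply: eq_bigr => k _.
rewrite scaler_sumr; apply: eq_bigr => k' _; apply/malgP => m.
by rewrite !(mcoeffZ, mcoeffU) mulrCA mulrnAr.
Qed.

Lemma lspan_mull (x f : A) : lspan rel f -> lspan rel (x * f).
Proof.
elim=> [|c v w Hv _ IH]; first by rewrite mulr0; apply: lspan0.
rewrite mulrDr mulZr; apply: lspan_cons => //.
case: Hv => [a b d y z|a b i j y z Hy Hz|a y Hy].
- by rewrite !mulrA; apply: rel_linear.
- by rewrite !mulrA; apply: rel_bracket.
- by rewrite mulrBr mulrA mulZr; apply: rel_induced.
Qed.

Lemma pi_lin : lin pi.
Proof. by move=> c x y; rewrite lquot_piD -lquot_piZ. Qed.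

Lemma Vact_pi x f : Vact x (pi f) = pi (gen x * f) :> Vaff.
Proof.
apply/lquot_eqP; rewrite -mulrBr; apply: lspan_mull.
by apply/lquot_eqP; rewrite lquot_reprK.
Qed.

Lemma pi_relP f h (r : A) : rel r -> r = f - h -> pi f = pi h.
Proof. by move=> Hr E; apply/(lquot_eqP rel f h); rewrite -E; exact: lspan1. Qed.

Lemma Vact_linr x : lin (Vact x : Vaff -> Vaff).
Proof.
move=> c u v; rewrite -(lquot_reprK u) -(lquot_reprK v).
move: (lquot_repr u) (lquot_repr v) => f h.
apply: etrans (congr1 (Vact x) (esym (pi_lin c f h))) _.
apply: etrans (Vact_pi x (c *: f + h)) _.
have E1 := Vact_pi x f; have E2 := Vact_pi x h; rewrite E1 E2.
rewrite -(pi_lin c (gen x * f) (gen x * h)); congr (pi _).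
by rewrite (mulrDr (gen x) (c *: f) h) (mulZr c (gen x) f).
Qed.

Let comb_mul (R : lalgType F) c (a b d f : R) :
  1 * (a - (c *: b + d)) * f = a * f - (c *: (b * f) + d * f).
Proof. by rewrite mul1r mulrBl mulrDl scalerAl. Qed.

Lemma Vact_linl (v : Vaff) : lin (fun x => Vact x v).
Proof.
move=> c x y; rewrite -(lquot_reprK v); move: (lquot_repr v) => f.
rewrite (Vact_pi (c *: x + y) f) (Vact_pi x f) (Vact_pi y f) -(pi_lin c (gen x * f) (gen y * f)).
apply: (pi_relP (@rel_linear F g gpar br form l 1 f c x y)).
exact: comb_mul.
Qed.

Let bracket_mul (R : lalgType F) c (a b z f : R) :
  1 * (a * b - c *: (b * a) - z) * f = - c *: (b * (a * f)) + a * (b * f) - z * f.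
Proof.
by rewrite mul1r !mulrBl -scalerAl -!mulrA scaleNr [- _ + _]addrC.
Qed.

Lemma Vact_bracket i j x y (v : Vaff) : affine_par gpar i x -> affine_par gpar j y ->
  Vact x (Vact y v) - (-1) ^+ (i && j) *: Vact y (Vact x v) =
  Vact (affine_br gpar br form intr x y) v.
Proof.
move=> Hx Hy; rewrite -(lquot_reprK v); move: (lquot_repr v) => f.
rewrite (Vact_pi y f) (Vact_pi x f) (Vact_pi x (gen y * f)) (Vact_pi y (gen x * f)).
rewrite (Vact_pi (affine_br gpar br form intr x y) f) addrC -scaleNr.
rewrite -(pi_lin (- (-1) ^+ (i && j)) (gen y * (gen x * f)) (gen x * (gen y * f))).
apply: (pi_relP (@rel_bracket F g gpar br form l 1 f i j x y Hx Hy)).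
exact: bracket_mul.
Qed.

Lemma Vact_nonneg x : nonneg_part x -> Vact x (Vvac gpar br form l) = (l * x.2) *: Vvac gpar br form l.
Proof.
move=> Hx; rewrite /Vvac (Vact_pi x 1).
have E := linZ pi_lin (l * x.2) 1; rewrite -E.
apply: (pi_relP (@rel_induced F g gpar br form l 1 x Hx)).
by rewrite (mul1r (gen x)) (mulr1 (gen x)).
Qed.

(** The induced module is generated by the vacuum. *)
Lemma Vaff_ind (P : Vaff -> Prop) : P (Vvac gpar br form l) ->
  (forall c u v, P u -> P v -> P (c *: u + v)) ->
  (forall x v, P v -> P (Vact x v)) -> forall v, P v.
Proof.
move=> Pv Pc Pa v; have P0 : P 0.
  by rewrite -[0](subrr (Vvac gpar br form l)) addrC -scaleN1r; apply: Pc.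
rewrite -[v]lquot_reprK; move: (lquot_repr v) => f {v}; rewrite [f]monalgE.
have Pm (m : {fmonom L}) : P (pi (<< 1 *g m >> : A)).
  rewrite -[m]fmK; elim: (m : seq L) => [|x s IH].
    have -> : (<< 1 *g FMonom [::] >> : A) = 1 by rewrite -[FMonom [::]]fmoneE.
    exact: Pv.
  have -> : (<< 1 *g FMonom (x :: s) >> : A) = gen x * << 1 *g FMonom s >>.
    rewrite /gen; apply: etrans _ (esym (fgmulUU _ _ _ _)).
    by rewrite mulr1; congr (<< _ *g _ >>); apply/eqP; rewrite fmP fmM fmU.
  by rewrite -Vact_pi; apply: Pa.
elim: (enum_fset (msupp f)) => [|m s IH]; first by rewrite big_nil (lin0 pi_lin).
rewrite big_cons; have -> : << f@_m *g m >> = f@_m *: (<< 1 *g m >> : A).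
  by apply/malgP => k; rewrite mcoeffZ !mcoeffU mulrnAr mulr1.
by rewrite pi_lin; apply: Pc.
Qed.

End InducedModule.

(** * The Jacobi identity in coefficients *)

Section JacobiCoefficients.
Variables (F : fieldType) (p T : nat).
Hypotheses (charF : p \in [pchar F]) (T_gt0 : (0 < T)%N) (cop : coprime T p).
Variables (V W : lmodType F) (Y : V -> int -> V -> V) (YW : V -> rat -> W -> W).
Hypothesis YW0 : forall q w, YW 0 q w = 0.

(** A sum over exponents whose nonzero terms are met along the injective sequence h. *)
Lemma nsum_fsbig (J : choiceType) (h : nat -> J) (f : J -> W) : injective h ->
  (forall d, f d != 0 -> exists k, d = h k) ->
  (\sum_(d \in [set: J]) f d)%R = nsum (fun k => f (h k)).
Proof.
move=> hi Hf; rewrite /nsum -(@fsbig_image _ _ _ _ _ setT h f); last by move=> x y _ _; apply: hi.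
apply/esym/fsbig_widen => // d [_ Hd] /=; apply/eqP/negPn/negP => /Hf [k E].
by apply: Hd; exists k.
Qed.

(** The Jacobi identity coefficient by coefficient: its coefficient at
    x0 ^ (- n - 1) x1 ^ (- m - 1) x2 ^ (- q - 1). *)
Definition jacC (s : rat) (sign : F) u v w :=
  forall n (m q : rat),
  prodF sign (YW u) (YW v) m n q w =
  if congZ m s then nsum (fun k => binr F m k *: YW (Y u (n + k%:Z) v) (q + m - k%:R) w) else 0.

Lemma jacobiP s sign u v w : jacobi Y YW s sign u v w <-> jacC s sign u v w.
Proof.
have Enat (k : nat) : Num.truncn (k%:R : rat) = k by rewrite natrK.
have nat_nat (k : nat) : (k%:R : rat) \is a Num.nat by exact: natr_nat.
have M0 (a : F) (b : W) : a *: b != 0 -> a != 0 /\ b != 0.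
  by rewrite scaler_eq0 negb_or => /andP.
have sub_powP al a b : sub_pow F al a b != 0 -> exists2 k : nat, b = k%:R & a = al - k%:R.
  rewrite /sub_pow; case: ifP => [/andP[/natrP[k ->] /eqP ->] _|_ /eqP //].
  by exists k.
have sub_powE al (k : nat) : sub_pow F al (al - k%:R) k%:R = (-1) ^+ k * binr F al k.
  by rewrite /sub_pow nat_nat eqxx /= Enat.
have coef n m q :
  [/\ series_mul (delta_12 F) (fun e => let: (e0, e1, e2) := e in
        if e0 == 0 then YW u (- e1 - 1) (YW v (- e2 - 1) w) else 0)
        (- n%:~R - 1, - m - 1, - q - 1) =
      PL n (fun s' t => YW u s' (YW v t w)) m q,
   series_mul (delta_21 F) (fun e => let: (e0, e1, e2) := e in
        if e0 == 0 then YW v (- e2 - 1) (YW u (- e1 - 1) w) else 0)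
        (- n%:~R - 1, - m - 1, - q - 1) =
      PR n (fun s' t => YW v t (YW u s' w)) m q &
   series_mul (delta_10 F s) (fun e => let: (e0, e1, e2) := e in
        if e1 == 0 then YW (int_modes Y u (- e0 - 1) v) (- e2 - 1) w else 0)
        (- n%:~R - 1, - m - 1, - q - 1) =
      if congZ m s then nsum (fun k => binr F m k *: YW (Y u (n + k%:Z) v) (q + m - k%:R) w) else 0].
  split.
  - rewrite /series_mul (@nsum_fsbig _ (fun k : nat => (- n%:~R - 1, n%:~R - k%:R, k%:R) : expo)).
    + apply: eq_nsum => k; rewrite /delta_12.
      have -> : (- n%:~R - 1 : rat) \is a Num.int by rewrite rpredB ?rpredN ?intr_int.
      have -> : - (- n%:~R - 1) - 1 = n%:~R :> rat by ring.
      rewrite sub_powE /= subrr eqxx; congr (_ *: YW u _ (YW v _ w)); ring.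
    + by move=> k k' [/eqP]; rewrite (inj_eq (addrI _)) eqr_opp eqr_nat => /eqP.
    + move=> [[d0 d1] d2] /M0 [] /=; case: ifP => _; last by move/eqP.
      move=> /sub_powP [k -> ->]; case: (- n%:~R - 1 - d0 =P 0) => [E _|_ /eqP //].
      have -> : d0 = - n%:~R - 1 by apply/esym/eqP; rewrite -subr_eq0 E.
      by exists k; congr (_, _, _); ring.
  - rewrite /series_mul (@nsum_fsbig _ (fun k : nat => (- n%:~R - 1, k%:R, n%:~R - k%:R) : expo)).
    + apply: eq_nsum => k; rewrite /delta_21.
      have -> : (- n%:~R - 1 : rat) \is a Num.int by rewrite rpredB ?rpredN ?intr_int.
      have -> : - (- n%:~R - 1) - 1 = n%:~R :> rat by ring.
      rewrite sub_powE numq_int /= subrr eqxx; congr (_ *: YW v _ (YW u _ w)); ring.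
    + by move=> k k' [/eqP]; rewrite eqr_nat => /eqP.
    + move=> [[d0 d1] d2] /M0 [] /=; case: ifP => _; last by move/eqP.
      rewrite mulf_eq0 negb_or => /andP[_ /sub_powP [k -> ->]].
      case: (- n%:~R - 1 - d0 =P 0) => [E _|_ /eqP //].
      have -> : d0 = - n%:~R - 1 by apply/esym/eqP; rewrite -subr_eq0 E.
      by exists k; congr (_, _, _); ring.
  - rewrite /series_mul (@nsum_fsbig _ (fun k : nat => (k%:R, - m - 1, m - k%:R) : expo)).
    + case: ifP => Hm; last first.
        rewrite (@nsumE _ _ _ 0) ?big_ord0 // => k _; rewrite /delta_10.
        case: ifP => [H|]; last by rewrite scale0r.
        move: Hm; rewrite /congZ -[m](subrK k%:R) addrAC rpredD ?natr_int //.
      apply: eq_nsum => k; rewrite /delta_10.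
      have -> : m - k%:R - s \is a Num.int.
        by rewrite addrAC rpredB ?natr_int.
      have E : - m - 1 = - (m - k%:R) - 1 - k%:R :> rat by ring.
      rewrite {1}E sub_powE.
      have -> : - (m - k%:R) - 1 = k%:R - m - 1 :> rat by ring.
      rewrite binr_neg mulrA -exprMn mulrNN mulr1 expr1n mul1r /= subrr eqxx.
      congr (_ *: YW _ _ w); last by ring.
      have -> : - (- n%:~R - 1 - k%:R) - 1 = (n + k%:Z)%:~R :> rat.
        by rewrite rmorphD /= -pmulrn; ring.
      by rewrite /int_modes intr_int numq_int.
    + by move=> k k' [/eqP]; rewrite eqr_nat => /eqP.
    + move=> [[d0 d1] d2] /M0 [] /=; case: ifP => _; last by move/eqP.
      move=> /sub_powP [k -> ->].
      case: (- m - 1 - (- d2 - 1 - k%:R) =P 0) => [E _|_ /eqP //].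
      by exists k; congr (_, _, _); lra.
split=> [J n m q|C].
  have [E1 E2 E3] := coef n m q; have := J (- n%:~R - 1, - m - 1, - q - 1).
  by rewrite E1 E2 E3.
rewrite /jacobi => -[[e0 e1] e2].
case: (boolP (e0 \is a Num.int)) => [/intrP[z ->]|He0].
  pose n := - z - 1; have [E1 E2 E3] := coef n (- e1 - 1) (- e2 - 1).
  have En : z%:~R = - n%:~R - 1 :> rat by rewrite /n rmorphB rmorphN /=; ring.
  have Em (x : rat) : x = - (- x - 1) - 1 by ring.
  by rewrite En {1 2 3}(Em e1) {1 2 3}(Em e2) E1 E2 E3 -C.
have Z (K : expo -> F) (B : expo -> W) (e : expo) : (forall d, K d *: B (e - d) = 0) -> series_mul K B e = 0.
  by move=> H; rewrite /series_mul fsbig1 // => d _.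
have H12 d0 : d0 \is a Num.int -> (e0 - d0 == 0) = false.
  move=> H; apply: contraNF He0 => /eqP E.
  by rewrite -[e0](subrK d0) E add0r.
have Z12 B : series_mul (delta_12 F) (fun e => let: (e0, e1, e2) := e in
    if e0 == 0 then B e1 e2 else 0) (e0, e1, e2) = 0 :> W.
  apply: Z => -[[d0 d1] d2] /=; case: ifP => H; last by rewrite scale0r.
  by rewrite H12 // scaler0.
have Z21 B : series_mul (delta_21 F) (fun e => let: (e0, e1, e2) := e in
    if e0 == 0 then B e1 e2 else 0) (e0, e1, e2) = 0 :> W.
  apply: Z => -[[d0 d1] d2] /=; case: ifP => H; last by rewrite scale0r.
  by rewrite H12 // scaler0.
rewrite (Z12 (fun e1 e2 => YW u (- e1 - 1) (YW v (- e2 - 1) w))).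
rewrite (Z21 (fun e1 e2 => YW v (- e2 - 1) (YW u (- e1 - 1) w))) scaler0 subrr Z //.
move=> [[d0 d1] d2] /=; apply/eqP/negPn/negP => /M0 []; case: ifP => _; last by move/eqP.
move=> /sub_powP [k -> _]; case: ifP => [_|_ /eqP //].
rewrite /int_modes ifF ?YW0 ?eqxx //; apply: contraNF He0 => H.
have -> : e0 = - (- (e0 - k%:R) - 1) - 1 + k%:R by ring.
by rewrite rpredD ?natr_int // rpredB // rpredN.
Qed.

End JacobiCoefficients.

(** * Modes of a vertex superalgebra *)

Section VertexModes.
Variables (F : fieldType) (p T : nat).
Hypotheses (charF : p \in [pchar F]) (T_gt0 : (0 < T)%N) (cop : coprime T p).
Variables (V : lmodType F) (par : bool -> V -> Prop) (vac : V) (Y : V -> int -> V -> V).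
Hypothesis Y_vsa : is_vertex_superalgebra par vac Y.
Implicit Types (a u v : V) (n : int).

Lemma Y_linl n v : lin (fun u => Y u n v).
Proof. by move=> e x y; apply: (va_linearl Y_vsa). Qed.

Lemma Y_linr u n : lin (Y u n).
Proof. by move=> e x y; apply: (va_linearr Y_vsa). Qed.

Local Notation IY := (int_modes Y).

Lemma IYE u n v : IY u n%:~R v = Y u n v.
Proof. by rewrite /int_modes intr_int numq_int. Qed.

Lemma isfld_IY u : isfld T (IY u).
Proof.
split=> [q e x y|v|q v]; rewrite /int_modes.
- by case: ifP => _; [exact: Y_linr | rewrite scaler0 addr0].
- have [N HN] := va_truncation Y_vsa u v; exists N%:~R => q Hq.
  case: ifP => // /intrP[z E]; rewrite E numq_int HN //.
  by move: Hq; rewrite E ler_int.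
- by case: ifP => // /Tint_int -> .
Qed.

Lemma IY0 q v : IY 0 q v = 0.
Proof. by rewrite /int_modes; case: ifP => // _; rewrite (lin0 (Y_linl _ _)). Qed.

Lemma Y_jac i j a u v : par i a -> par j u ->
  jacC Y IY 0 (ksg F i j) a u v.
Proof.
by move=> Ha Hu; apply/(jacobiP Y IY0); exact: (va_jacobi Y_vsa v Ha Hu).
Qed.

(** The commutator formula for modes. *)
Lemma Y_comm i j a u v n n' : par i a -> par j u ->
  Y a n (Y u n' v) - ksg F i j *: Y u n' (Y a n v) =
  nsum (fun k => binr F n%:~R k *: Y (Y a k%:Z u) (n' + n - k%:Z) v).
Proof.
move=> Ha Hu; have := Y_jac v Ha Hu 0 n%:~R n'%:~R.
rewrite (prodF0 charF T_gt0 cop); try exact: isfld_IY.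
rewrite !IYE.
have -> : congZ n%:~R 0 by rewrite /congZ subr0 intr_int.
move=> ->; apply: eq_nsum => k; congr (_ *: _).
by rewrite add0r -(IYE (Y a k%:Z u)) rmorphB rmorphD.
Qed.

(** The iterate formula, applied to the vacuum, where only one expansion contributes. *)
Lemma Y_iterate_vac i j a u n k : par i a -> par j u ->
  Y (Y a n u) (- k.+1%:Z) vac =
  \sum_(d < k.+1) ((-1) ^+ d * binr F n%:~R d) *:
     Y a (n - d%:Z) (Y u (- (k - d)%N.+1%:Z) vac).
Proof.
move=> Ha Hu; have := Y_jac vac Ha Hu n 0 (- k.+1%:Z)%:~R.
rewrite congZ_refl prodFE.
have -> : PR n (fun s t => IY u t (IY a s vac)) 0 (- k.+1%:Z)%:~R = 0.
  apply: nsum0 => d; rewrite add0r.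
  have -> : (d%:R : rat) = d%:Z%:~R by [].
  by rewrite IYE (va_creation Y_vsa) // (fld0 _ (isfld_IY u)) scaler0.
rewrite scaler0 subr0 (@nsum_single _ _ _ 0%N) => [|d /negbTE d0]; last first.
  by rewrite (binr_0 charF T_gt0 cop) d0 scale0r.
rewrite binr0 scale1r !addr0 IYE => <-.
rewrite /PL (@nsumE _ _ _ k.+1) => [|d Hd]; last first.
  have -> : ((- k.+1%:Z)%:~R + d%:R : rat) = (d%:Z - k.+1%:Z)%:~R.
    by rewrite addrC rmorphB rmorphN.
  by rewrite IYE (va_creation Y_vsa) ?(fld0 _ (isfld_IY _)) ?scaler0 // subr_ge0.
apply: eq_bigr => d _; congr (_ *: _).
have -> : (0 + n%:~R - d%:R : rat) = (n - d%:Z)%:~R by rewrite add0r rmorphB.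
have -> : ((- k.+1%:Z)%:~R + d%:R : rat) = (- (k - d)%N.+1%:Z)%:~R.
  have Hd : (d <= k)%N by rewrite -ltnS.
  by rewrite !rmorphN /= -!pmulrn -!natr1 natrB //; ring.
by rewrite !IYE.
Qed.

End VertexModes.

(** * The Jacobi identity *)

(** The situation after the universal property has been applied: [phi] maps a vertex superalgebra,
    generated from the vacuum by the modes of [emb a], to pairs of fields; it maps the vacuum to
    the identity, and turns the mode n of [emb a], for [a] of degree s, into the Frobenius limit
    of the products with [fA s a]. *)
Section Twisted.
Variables (F : fieldType) (p : nat) (charF : p \in [pchar F]).
Variables (g : vectType F) (gpar : bool -> {vspace g}) (tau : 'End(g)).
Variables (T : nat) (cop : coprime T p) (eta : F) (eta_prim : T.-primitive_root eta).
Variables (V : lmodType F) (par : bool -> V -> Prop) (vac : V) (Y : V -> int -> V -> V).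
Hypothesis Y_vsa : is_vertex_superalgebra par vac Y.
Variables (emb : g -> V) (sigma : V -> V) (M : lmodType F) (fA : nat -> g -> rat -> M -> M).

Let T_gt0 : (0 < T)%N := prim_order_gt0 eta_prim.
Let TF : T%:R != 0 :> F := T_neq0 charF cop.
Local Notation Pk := (Pk p T).
Local Notation eigen := (eigen tau eta).
Local Notation isfld := (isfld T).
Local Notation Fd := (field_ M).
Local Notation idF := (@idF F M).
Local Notation prodF := (@prodF F M).
Local Notation W := (bool -> Fd).
Local Notation ksg := (ksg F).
Local Notation act a n v := (Y (emb a) n v).
Implicit Types (a b : g) (u v : V) (n : int) (i j c : bool) (r s : nat) (w : M) (m q : rat).

Hypothesis emb_par : forall i a, a \in gpar i -> par i (emb a).
Hypothesis V_ind : forall P : V -> Prop, P vac ->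
  (forall e u v, P u -> P v -> P (e *: u + v)) ->
  (forall i s a n v, a \in gpar i -> eigen s a -> P v -> P (act a n v)) ->
  forall v, P v.
Hypothesis sigma_lin : lin sigma.
Hypothesis sigma_vac : sigma vac = vac.
Hypothesis sigma_act : forall s a n v, eigen s a ->
  sigma (act a n v) = eta ^+ s *: act a n (sigma v).
Hypothesis fA_fld : forall r a, eigen r a -> isfld (fA r a).
Hypothesis fA_off : forall r a q w, ~~ congZ q (r%:R / T%:R) -> fA r a q w = 0.

Variable phi : V -> W.
Hypothesis phi_lin : lin phi.
Hypothesis phi_fld : forall v c, isfld (phi v c).
Hypothesis phi_vac : phi vac = fun c => if c then 0 else idF.
Hypothesis phi_act : forall i s b n v, b \in gpar i -> eigen s b ->
  exists K, forall k, (K <= k)%N -> forall c, phi (act b n v) c =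
    zsh (- ((Pk k)%:R * (s%:R / T%:R)))
      (prodF (ksg i (c (+) i)) (fA s b) (phi v (c (+) i)) ((Pk k)%:R * (s%:R / T%:R)) n).
Hypothesis phi_loc : forall i s b v, b \in gpar i -> eigen s b ->
  exists N : int, forall n, N <= n -> forall m c,
    prodF (ksg i c) (fA s b) (phi v c) m n = 0.

(** ** Homogeneous monomials *)

(** Monomials in the modes of homogeneous elements, applied to the vacuum, with their parity and
    their degree (not reduced modulo T). *)
Inductive mono : bool -> nat -> V -> Prop :=
| mono_vac : mono false 0 vac
| mono_act i j r s a n u : a \in gpar j -> eigen s a -> mono i r u ->
    mono (j (+) i) (s + r) (act a n u).

Lemma mono_par i r u : mono i r u -> par i u.
Proof.
elim=> [|{}i j {}r s a n {}u Ha _ _ IH]; first exact: (va_vac_even Y_vsa).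
by apply: (va_par_modes Y_vsa) => //; exact: emb_par.
Qed.

Lemma mono_phi0 i r u : mono i r u -> phi u (~~ i) = 0.
Proof.
elim=> [|{}i j {}r s a n {}u Ha Ea _ IH]; first by rewrite phi_vac.
have [K HK] := phi_act n u Ha Ea.
have E : ~~ (j (+) i) (+) j = ~~ i by case: (i); case: (j).
rewrite (HK K) // E IH (prodF_zero _ _ _ (fA_fld Ea)).
by [].
Qed.

Lemma mono_off i r u q w : mono i r u -> ~~ congZ q (r%:R / T%:R) -> phi u i q w = 0.
Proof.
move=> Hu; elim: Hu q w => [|{}i j {}r s a n {}u Ha Ea _ IH] q w Hq.
  rewrite phi_vac idFE; case: eqP => // E; case/negP: Hq.
  by rewrite E mul0r /congZ subr0.
have [K HK] := phi_act n u Ha Ea.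
rewrite (HK K) // /zsh addbAC addbb addFb.
have Hs := Pk_cong charF cop K (Tint_div T_gt0 s).
have off (z : rat) : z \is a Num.int ->
    ~~ congZ (q + - ((Pk K)%:R * (s%:R / T%:R)) + z) (r%:R / T%:R).
  move=> Hz; apply: contra Hq => H.
  have := congZD (congZDi H (c := - z) _) Hs; rewrite addrK subrK => /(_ _).
  by rewrite rpredN natrD mulrDl addrC; apply.
rewrite prodFE /PL /PR !nsum0 ?scaler0 ?subr0 // => k.
  by rewrite -addrA IH ?scaler0 // off // rpredB ?intr_int ?natr_int.
by rewrite IH ?(fld0 _ (fA_fld Ea)) ?scaler0 // off ?natr_int.
Qed.

Lemma mono_sigma i r u : mono i r u -> sigma u = eta ^+ r *: u.
Proof.
elim=> [|{}i j {}r s a n {}u Ha Ea _ IH]; first by rewrite sigma_vac scale1r.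
by rewrite (sigma_act _ _ Ea) IH (linZ (Y_linr Y_vsa _ _)) scalerA -exprD.
Qed.

Lemma phi_sum (I : Type) (t : seq I) (f : I -> F) (x : I -> V) c :
  phi (\sum_(d <- t) f d *: x d) c = \sum_(d <- t) f d *: phi (x d) c.
Proof.
elim: t => [|d t IH]; first by rewrite !big_nil (lin0 phi_lin).
by rewrite !big_cons phi_lin -IH.
Qed.

Lemma field_sumE (I : Type) (t : seq I) (H : I -> Fd) q w :
  (\sum_(d <- t) H d) q w = \sum_(d <- t) H d q w.
Proof. by elim: t => [|d t IH]; rewrite ?big_nil // !big_cons -IH. Qed.

Lemma dd_idF k : dd k idF = if k is 0%N then idF else 0 :> Fd.
Proof.
case: k => [|k]; first exact: dd0.
apply: funext => q; apply: funext => w; rewrite /dd idFE.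
case: ifP => [/eqP E|_]; last by rewrite scaler0.
have -> : q = k%:R by move: E; rewrite -natr1; lra.
by rewrite (binr_natE charF T_gt0 cop) bin_small // mulr0 scale0r.
Qed.

(** Finitely many eventual properties hold from a common index on. *)
Lemma ev_all (P : nat -> nat -> Prop) N :
  (forall d, exists K, forall k, (K <= k)%N -> P d k) ->
  exists K, forall k, (K <= k)%N -> forall d, (d < N)%N -> P d k.
Proof.
move=> H; elim: N => [|N [K HK]]; first by exists 0%N.
have [L HL] := H N; exists (maxn K L) => k; rewrite geq_max => /andP[h1 h2] d.
by rewrite ltnS leq_eqVlt => /orP[/eqP ->|]; [exact: HL | exact: HK].
Qed.

(** The mode - k - 1 of u sends the vacuum to the k-th divided derivative of u, and phi turns
    the latter into the derivative of fields. *)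
Lemma mono_dd i r u k : mono i r u -> phi (Y u (- k.+1%:Z) vac) i = dd k (phi u i).
Proof.
move=> Hu; elim: Hu k => [|{}i j {}r s a n {}u Ha Ea Hu IH] k.
  rewrite (va_vacuum Y_vsa) phi_vac dd_idF; case: k => [|k] /=; first by rewrite phi_vac.
  by rewrite (lin0 phi_lin).
rewrite (Y_iterate_vac charF T_gt0 cop Y_vsa n k (emb_par Ha) (mono_par Hu)) phi_sum.
have E : j (+) i (+) j = i by case: (i); case: (j).
have [K HK] := ev_all k.+1 (fun d => phi_act (n - d%:Z) (Y u (- (k - d)%N.+1%:Z) vac) Ha Ea).
have [K' HK'] := phi_act n u Ha Ea.
pose e := maxn k (maxn K K').
have [h1 h2 h3] : [/\ (k <= e)%N, (K <= e)%N & (K' <= e)%N].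
  by rewrite !leq_max !leqnn !orbT.
rewrite (HK' _ h3) E.
have Es : - ((Pk e)%:R * (s%:R / T%:R)) = (Pk e)%:R * (- (s%:R / T%:R)) :> rat by rewrite mulrN.
rewrite [in RHS]Es (dd_zsh charF T_gt0 cop); last 3 first.
- by apply: isfld_prodF => //; exact: fA_fld.
- by rewrite /Tint mulNr rpredN; exact: (Tint_div T_gt0 s).
- exact: leq_ltn_trans h1 (Pk_gt charF T_gt0 e).
rewrite (dd_prodF charF T_gt0 cop) //; last exact: fA_fld.
apply: funext => q; apply: funext => w; rewrite /zsh !field_sumE.
by apply: eq_bigr => d _; rewrite (HK _ h2 d) // E -IH /zsh Es.
Qed.

(** ** The Jacobi identity for monomials *)

(** The brackets of the modes of [fA s b] and [phi u] are given by the images of the nonnegative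
    products of b and u. *)
Lemma fA_comm i s b j u c : b \in gpar i -> eigen s b ->
  exists N : nat, (forall k, (N <= k)%N -> act b k%:Z u = 0) /\
  forall q t w, congZ q (s%:R / T%:R) ->
    fA s b q (phi u c t w) - ksg i c *: phi u c t (fA s b q w) =
    \sum_(k < N) binr F q k *: phi (act b k%:Z u) (i (+) c) (q + t - k%:R) w.
Proof.
move=> Hb Eb; have [N' HN'] := va_truncation Y_vsa (emb b) u.
exists `|N'|%N; split=> [k Hk|q t w Hq]; first by apply: HN'; lia.
have [L HL] := phi_loc u Hb Eb; have Fb := fA_fld Eb.
pose h m n : Fd := prodF (ksg i c) (fA s b) (phi u c) m n.
have hloc m n : L <= n -> h m n = 0 by move=> Hn; apply: HL.
have hrec m n q0 w0 : h m (n + 1) q0 w0 = h (m + 1) n q0 w0 - h m n (q0 + 1) w0.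
  exact: (prodF_rec charF T_gt0 cop).
have HN n : N' <= n -> phi (act b n u) (i (+) c) = 0.
  by move=> Hn; rewrite HN' // (lin0 phi_lin).
have Hlim n : exists K, forall k, (K <= k)%N ->
    h ((Pk k)%:R * (s%:R / T%:R)) n =
    zsh ((Pk k)%:R * (s%:R / T%:R)) (phi (act b n u) (i (+) c)).
  have [K HK] := phi_act n u Hb Eb; exists K => k Hk.
  have E : i (+) c (+) i = c by case: (i); case: (c).
  by rewrite (HK _ Hk) E zshA addrN zsh0.
have := hlim_inv charF T_gt0 cop hrec hloc HN (Tint_div T_gt0 s) Hlim 0 t w Hq.
rewrite /h (prodF0 charF T_gt0 cop) // => ->; rewrite (@nsumE _ _ _ `|N'|%N).
  by apply: eq_bigr => k _; rewrite add0r [t + q]addrC.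
by move=> k Hk; rewrite add0r HN ?scaler0 //; lia.
Qed.

(** The products of [phi u] with [phi (b_n0 v)] in terms of those of [phi u] and of the
    [phi (b_d u)] with [phi v]: this is [prodF_comm] at the exponent x = P s / T, for P a large
    power of p, where all binomial coefficients of x but the first vanish. *)
Lemma prodF_step i i' j s b u v n0 : b \in gpar i -> eigen s b ->
  exists N : nat, (forall k, (N <= k)%N -> act b k%:Z u = 0) /\
  exists K, forall k, (K <= k)%N -> forall m n,
  let x := (Pk k)%:R * (s%:R / T%:R) in
  prodF (ksg i' (i (+) j)) (phi u i') (phi (act b n0 v) (i (+) j)) m n =
  zsh (- x) (ksg i i' *: (prodF (ksg i (i' (+) j)) (fA s b)
       (prodF (ksg i' j) (phi u i') (phi v j) m n) x n0
     - \sum_(d < N) binr F n0%:~R d *: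
       (prodF (ksg (i (+) i') j) (phi (act b d%:Z u) (i (+) i')) (phi v j)
          (m + x) (n + n0 - d%:Z) : Fd) : Fd)).
Proof.
move=> Hb Eb; have [N [HN comm]] := fA_comm i u i' Hb Eb.
exists N; split=> //; have [K HK] := phi_act n0 v Hb Eb.
exists (maxn N K) => k; rewrite geq_max => /andP[h1 h2] m n x.
have E : i (+) j (+) i = j by case: (i); case: (j).
rewrite (HK _ h2) E prodF_zsh; congr zsh.
have Hx : congZ x (s%:R / T%:R) := Pk_cong charF cop k (Tint_div T_gt0 s).
have HI d : isfld (phi (act b d%:Z u) (i (+) i')) by [].
have HN' d : (N <= d)%N -> phi (act b d%:Z u) (i (+) i') = 0.
  by move=> /HN ->; rewrite (lin0 phi_lin).
have := prodF_comm charF T_gt0 cop (ksg i j) (ksg i' j) (fA_fld Eb) (phi_fld u i')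
  (phi_fld v j) HI HN' (ksg2 F i i') (Tint_div T_gt0 s) comm n n0 m Hx.
rewrite ksgDr (ksgC F i i') ksgDr ksgDl (ksgC F i' i) => ->.
have -> : forall X Y Z : Fd, Y = Z -> ksg i i' *: (ksg i i' *: X + Y - Z) = X.
  by move=> X Y' Z ->; rewrite addrK scalerA ksg2 scale1r.
  by [].
(* As N <= P, only the first binomial coefficient of the exponent x survives. *)
case: (N) h1 => [|N'] h1; first by rewrite !big_ord0.
rewrite big_ord_recl [X in _ + X]big1 ?addr0 => [|d _].
  by apply: eq_bigr => d _; rewrite binr0 mul1r.
rewrite big1 // => d' _; rewrite (binr_small charF T_gt0 cop) ?mul0r ?scale0r //.
  exact: Tint_div.
rewrite lift0 /=; apply: (@leq_ltn_trans k _ _ _ (Pk_gt charF T_gt0 k)).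
exact: leq_trans (ltn_ord d) (ltnW h1).
Qed.

Lemma zsh_lin x : lin (zsh x : Fd -> Fd). Proof. by []. Qed.

(** Locality of the images of two monomials. *)
Lemma mono_local j r' v : mono j r' v -> forall i r u, mono i r u ->
  exists N : int, forall n, N <= n -> forall m, prodF (ksg i j) (phi u i) (phi v j) m n = 0.
Proof.
elim=> [|{r' v}j i r' s b n0 v Hb Eb Hv IH] i' r u Hu.
  exists 0 => n Hn m; rewrite phi_vac ksg0r.
  exact: (prodF_idr_ge0 charF T_gt0 cop).
have [N [_ [K /(_ K (leqnn K)) H]]] := prodF_step i' j u v n0 Hb Eb.
have [N1 H1] := IH _ _ _ Hu.
have [N2 H2] : exists N2 : int, forall d, (d < N)%N -> forall n, N2 <= n -> forall m,
    prodF (ksg (i (+) i') j) (phi (act b d%:Z u) (i (+) i')) (phi v j) m n = 0.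
  elim: (N) => [|M' [N2 H2]]; first by exists 0.
  have [N3 H3] := IH _ _ _ (mono_act M'%:Z Hb Eb Hu).
  exists (Num.max N2 N3) => d; rewrite ltnS leq_eqVlt => /orP[/eqP ->|Hd] n; rewrite ge_max => /andP[h1 h2] m.
    exact: H3.
  exact: H2.
exists (Num.max N1 (N2 - n0 + N%:Z)) => n; rewrite ge_max => /andP[h1 h2] m.
rewrite H H1 // (prodF_zero _ _ _ (fA_fld Eb)) big1 ?subr0 ?scaler0 // => d _.
by rewrite H2 ?scaler0 //; have := ltn_ord d; lia.
Qed.

(** The image of a product of monomials is the Frobenius limit of the products of the images. *)
Lemma mono_limit j r' v : mono j r' v -> forall i r u, mono i r u ->
  forall n, exists K, forall k, (K <= k)%N ->
  prodF (ksg i j) (phi u i) (phi v j) ((Pk k)%:R * (r%:R / T%:R)) n =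
  zsh ((Pk k)%:R * (r%:R / T%:R)) (phi (Y u n v) (i (+) j)).
Proof.
elim=> [|{r' v}j i r' s b n0 v Hb Eb Hv IH] i' r u Hu n.
  case: (lerP 0 n) => Hn.
    exists 0%N => k _; rewrite phi_vac ksg0r (va_creation Y_vsa) //.
    by rewrite (lin0 phi_lin) (prodF_idr_ge0 charF T_gt0 cop).
  have [d ->] : exists d : nat, n = - d.+1%:Z by case: n Hn => // d _; exists d; rewrite NegzE.
  exists d => k Hk; rewrite phi_vac ksg0r addbF.
  have Hx := Pk_cong charF cop k (Tint_div T_gt0 r).
  rewrite (prodF_idr charF T_gt0 cop d _ Hx) //; last first.
    by move=> q w; exact: mono_off.
  rewrite (dd_zsh charF T_gt0 cop) ?(mono_dd d Hu) //; first exact: Tint_div.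
  exact: leq_ltn_trans Hk (Pk_gt charF T_gt0 k).
have [N [HN [K H]]] := prodF_step i' j u v n0 Hb Eb.
have [K1 H1] := IH _ _ _ Hu n.
have [K2 H2] := ev_all N (fun d => IH _ _ _ (mono_act d%:Z Hb Eb Hu) (n + n0 - d%:Z)).
have [K3 H3] := phi_act n0 (Y u n v) Hb Eb.
exists (maxn (maxn K K1) (maxn K2 K3)) => k.
rewrite !geq_max => /andP[/andP[h0 h1] /andP[h2 h3]].
have Ec : i' (+) j (+) i (+) i = i' (+) j by case: (i); case: (i'); case: (j).
have Ec' : i (+) i' (+) j = i' (+) j (+) i by case: (i); case: (i'); case: (j).
have Ec2 : i' (+) (i (+) j) = i' (+) j (+) i by case: (i); case: (i'); case: (j).
rewrite (H _ h0) H1 // prodF_zsh.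
set x := (Pk k)%:R * (s%:R / T%:R); set y := (Pk k)%:R * (r%:R / T%:R).
have := H3 _ h3 (i' (+) j (+) i); rewrite Ec -/x => E3.
have E4 : prodF (ksg i (i' (+) j)) (fA s b) (phi (Y u n v) (i' (+) j)) x n0 =
    zsh x (phi (act b n0 (Y u n v)) (i' (+) j (+) i)) by rewrite E3 zshA addrN zsh0.
rewrite E4 zshA.
have EY : \sum_(d < N) binr F n0%:~R d *: Y (act b d%:Z u) (n + n0 - d%:Z) v =
    act b n0 (Y u n v) - ksg i i' *: Y u n (act b n0 v).
  rewrite (Y_comm charF T_gt0 cop Y_vsa v n0 n (emb_par Hb) (mono_par Hu)).
  rewrite (@nsumE _ _ _ N) // => d Hd.
  by rewrite HN // (lin0 (Y_linl Y_vsa _ _)) scaler0.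
have -> : \sum_(d < N) binr F n0%:~R d *: (prodF (ksg (i (+) i') j)
      (phi (act b d%:Z u) (i (+) i')) (phi v j) (y + x) (n + n0 - d%:Z) : Fd) =
    zsh (y + x) (phi (act b n0 (Y u n v)) (i' (+) j (+) i) -
       ksg i i' *: phi (Y u n (act b n0 v)) (i' (+) j (+) i)) :> Fd.
  have -> : phi (act b n0 (Y u n v)) (i' (+) j (+) i) -
       ksg i i' *: phi (Y u n (act b n0 v)) (i' (+) j (+) i) =
     phi (act b n0 (Y u n v) - ksg i i' *: Y u n (act b n0 v)) (i' (+) j (+) i).
    by rewrite (linB phi_lin) (linZ phi_lin).
  rewrite -EY phi_sum (lin_sum (zsh_lin _)); apply: eq_bigr => d _.
  rewrite (linZ (zsh_lin _)); congr (_ *: _).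
  have Exy : y + x = (Pk k)%:R * ((s + r)%N%:R / T%:R) by rewrite /x /y natrD mulrDl mulrDr addrC.
  by rewrite Exy H2 // Ec'.
have AB (A B : Fd) : A - (A - B) = B by rewrite opprB addrC subrK.
rewrite -(linB (zsh_lin _)) AB.
by rewrite -(linZ (zsh_lin _)) scalerA ksg2 scale1r zshA addrC addrK addbA [in RHS]addbAC.
Qed.

Lemma nsum_comb (f h : nat -> M) e : (exists K, forall k, (K <= k)%N -> f k = 0) ->
  (exists K, forall k, (K <= k)%N -> h k = 0) ->
  nsum (fun k => e *: f k + h k) = e *: nsum f + nsum h.
Proof.
move=> [K HK] [L HL].
have Hf k : (maxn K L <= k)%N -> f k = 0 by rewrite geq_max => /andP[/HK].
have Hh k : (maxn K L <= k)%N -> h k = 0 by rewrite geq_max => /andP[_ /HL].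
rewrite (nsumE Hf) (nsumE Hh) (@nsumE _ _ _ (maxn K L)) => [|k Hk]; last first.
  by rewrite Hf // Hh // scaler0 addr0.
by rewrite scaler_sumr -big_split.
Qed.

(** The coefficients of the Jacobi identity, for u of parity i and degree r modulo T and for v
    of parity j, in terms of the components of parity i, j and i + j. *)
Definition jacPhi r i j u v := forall n m q w,
  prodF (ksg i j) (phi u i) (phi v j) m n q w =
  if congZ m (r%:R / T%:R) then
    nsum (fun k => binr F m k *: phi (Y u (n + k%:Z) v) (i (+) j) (q + m - k%:R) w)
  else 0.

Lemma mono_jacobi i j r r' u v : mono i r u -> mono j r' v -> jacPhi r i j u v.
Proof.
move=> Hu Hv n m q w; case: (boolP (congZ m (r%:R / T%:R))) => Hm; last first.
  have off q' w' : ~~ congZ q' (r%:R / T%:R) -> phi u i q' w' = 0 by exact: mono_off.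
  by rewrite (prodF_off _ _ (phi_fld v j) off Hm).
have [N HN] := mono_local Hv Hu; have [N' HN'] := va_truncation Y_vsa u v.
pose h m n : Fd := prodF (ksg i j) (phi u i) (phi v j) m n.
have hrec m' n' q0 w' : h m' (n' + 1) q0 w' = h (m' + 1) n' q0 w' - h m' n' (q0 + 1) w'.
  exact: (prodF_rec charF T_gt0 cop).
have hloc m' n' : N <= n' -> h m' n' = 0 by move=> Hn; apply: HN.
have HH n' : N' <= n' -> phi (Y u n' v) (i (+) j) = 0.
  by move=> Hn; rewrite HN' // (lin0 phi_lin).
exact: (hlim_inv charF T_gt0 cop hrec hloc HH (Tint_div T_gt0 r) (mono_limit Hv Hu) n q w Hm).
Qed.

Lemma jacPhi_trunc i j u v n m q w : exists K : nat, forall k, (K <= k)%N ->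
  binr F m k *: phi (Y u (n + k%:Z) v) (i (+) j) (q + m - k%:R) w = 0.
Proof.
have [N HN] := va_truncation Y_vsa u v; exists (`|N| + `|n|)%N => k Hk.
by rewrite HN ?(lin0 phi_lin) ?scaler0 //; lia.
Qed.

Lemma jacPhi_0l r i j v : jacPhi r i j 0 v.
Proof.
move=> n m q w; have Fv := phi_fld v j; have H0 := isfld0 T M.
have -> : phi 0 i = 0 by rewrite (lin0 phi_lin).
have E : prodF (ksg i j) (0 : Fd) (phi v j) m n = 0 :> Fd.
  by have := prodF_combl (ksg i j) (-1) m n H0 H0 Fv; rewrite scaler0 addr0 scaleN1r addNr.
rewrite E; case: ifP => // _; rewrite nsum0 // => k.
by rewrite (lin0 (Y_linl Y_vsa _ _)) (lin0 phi_lin) scaler0.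
Qed.

Lemma jacPhi_0r r i j u : jacPhi r i j u 0.
Proof.
move=> n m q w; have -> : phi 0 j = 0 by rewrite (lin0 phi_lin).
rewrite (prodF_zero _ _ _ (phi_fld u i)); case: ifP => // _; rewrite nsum0 // => k.
by rewrite (lin0 (Y_linr Y_vsa _ _)) (lin0 phi_lin) scaler0.
Qed.

Lemma congZ_modn m r : congZ m ((r %% T)%N%:R / T%:R) = congZ m (r%:R / T%:R).
Proof.
have T0 : T%:R != 0 :> rat by rewrite pnatr_eq0 -lt0n.
rewrite {2}(divn_eq r T) natrD natrM mulrDl mulfK // /congZ opprD addrCA.
by apply/idP/idP => H; [rewrite rpredD // rpredN natr_int | rewrite -[_ - _](addKr (- (r %/ T)%:R)) rpredD // opprK natr_int].
Qed.

Lemma jacPhi_combl r i j e u u' v : jacPhi r i j u v -> jacPhi r i j u' v ->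
  jacPhi r i j (e *: u + u') v.
Proof.
move=> H H' n m q w.
have -> : phi (e *: u + u') i = e *: phi u i + phi u' i by rewrite phi_lin.
rewrite (prodF_combl _ _ _ _ (phi_fld u i) (phi_fld u' i) (phi_fld v j)).
have -> : (e *: prodF (ksg i j) (phi u i) (phi v j) m n +
   prodF (ksg i j) (phi u' i) (phi v j) m n : Fd) q w =
   e *: prodF (ksg i j) (phi u i) (phi v j) m n q w + prodF (ksg i j) (phi u' i) (phi v j) m n q w by [].
rewrite H H'; case: ifP => _; last by rewrite scaler0 addr0.
rewrite -nsum_comb; try exact: jacPhi_trunc.
apply: eq_nsum => k; rewrite (Y_linl Y_vsa) phi_lin scalerA mulrC -scalerA -scalerDr.
by [].
Qed.

Lemma jacPhi_combr r i j e u v v' : jacPhi r i j u v -> jacPhi r i j u v' ->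
  jacPhi r i j u (e *: v + v').
Proof.
move=> H H' n m q w.
have -> : phi (e *: v + v') j = e *: phi v j + phi v' j by rewrite phi_lin.
rewrite (prodF_combr _ _ _ _ (phi_fld u i) (phi_fld v j) (phi_fld v' j)).
have -> : (e *: prodF (ksg i j) (phi u i) (phi v j) m n +
   prodF (ksg i j) (phi u i) (phi v' j) m n : Fd) q w =
   e *: prodF (ksg i j) (phi u i) (phi v j) m n q w + prodF (ksg i j) (phi u i) (phi v' j) m n q w by [].
rewrite H H'; case: ifP => _; last by rewrite scaler0 addr0.
rewrite -nsum_comb; try exact: jacPhi_trunc.
apply: eq_nsum => k; rewrite (Y_linr Y_vsa) phi_lin scalerA mulrC -scalerA -scalerDr.
by [].
Qed.

(** ** Decomposition into homogeneous monomials *)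

(** Monomials of parity i whose degree satisfies P. *)
Definition monos (P : nat -> Prop) i v := exists2 r, P r & mono i r v.

Lemma lspan_lin_ind (U : lmodType F) (G : U -> Prop) (P : U -> Prop) : P 0 ->
  (forall e x y, P x -> P y -> P (e *: x + y)) -> (forall x, G x -> P x) ->
  forall x, lspan G x -> P x.
Proof. by move=> P0 Pc PG x; elim=> // e y z Gy _ Pz; apply: Pc => //; exact: PG. Qed.

Lemma mono_span v : lspan (fun v => exists i, monos (fun=> True) i v) v.
Proof.
elim/V_ind: v => [|e u v|i s a n v Ha Ea].
- by apply: lspan1; exists false, 0%N => //; exact: mono_vac.
- exact: lspan_lin.
apply: (lspan_lin_ind (P := fun v => lspan _ (act a n v))).
- by rewrite (lin0 (Y_linr Y_vsa _ _)); exact: lspan0.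
- by move=> e x y Hx Hy; rewrite (Y_linr Y_vsa); exact: lspan_lin.
move=> x [j [r _ Hx]]; apply: lspan1; exists (i (+) j), (s + r)%N => //.
exact: mono_act.
Qed.

Lemma mono_span_eigen r v : (r < T)%N -> sigma v = eta ^+ r *: v ->
  lspan (fun v => exists i, monos (fun r' => r' %% T = r)%N i v) v.
Proof.
move=> Hr Ev; have L := lin_epr eta T sigma_lin r.
have := epr_id sigma_lin eta_prim TF Hr Hr Ev; rewrite eqxx => <-.
move: v (mono_span v) {Ev}; apply: lspan_lin_ind => [|e x y Hx Hy|x [i [r' _ Hx]]].
- by rewrite (lin0 L); exact: lspan0.
- by rewrite L; exact: lspan_lin.
have Ex : sigma x = eta ^+ (r' %% T) *: x by rewrite (prim_expr_mod eta_prim) (mono_sigma Hx).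
rewrite (epr_id sigma_lin eta_prim TF Hr (ltn_pmod _ T_gt0) Ex).
case: eqP => [E|_]; last exact: lspan0.
by apply: lspan1; exists i, r'.
Qed.

Lemma lspan_par P i v : lspan (monos P i) v -> par i v.
Proof.
move: v; apply: lspan_lin_ind => [|e x y|x [r _ Hx]]; first exact: (va_par_zero Y_vsa).
  exact: (va_par_linear Y_vsa).
exact: mono_par Hx.
Qed.

Lemma mono_span_par (P : nat -> Prop) i v :
  lspan (fun v => exists i, monos P i v) v -> par i v -> lspan (monos P i) v.
Proof.
move=> Hv; have [x [y [Hx Hy ->]]] : exists x y,
    [/\ lspan (monos P i) x, lspan (monos P (~~ i)) y & v = x + y].
  move: v Hv; apply: lspan_lin_ind => [|e v v' [x [y [Hx Hy ->]]] [x' [y' [Hx' Hy' ->]]]|v [j Hv]].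
  - by exists 0, 0; rewrite addr0; split=> //; exact: lspan0.
  - exists (e *: x + x'), (e *: y + y'); split; try exact: lspan_lin.
    by rewrite scalerDr addrACA.
  case: (eqVneq j i) => [E|ji].
    by exists v, 0; rewrite addr0; split; [rewrite -E; exact: lspan1 | exact: lspan0|].
  have E : j = ~~ i by move: ji; case: (i); case: (j).
  by exists 0, v; rewrite add0r; split; [exact: lspan0 | rewrite -E; exact: lspan1|].
move=> Hxy; suff -> : y = 0 by rewrite addr0.
have Hyi : par i y.
  by rewrite -[y](addKr x) -scaleN1r; apply: (va_par_linear Y_vsa) => //; exact: lspan_par Hx.
have Hy' := lspan_par Hy.
by case: (i) Hyi Hy' => h1 h2; apply: (va_par_direct Y_vsa).
Qed.

(** The image of a homogeneous element is homogeneous. *)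
Lemma phi_par i v : par i v -> phi v (~~ i) = 0.
Proof.
move=> /(mono_span_par (mono_span v)); move: v; apply: lspan_lin_ind => [|e x y Hx Hy|x [r _ Hx]].
- by rewrite (lin0 phi_lin).
- have -> : phi (e *: x + y) (~~ i) = e *: phi x (~~ i) + phi y (~~ i) by rewrite phi_lin.
  by rewrite Hx Hy scaler0 addr0.
exact: mono_phi0 Hx.
Qed.

(** ** The twisted module *)

(** The twisted vertex operators: the sum of the even and of the odd component. *)
Definition YM v q w := phi v false q w + phi v true q w.

Lemma YM_par i v q w : par i v -> YM v q w = phi v i q w.
Proof.
by move=> /phi_par; rewrite /YM; case: (i) => /= ->; rewrite ?add0r ?addr0.
Qed.

Lemma YM_jacobi r i j u v w : (r < T)%N -> sigma u = eta ^+ r *: u ->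
  par i u -> par j v -> jacobi Y YM (r%:R / T%:R) ((-1) ^+ (i && j)) u v w.
Proof.
move=> Hr Eu Pu Pv; apply/jacobiP => [q w'|].
  by rewrite /YM (lin0 phi_lin) addr0.
have J : jacPhi r i j u v.
  have Su := mono_span_par (mono_span_eigen Hr Eu) Pu; move: u Su {Eu Pu}; apply: lspan_lin_ind => [|e x y|u [r' Er Hu]].
  - exact: jacPhi_0l.
  - exact: jacPhi_combl.
  have Sv := mono_span_par (mono_span v) Pv; move: v Sv {Pv}; apply: lspan_lin_ind => [|e x y|v [s _ Hv]].
  - exact: jacPhi_0r.
  - exact: jacPhi_combr.
  by rewrite /jacPhi -Er => n m q w'; rewrite congZ_modn; exact: (mono_jacobi Hu Hv).
move=> n m q; have := J n m q w.
have Efun x i' : par i' x -> YM x = phi x i'.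
  by move=> Px; apply: funext => q'; apply: funext => w'; exact: YM_par.
rewrite (Efun u i Pu) (Efun v j Pv) => ->; case: ifP => // _; apply: eq_nsum => k.
by rewrite (YM_par _ _ (va_par_modes Y_vsa (n + k%:Z) Pu Pv)).
Qed.

Lemma YM_twisted : is_twisted_module par vac Y sigma eta T YM.
Proof.
split.
- by move=> e u v q w; rewrite /YM phi_lin scalerDr addrACA.
- by move=> u q e v w; rewrite /YM !(fld_lin (phi_fld u _)) scalerDr addrACA.
- by move=> u q w Hq; rewrite /YM !(fld_T (phi_fld u _)) ?addr0.
- move=> r u q w Hr Eu Hq; rewrite /YM.
  have H c : phi u c q w = 0.
    have Su := mono_span_eigen Hr Eu; move: u Su {Eu}; apply: lspan_lin_ind => [|e x y Hx Hy|u [i [r' Er Hu]]].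
    - by rewrite (lin0 phi_lin).
    - have -> : phi (e *: x + y) c q w = e *: phi x c q w + phi y c q w by rewrite phi_lin.
      by rewrite Hx Hy scaler0 addr0.
    case: (eqVneq c i) => [->|ci].
      by apply: (mono_off _ Hu); rewrite -congZ_modn Er.
    have -> : c = ~~ i by move: ci; case: (i); case: (c).
    by rewrite (mono_phi0 Hu).
  by rewrite !H addr0.
- move=> r u w _ _.
  have [q0 H0] := fld_tr (phi_fld u false) w; have [q1 H1] := fld_tr (phi_fld u true) w.
  exists (Num.max q0 q1) => q; rewrite ge_max => /andP[h0 h1].
  by rewrite /YM H0 // H1 // addr0.
- by move=> q w; rewrite /YM phi_vac addr0 idFE.
- by move=> r i j u v w; exact: YM_jacobi.
Qed.

Lemma YM_emb j s a q w : a \in gpar j -> eigen s a -> YM (emb a) q w = fA s a q w.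
Proof.
move=> Ha Ea; rewrite (YM_par _ _ (emb_par Ha)) -(va_creation_const Y_vsa (emb a)).
have [K /(_ K (leqnn K)) ->] := phi_act (-1) vac Ha Ea.
have Hx := Pk_cong charF cop K (Tint_div T_gt0 s).
rewrite addbb phi_vac ksg0r.
rewrite (prodF_idr charF T_gt0 cop 0 (fA_fld Ea) Hx) ?dd0 ?zshA ?addNr ?zsh0 //.
exact: fA_off.
Qed.

End Twisted.

(** * The twisted module structure *)

(** For a module V of the affine superalgebra which is generated by a vector [vac] on which k acts
    as l. The induced module is used through these properties only. *)
Section InducedSpan.
Variables (F : fieldType) (p : nat) (charF : p \in [pchar F]).
Variables (g : vectType F) (gpar : bool -> {vspace g}) (br : g -> g -> g).
Hypothesis g_lie : is_lie_superalgebra gpar br.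
Variables (form : g -> g -> F) (tau : 'End(g)) (tau_aut : is_lie_automorphism gpar br tau).
Variables (T : nat) (cop : coprime T p).
Hypothesis tau_iter : forall a, iter T tau a = a.
Variables (eta : F) (eta_prim : T.-primitive_root eta) (l : F).
Variables (V : lmodType F) (vac : V) (Va : affine g int -> V -> V).
Hypothesis Va_linl : forall v, lin (fun x => Va x v).
Hypothesis Va_linr : forall x, lin (Va x).
Hypothesis Va_bracket : forall i j x y v, affine_par gpar i x -> affine_par gpar j y ->
  Va x (Va y v) - (-1) ^+ (i && j) *: Va y (Va x v) = Va (affine_br gpar br form intr x y) v.
Hypothesis Va_kk_vac : Va kk vac = l *: vac.
Hypothesis Va_ind : forall P : V -> Prop, P vac ->
  (forall c u v, P u -> P v -> P (c *: u + v)) ->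
  (forall x v, P v -> P (Va x v)) -> forall v, P v.
Local Notation eigen := (eigen tau eta).
Local Notation prg := (prg gpar tau T eta).
Implicit Types (a b : g) (u v : V) (n : int) (i j c : bool) (r s : nat).

Lemma tens_par (K : choiceType) i a (k : K) : a \in gpar i -> affine_par gpar i (tens a k).
Proof.
move=> Ha; split=> // x; rewrite mcoeffU; case: (k =P x) => _; rewrite ?mulr1n //.
by rewrite mulr0n mem0v.
Qed.

Lemma affine_map_tens a n : affine_map tau (tens a n) = tens (tau a) n :> affine g int.
Proof.
congr (_, _); have H : forall k : int, lin (fun a : g => << tau a *g k >> : loop g int).
  by move=> k e x y; rewrite linearP lin_malgU.
exact: (suppsum_U (G := fun (k : int) a => << tau a *g k >> : loop g int) a n H).
Qed.

Lemma affine_prg (x : affine g int) :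
  x = x.2 *: kk + \sum_(n <- msupp x.1) \sum_i \sum_(r < T) tens (prg i r x.1@_n) n.
Proof.
have -> : \sum_(n <- msupp x.1) \sum_i \sum_(r < T) tens (prg i r x.1@_n) n = (x.1, 0) :> affine g int.
  transitivity (\sum_(n <- msupp x.1) tens x.1@_n n : affine g int).
    apply: eq_bigr => n _; under eq_bigr => i _ do rewrite -(lin_sum (tens_lin n)).
    by rewrite -(lin_sum (tens_lin n)) (prg_sum charF g_lie tau cop eta_prim).
  have E2 (t : seq int) : \sum_(n <- t) tens x.1@_n n = (\sum_(n <- t) << x.1@_n *g n >>, 0) :> affine g int.
    by elim: t => [|n t IH]; rewrite ?big_nil // !big_cons IH; congr (_, _); rewrite /= addr0.
  by rewrite E2 -monalgE.
by case: x => f e; congr (_, _); rewrite /= ?scaler0 ?add0r // addr0 -[e *: _]/(e * _) mulr1.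
Qed.

Let V_ind_kk (P : V -> Prop) : P vac ->
  (forall e u v, P u -> P v -> P (e *: u + v)) -> (forall v, P v -> P (Va kk v)) ->
  (forall i s a n v, a \in gpar i -> eigen s a -> P v -> P (Va (tens a n) v)) ->
  forall v, P v.
Proof.
move=> Pv Pc Pk Pt; apply: Va_ind => // x v Hv.
have P0 : P 0.
  by rewrite -[0](subrr vac) addrC -scaleN1r; apply: Pc.
have L := Va_linl v.
have Psum (I : Type) (t : seq I) (f : I -> affine g int) : (forall k, P (Va (f k) v)) -> P (Va (\sum_(k <- t) f k) v).
  move=> H; elim: t => [|k t IH]; first by rewrite big_nil (lin0 L).
  by rewrite big_cons -[f k]scale1r L; apply: Pc.
rewrite (affine_prg x) L; apply: Pc; first exact: Pk.
apply: (Psum) => n; apply: (Psum) => i; apply: (Psum) => r.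
by apply: (Pt i r) => //; [exact: prg_in | exact: (prg_eigen g_lie tau_aut tau_iter eta_prim)].
Qed.

Lemma Va_kk v : Va kk v = l *: v.
Proof.
move: v; apply: V_ind_kk => [|e u v IHu IHv|v IH|i s a n v Ha _ IH].
- exact: Va_kk_vac.
- by rewrite Va_linr IHu IHv scalerDr !scalerA mulrC.
- by rewrite IH (linZ (Va_linr _)) IH.
have kk_par : affine_par gpar false (kk : affine g int) by split=> // k; rewrite mcoeff0 mem0v.
have := Va_bracket v kk_par (tens_par n Ha); rewrite /= expr0 scale1r affine_br_kkl.
by rewrite (lin0 (Va_linl v)) IH (linZ (Va_linr _)) => /eqP; rewrite subr_eq0 => /eqP.
Qed.

(** V is spanned by the monomials in the a (x) t ^ n with [a] homogeneous for the parity and for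
    tau. *)
Lemma V_ind_hom (P : V -> Prop) : P vac ->
  (forall e u v, P u -> P v -> P (e *: u + v)) ->
  (forall i s a n v, a \in gpar i -> eigen s a -> P v -> P (Va (tens a n) v)) ->
  forall v, P v.
Proof.
move=> Pv Pc Pt; apply: (V_ind_kk) => // v Hv; rewrite Va_kk.
by rewrite -[_ *: _]addr0; apply: (Pc) => //; rewrite -[0](subrr vac) addrC -scaleN1r; apply: Pc.
Qed.

End InducedSpan.

Lemma Vemb_par (F : fieldType) (g : vectType F) (gpar : bool -> {vspace g}) (br : g -> g -> g)
  (form : g -> g -> F) (l : F) i b : b \in gpar i -> @Vpar F g gpar br form l i (Vemb gpar br form l b).
Proof.
by move=> Hb; rewrite -[i]addbF; apply: Vpar_act; [exact: tens_par | exact: Vpar_vac].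
Qed.

Theorem theorem5p2
  (F : closedFieldType) (p : nat) (charF : p \in [pchar F]) (p_gt2 : (2 < p)%N)
  (g : vectType F) (gpar : bool -> {vspace g}) (br : g -> g -> g)
  (g_lie : is_lie_superalgebra gpar br)
  (g_odd : forall u v, u \in gpar true -> v \in gpar true -> br u v = 0)
  (form : g -> g -> F) (form_g : is_invariant_form gpar br form)
  (tau : 'End(g)) (tau_aut : is_lie_automorphism gpar br tau)
  (tau_form : forall a b, form (tau a) (tau b) = form a b)
  (T : nat) (tau_order : has_order tau T) (coprime_T : coprime T p)
  (eta : F) (eta_prim : T.-primitive_root eta)
  (l : F)
  (Y : Vaff gpar br form l -> int -> Vaff gpar br form l -> Vaff gpar br form l)
  (Y_vsa : is_vertex_superalgebra
             (@Vpar F g gpar br form l) (Vvac gpar br form l) Y)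
  (Y_g : forall (a : g) (n : int) (v : Vaff gpar br form l),
           Y (Vemb gpar br form l a) n v = Vact (tens a n) v)
  (sigma : Vaff gpar br form l -> Vaff gpar br form l)
  (sigma_ind : induced_automorphism tau sigma)
  (M : lmodType F) (rho : affine g rat -> M -> M)
  (rho_mod : is_affine_module gpar br form (ratr : rat -> F)
               (twisted_affine tau eta T) rho)
  (rho_level : has_level rho l)
  (rho_trunc : locally_truncated tau eta T rho) :
  exists YM : Vaff gpar br form l -> rat -> M -> M,
    is_twisted_module
      (@Vpar F g gpar br form l) (Vvac gpar br form l) Y sigma eta T YM /\
    (forall (i : nat) (a : g) (q : rat) (w : M), (i < T)%N -> eigen tau eta i a ->
       YM (Vemb gpar br form l a) q w = tau_field T rho i a q w).

Proof.
have T_gt0 : (0 < T)%N := prim_order_gt0 eta_prim.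
have tau_iter a : iter T tau a = a by have [_ /(_ T)[_ H]] := tau_order; apply: H; exact: dvdnn.
(* Pairs of fields, those local to the fields a_tau, the action on them and the identity field. *)
pose U := bool -> field_ M.
pose Wp : U -> Prop := inW gpar tau T eta rho.
pose ac : affine g int -> U -> U := act p gpar tau T eta l rho.
pose wv : U := w0 (M := M).
have Wc d be ga : Wp be -> Wp ga -> Wp (d *: be + ga).
  exact: (inW_comb eta_prim rho_mod rho_trunc).
have aW x be : Wp be -> Wp (ac x be).
  exact: (act_W charF g_lie form_g tau_aut tau_form coprime_T tau_iter eta_prim rho_mod rho_level rho_trunc).
have al c x y be : Wp be -> ac (c *: x + y) be = c *: ac x be + ac y be.
  exact: (act_linl charF g_lie tau_aut coprime_T tau_iter eta_prim l rho_mod rho_trunc).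
have ar x c be ga : Wp be -> Wp ga -> ac x (c *: be + ga) = c *: ac x be + ac x ga.
  exact: (act_linr charF g_lie tau_aut coprime_T tau_iter eta_prim l rho_mod rho_trunc).
have ab i j x y be : affine_par gpar i x -> affine_par gpar j y -> Wp be ->
    ac (affine_br gpar br form intr x y) be =
    ac x (ac y be) - (-1) ^+ (i && j) *: ac y (ac x be).
  exact: (act_br charF g_lie form_g tau_aut tau_form coprime_T tau_iter eta_prim rho_mod rho_level rho_trunc).
have Ww : Wp wv by exact: (inW_w0 charF coprime_T eta_prim rho_mod rho_trunc).
have aw x : nonneg_part x -> ac x wv = (l * x.2) *: wv.
  exact: (act_w0 charF g_lie tau_aut coprime_T tau_iter eta_prim l rho_mod rho_trunc).
pose phi : Vaff gpar br form l -> U := uphi ac wv.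
have phi_lin : lin phi := uphi_lin Wc aW al ar ab Ww aw.
have phi_W v : Wp (phi v) := uphi_W Wc aW Ww v.
have phi_vac : phi (Vvac gpar br form l) = wv := uphi_vac Wc aW al ar ab Ww aw.
have phi_Vact x v : phi (Vact x v) = ac x (phi v) := uphi_act Wc aW al ar ab Ww aw x v.
have phi_fld v c : isfld T (phi v c) by exact: W_fld (phi_W v) c.
have phi_loc i s b v : b \in gpar i -> eigen tau eta s b -> exists N : int, forall n, N <= n ->
    forall m c, prodF (ksg F i c) (fldA T rho s b) (phi v c) m n = 0.
  by move=> Hb Eb; exact: (W_loc (phi_W v) Hb Eb).
have phi_act i s b n v : b \in gpar i -> eigen tau eta s b ->
  exists K, forall k, (K <= k)%N -> forall c, phi (Y (Vemb gpar br form l b) n v) c =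
    zsh (- ((Pk p T k)%:R * (s%:R / T%:R)))
      (prodF (ksg F i (c (+) i)) (fldA T rho s b) (phi v (c (+) i)) ((Pk p T k)%:R * (s%:R / T%:R)) n).
  move=> Hb Eb; rewrite Y_g phi_Vact /ac.
  rewrite (act_tens charF g_lie tau_aut coprime_T tau_iter eta_prim l rho_mod rho_trunc n Hb Eb (phi_W v)).
  have [K HK] := Fop_ev charF coprime_T eta_prim rho_mod rho_trunc n Hb Eb (phi_W v).
  by exists K => k Hk c; rewrite -(HK k Hk).
have Y_ind (P : Vaff gpar br form l -> Prop) : P (Vvac gpar br form l) ->
  (forall e u v, P u -> P v -> P (e *: u + v)) ->
  (forall i s a n v, a \in gpar i -> eigen tau eta s a -> P v -> P (Y (Vemb gpar br form l a) n v)) ->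
  forall v, P v.
  move=> Pv Pc Pt.
  apply: (V_ind_hom charF g_lie tau_aut coprime_T tau_iter eta_prim (@Vact_linl _ _ _ _ _ l)
    (@Vact_linr _ _ _ _ _ l) (fun i j x y v => @Vact_bracket _ _ _ _ _ l i j x y v) _
    (@Vaff_ind _ _ _ _ _ l)) => //.
    have E := @Vact_nonneg _ _ gpar br form l kk; rewrite mulr1 in E; apply: E.
    by move=> n _; rewrite mcoeff0.
  by move=> i s a n v Ha Ea Hv; rewrite -Y_g; exact: (Pt i s).
have sigma_lin : lin sigma by move=> c x y; exact: (ind_linear sigma_ind).
have sigma_act s a n v : eigen tau eta s a ->
    sigma (Y (Vemb gpar br form l a) n v) = eta ^+ s *: Y (Vemb gpar br form l a) n (sigma v).
  move=> Ea; rewrite !Y_g (ind_act sigma_ind) affine_map_tens Ea.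
  by rewrite (linZ (tens_lin n)) (linZ (Vact_linl (sigma v))).
have fA_fld r a : eigen tau eta r a -> isfld T (fldA T rho r a).
  exact: (isfld_fldA eta_prim rho_mod rho_trunc).
have fA_off r a q w : ~~ congZ q (r%:R / T%:R) -> fldA T rho r a q w = 0 by exact: fldA_off.
have emb_par := @Vemb_par F g gpar br form l.
have tw := YM_twisted charF coprime_T eta_prim Y_vsa emb_par Y_ind sigma_lin
  (ind_vac sigma_ind) sigma_act fA_fld phi_lin phi_fld phi_vac phi_act phi_loc.
exists (YM phi); split=> // i a q w Hi Ea.
have hom j b : b \in gpar j -> eigen tau eta i b ->
    YM phi (Vemb gpar br form l b) q w = fldA T rho i b q w.
  exact: (YM_emb charF coprime_T eta_prim Y_vsa emb_par Y_ind fA_fld fA_off phi_lin phi_vac phi_act).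
(* The fields of the elements of g are known for homogeneous parities, hence in general. *)
have Ep j : eigen tau eta i (par_part gpar j a).
  by rewrite /eigen (tau_par g_lie tau_aut) Ea (linZ (par_part_lin gpar j)).
rewrite -(par_part_sum g_lie a) -[par_part gpar false a]scale1r.
have -> : Vemb gpar br form l (1 *: par_part gpar false a + par_part gpar true a) =
    1 *: Vemb gpar br form l (par_part gpar false a) + Vemb gpar br form l (par_part gpar true a).
  by rewrite /Vemb tens_lin Vact_linl.
apply: etrans (tm_linearl tw _ _ _ _ _) _.
apply: etrans (congr2 (fun x y => 1 *: x + y)
  (hom false _ (par_part_in gpar false a) (Ep false)) (hom true _ (par_part_in gpar true a) (Ep true))) _.
have E := fldA_comb eta_prim rho_mod 1 (Ep false) (Ep true).
by rewrite -[RHS]/(fldA T rho i (1 *: par_part gpar false a + par_part gpar true a) q w) E.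
Qed.
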